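(* For each $n\ge 2$ let $p=p(n)\ge 1$ be an integer, and let $X_1,\ldots,X_n$ be independent and identically distributed random vectors in $\mathbb{R}^p$ whose components $X_i(k)$, $1\le k\le p$, are independent random variables that have a density with respect to the Lebesgue measure on $\mathbb{R}$. Let $\boldsymbol{\tau}$ be the $p\times p$ empirical Kendall matrix of $X_1,\ldots,X_n$, with entries $$\boldsymbol{\tau}_{kl}=\frac{1}{\binom{n}{2}}\sum_{1\le i<j\le n}\operatorname{sign}\big(X_i(k)-X_j(k)\big)\cdot\operatorname{sign}\big(X_i(l)-X_j(l)\big),\qquad 1\le k,l\le p.$$ Then, as $n\to\infty$ and $\frac{p}{n}\to\gamma>0$, the empirical spectral distribution of $\boldsymbol{\tau}$ converges in probability (with respect to weak convergence of probability measures on $\mathbb{R}$) to the law of $$\frac{2}{3}Y+\frac{1}{3},$$ where $Y$ is distributed according to the standard Marčenko–Pastur law with parameter $\gamma$.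
   Context: Here $x(k)$ denotes the $k$th coordinate of a vector $x$, and $\operatorname{sign}$ is the sign function with the convention $\operatorname{sign}(0)=1$. The empirical spectral distribution of a symmetric $p\times p$ matrix with eigenvalues $\lambda_1,\ldots,\lambda_p$ is the probability measure $\frac1p\sum_{k=1}^p\delta_{\lambda_k}$ on $\mathbb{R}$. The standard Marčenko–Pastur law with parameter $\gamma\in(0,\infty)$ is the probability measure on $\mathbb{R}$ with density $p_\gamma(x)=\frac{1}{2\pi x\gamma}\sqrt{(b-x)(x-a)}$ for $a\le x\le b$ and $p_\gamma(x)=0$ otherwise, where $a=(1-\sqrt\gamma)^2$ and $b=(1+\sqrt\gamma)^2$, together with a point mass $1-\frac1\gamma$ at the origin if $\gamma>1$. *)

(* Defs.v *)
From HB Require Import structures.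
From mathcomp Require Import all_boot all_order all_algebra.
From mathcomp Require Import all_classical all_reals all_analysis.
From mathcomp Require Import measurable_realfun.
From mathcomp.real_closed Require complex.

Set Implicit Arguments.
Unset Strict Implicit.
Unset Printing Implicit Defensive.

Import Order.TTheory GRing.Theory Num.Theory.
Import numFieldNormedType.Exports.
Local Open Scope classical_set_scope.
Local Open Scope ring_scope.

Section Probability.
Context d d' (T : measurableType d) (T' : measurableType d') (R : realType).
Variable P : probability T R.

Definition mutually_independent (I : finType) (X : I -> T -> T') : Prop :=
  forall (J : {set I}) (B : I -> set T'),
    (forall i, measurable (B i)) ->
    (P (\bigcap_(i in [set` J]) (X i @^-1` B i)) =
     \prod_(i in J) P (X i @^-1` B i))%E.

Definition identically_distributed (I : Type) (X : I -> T -> T') : Prop :=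
  forall (i j : I) (B : set T'), measurable B ->
    P (X i @^-1` B) = P (X j @^-1` B).

End Probability.

Definition has_density d (T : measurableType d) (R : realType)
    (P : probability T R) (X : T -> R) : Prop :=
  exists f : R -> R,
    [/\ measurable_fun [set: R] f,
        forall x, 0 <= f x
      & forall B : set R, measurable B ->
          P (X @^-1` B) = (\int[lebesgue_measure]_(x in B) (f x)%:E)%E].

(* Unlike [Num.sg], the value at 0 is 1. *)
Definition sign (R : realType) (x : R) : R := if 0 <= x then 1 else -1.

Definition kendall (R : realType) (n p : nat) (x : 'I_n -> p.-tuple R) :
    'M[R]_p :=
  \matrix_(k < p, l < p)
    (('C(n, 2))%:R^-1 *
     \sum_(i < n) \sum_(j < n | (i < j)%N)
        sign (tnth (x i) k - tnth (x j) k) * sign (tnth (x i) l - tnth (x j) l)).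

Lemma kendall_sym (R : realType) (n p : nat) (x : 'I_n -> p.-tuple R) :
  (kendall x)^T = kendall x.
Proof.
apply/matrixP => k l; rewrite !mxE; congr (_ * _).
by apply: eq_bigr => i _; apply: eq_bigr => j _; rewrite mulrC.
Qed.

(* The eigenvalues of a symmetric matrix, repeated according to their
   multiplicities; [eigenvaluesP] below shows that a sequence as required
   exists when [A] is symmetric. It is unique up to reordering, and nothing
   below depends on the order. *)
Definition eigenvalues (R : realType) (p : nat) (A : 'M[R]_p) : seq R :=
  xget [::] [set s | char_poly A = \prod_(x <- s) ('X - x%:P)].

Section Eigenvalues.
Import complex.

Lemma eigenvaluesP (R : realType) (p : nat) (A : 'M[R]_p) : A^T = A ->
  char_poly A = \prod_(x <- eigenvalues A) ('X - x%:P).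
Proof.
move=> symA.
pose f : {rmorphism R -> (complex R)} := real_complex R.
pose C : 'M[complex R]_p := map_mx f A.
have fR x : f x \is Num.real by rewrite complex_real.
have Creal : C \is a mxOver Num.real by apply/mxOverP => i j; rewrite mxE.
have Csym : C \is symmetricmx.
  by apply/is_hermitianmxP; rewrite expr0 scale1r map_mx_id// map_trmx symA.
have Cherm : C \is hermsymmx by apply: realsym_hermsym.
have /hermitian_normalmx/orthomx_spectralP CE := Cherm.
have Dreal := hermitian_spectral_diag_real Cherm.
set D := spectral_diag C in CE Dreal.
set Q := spectralmx C in CE.
have Qu : Q \in unitmx by exact: spectral_unit.
pose s := [seq complex.Re (D 0 i) | i <- enum 'I_p].
have fDE i : f (complex.Re (D 0 i)) = D 0 i.
  by apply: RRe_real; have /mxOverP := Dreal; apply.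
have charC : char_poly C = \prod_(i < p) ('X - (D 0 i)%:P).
  have diagE : char_poly (diag_mx D) = \prod_(i < p) ('X - (D 0 i)%:P).
    rewrite char_poly_trig ?diag_mx_is_trig//.
    by apply: eq_bigr => i _; rewrite mxE eqxx mulr1n.
  rewrite -diagE CE /char_poly /char_poly_mx.
  have QQ : map_mx polyC (invmx Q) *m map_mx polyC Q = 1%:M.
    by rewrite -map_mxM mulVmx// map_mx1.
  have -> : 'X%:M - map_mx polyC (invmx Q *m diag_mx D *m Q) =
      map_mx polyC (invmx Q) *m ('X%:M - map_mx polyC (diag_mx D)) *m
      map_mx polyC Q.
    rewrite !map_mxM mulmxBr mulmxBl; congr (_ - _).
    by rewrite -mulmxA -scalar_mxC mulmxA QQ mul1mx.
  by rewrite !det_mulmx mulrAC -det_mulmx QQ det1 mul1r.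
suff H : char_poly A = \prod_(x <- s) ('X - x%:P).
  exact: (@xgetPex _ [::] [set s | char_poly A = \prod_(x <- s) ('X - x%:P)]
    (ex_intro _ s H)).
apply: (@map_poly_inj _ _ f); rewrite map_char_poly charC rmorph_prod.
rewrite big_map big_enum/=; apply: eq_bigr => i _.
by rewrite rmorphB/= map_polyX map_polyC/= fDE.
Qed.
End Eigenvalues.

Definition esd (R : realType) (p : nat) (A : 'M[R]_p) :
    {measure set R -> \bar R} :=
  mscale ((p%:R : R)^-1)%:nng
    (msum (fun k => \d_((eigenvalues A)`_k)) (size (eigenvalues A))).

Lemma esdT (R : realType) (p : nat) (A : 'M[R]_p) : (0 < p)%N -> A^T = A ->
  esd A [set: R] = 1%E.
Proof.
move=> p0 symA; have sE : size (eigenvalues A) = p.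
  have := congr1 (fun q : {poly R} => size q) (eigenvaluesP symA).
  by rewrite size_char_poly size_prod_XsubC => -[].
rewrite /esd/= /mscale/= /msum.
rewrite (eq_bigr (fun=> 1%E)); last by move=> i _; exact: diracT.
rewrite sE sumEFin sumr_const card_ord -EFinM mulVf//.
by rewrite pnatr_eq0 -lt0n.
Qed.

Section MarchenkoPastur.
Variables (R : realType) (gamma : R).

Definition mp_a : R := (1 - Num.sqrt gamma) ^+ 2.
Definition mp_b : R := (1 + Num.sqrt gamma) ^+ 2.

(* The convention [0^-1 = 0] only intervenes at [x = 0] when [gamma = 1]. *)
Definition mp_density (x : R) : R :=
  if (mp_a <= x) && (x <= mp_b)
  then (2 * pi * x * gamma)^-1 * Num.sqrt ((mp_b - x) * (x - mp_a))
  else 0.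

Lemma mp_density_ge0 x : 0 <= mp_density x.
Proof.
rewrite /mp_density; case: ifP => // /andP[ax xb].
have x0 : 0 <= x by apply: le_trans ax; exact: sqr_ge0.
have [g0|g0] := leP 0 gamma.
  by rewrite mulr_ge0 ?sqrtr_ge0// invr_ge0 !mulr_ge0// pi_ge0.
have s0 : Num.sqrt gamma = 0 by rewrite ler0_sqrtr// ltW.
have -> : x = 1.
  apply/eqP; rewrite eq_le; apply/andP; split.
    by move: xb; rewrite /mp_b s0 addr0 expr1n.
  by move: ax; rewrite /mp_a s0 subr0 expr1n.
by rewrite /mp_a /mp_b s0 addr0 subr0 expr1n subrr mul0r sqrtr0 mulr0.
Qed.

Lemma measurable_mp_density : measurable_fun [set: R] mp_density.
Proof.
have minv : measurable_fun [set: R] (fun x : R => x^-1).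
  rewrite -(setUv [set (0 : R)]).
  apply/measurable_funU => //; first exact: measurableC.
  split; first exact: measurable_fun_set1.
  apply: open_continuous_measurable_fun; first by rewrite openC; exact: closed_eq.
  by move=> x; rewrite inE/= => /eqP x0; exact: inv_continuous.
have msqrt : measurable_fun [set: R] (@Num.sqrt R).
  by apply: continuous_measurable_fun; exact: sqrt_continuous.
apply: measurable_fun_ifT => //=.
  apply: measurable_and.
    exact: measurable_fun_ler.
  exact: measurable_fun_ler.
apply: measurable_funM.
  apply: (measurableT_comp minv).
  by apply: measurable_funM => //; apply: measurable_funM.
apply: (measurableT_comp msqrt).
by apply: measurable_funM; apply: measurable_funB.
Qed.

Definition mp_ac (B : set R) : \bar R :=
  (\int[lebesgue_measure]_(x in B) (mp_density x)%:E)%E.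

Let mp_ac0 : mp_ac set0 = 0%E.
Proof. by rewrite /mp_ac integral_set0. Qed.

Let mp_ac_ge0 B : (0 <= mp_ac B)%E.
Proof. by apply: integral_ge0 => x _; rewrite lee_fin mp_density_ge0. Qed.

Let mp_ac_sigma_additive : semi_sigma_additive mp_ac.
Proof.
move=> /= F mF tF mUF; rewrite /mp_ac; apply: cvg_toP.
  apply: ereal_nondecreasing_is_cvgn => m n mn.
  by apply: lee_sum_nneg_natr => // k _ _; exact: mp_ac_ge0.
rewrite ge0_integral_bigcup//=.
- apply: measurable_funTS; apply: measurableT_comp => //.
  exact: measurable_mp_density.
- by move=> x _; rewrite lee_fin mp_density_ge0.
Qed.

HB.instance Definition _ := isMeasure.Build _ _ _ mp_ac
  mp_ac0 mp_ac_ge0 mp_ac_sigma_additive.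

Definition mp_atom : R := if 1 < gamma then 1 - gamma^-1 else 0.

Lemma mp_atom_ge0 : 0 <= mp_atom.
Proof.
rewrite /mp_atom; case: ifP => // g1.
by rewrite subr_ge0 invf_le1 ?ltW// (lt_trans ltr01).
Qed.

Definition marchenko_pastur : {measure set R -> \bar R} :=
  measure_add mp_ac (mscale (NngNum mp_atom_ge0) \d_(0 : R)).

End MarchenkoPastur.

Section AffineLaw.
Variables (R : realType) (mu : {measure set R -> \bar R}) (a b : R).

(* The law of [a * Y + b] when [Y] has law [mu]. *)
Definition affine_law : set R -> \bar R :=
  pushforward mu (fun y : R => a * y + b).

Let measurable_affine : measurable_fun [set: R] (fun y : R => a * y + b).
Proof. by apply: measurable_funD => //; exact: measurable_funM. Qed.

HB.instance Definition _ := Measure.copy affine_law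
  (@measure_function_pushforward__canonical__measure_function_Measure
     _ _ _ _ _ mu _ measurable_affine).

End AffineLaw.

(* The random measures [mu_ n] may live on different probability spaces. *)
Definition weakly_cvg_in_probability (R : realType) (d : nat -> measure_display)
    (T : forall n, measurableType (d n)) (P : forall n, probability (T n) R)
    (mu_ : forall n, T n -> {measure set R -> \bar R})
    (mu : {measure set R -> \bar R}) : Prop :=
  forall f : R -> R, continuous f -> bounded_fun f ->
  forall eps : R, 0 < eps ->
    (fun n => P n [set w |
       eps <= `| \int[mu_ n w]_x f x - \int[mu]_x f x |]) @ \oo --> 0%E.

(* Main.v *)
(** Independent columns with continuous laws are, up to ties, replaced by iid
    uniform points of a fine grid: binning each coordinate at the quantiles of its
    law is monotone, so it preserves the signs of differences, and ties have
    vanishing probability.  Every expectation becomes an average over a finite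
    product space.

    On the grid, [sign (x_i - x_j)] is its projection [u_i - u_j], with [u] uniform
    on [[-1, 1]], plus a remainder orthogonal to all functions of a single
    coordinate.  Hence the Kendall matrix is within bounded mean square Frobenius
    distance, up to [O(p / n)], of [2 * W + 1 / 3] with [W = n^-1 * sum_i u_i u_i^T].

    For [t > 0], the normalized trace [m] of [Q = (W + t)^-1] satisfies
    [p / n = t m + n^-1 * sum_i q_i / (1 + q_i)] with
    [q_i = n^-1 * u_i^T Q_(i) u_i] and [Q_(i)] independent of [u_i].  The [q_i]
    concentrate around [m / 3], and the limiting equation in [m] is strictly
    increasing, so [m] converges to the Stieltjes transform of the
    Marchenko-Pastur law, at negative real arguments only.

    Since all measures live on the nonnegative reals and the Kendall matrix has
    normalized trace [1], these values control the integral of every bounded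
    continuous function, by the Weierstrass theorem in [1 / (1 + x)]. *)

Require Import Defs.
From HB Require Import structures.
From mathcomp Require Import all_boot all_order all_algebra.
From mathcomp Require Import all_classical all_reals all_analysis.
From mathcomp Require Import measurable_realfun.
From mathcomp Require Import ring lra.
From mathcomp.real_closed Require complex.

Set Implicit Arguments.
Unset Strict Implicit.
Unset Printing Implicit Defensive.

Import Order.TTheory GRing.Theory Num.Theory.
Import numFieldNormedType.Exports.
Local Open Scope classical_set_scope.
Local Open Scope ring_scope.

(** * Resolvents of positive semidefinite matrices *)

(** The constants of the limit come from the projection. A variable uniform on [-1, 1] has variance
    1 / 3, so [W] behaves like a third of a sample covariance matrix and [2 W] like [2 / 3 Y]. The
    diagonal of [2 W] is close to 2 / 3 while the Kendall matrix has diagonal 1; the missing 1 / 3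
    is a multiple of the identity. Off the diagonal the remainder has second moment of order n^-2 in
    each of about p^2 entries. A perturbation of bounded Frobenius norm moves the trace of a
    resolvent by a constant times the square root of p, which disappears after division by p.

    Only second moments enter, each obtained by resampling coordinates of a finite sample and
    followed by Markov's inequality. The estimates do not deteriorate as the number L of grid points
    grows, so L can be taken as large as the ties require.

    At negative real arguments all resolvents are real and positive. Uniqueness of the limit is then
    the monotonicity of a real function, and inversion of the transform is replaced by the density
    of the functions spanned by products of 1 / (x + t). *)

Section Resolvent.
Variable R : realFieldType.
Implicit Types (p q : nat) (t c : R).

Definition frob2 p q (X : 'M[R]_(p, q)) : R := \tr (X^T *m X).

(** Testing against rectangular matrices of any width covers at once vectors, the identity and
    products with a resolvent, so that trace and Frobenius bounds follow without passing through
    columns. *)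
Definition psd p (A : 'M[R]_p) : Prop :=
  A^T = A /\ forall q (X : 'M[R]_(p, q)), 0 <= \tr (X^T *m A *m X).

Definition resolvent t p (A : 'M[R]_p) : 'M[R]_p := invmx (A + t%:M).

Lemma frob2E p q (X : 'M[R]_(p, q)) : frob2 X = \sum_i \sum_j X i j ^+ 2.
Proof.
rewrite /frob2 /mxtrace exchange_big; apply: eq_bigr => j _; rewrite mxE.
by apply: eq_bigr => i _; rewrite mxE expr2.
Qed.

Lemma frob2_ge0 p q (X : 'M[R]_(p, q)) : 0 <= frob2 X.
Proof. by rewrite frob2E; apply: sumr_ge0 => i _; apply: sumr_ge0 => j _; exact: sqr_ge0. Qed.

Lemma frob2_eq0 p q (X : 'M[R]_(p, q)) : frob2 X = 0 -> X = 0.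
Proof.
rewrite frob2E => /eqP; rewrite psumr_eq0; last first.
  by move=> i _; apply: sumr_ge0 => j _; exact: sqr_ge0.
move=> /allP X0; apply/matrixP => i j; rewrite mxE; apply/eqP.
have := X0 i (mem_index_enum i); rewrite psumr_eq0; last by move=> k _; exact: sqr_ge0.
by move=> /allP /(_ j (mem_index_enum j)); rewrite /= sqrf_eq0.
Qed.

Lemma frob21 p : frob2 (1%:M : 'M[R]_p) = p%:R.
Proof. by rewrite /frob2 trmx1 mulmx1 mxtrace1. Qed.

Lemma frob2_tr p q (X : 'M[R]_(p, q)) : frob2 X^T = frob2 X.
Proof. by rewrite /frob2 trmxK mxtrace_mulC. Qed.

Lemma frob2D p q (X Y : 'M[R]_(p, q)) :
  frob2 (X + Y) = frob2 X + 2 * \tr (X^T *m Y) + frob2 Y.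
Proof.
rewrite /frob2 [(X + Y)^T]linearD/= mulmxDl !mulmxDr !mxtraceD.
have -> : \tr (Y^T *m X) = \tr (X^T *m Y) by rewrite -mxtrace_tr trmx_mul trmxK.
ring.
Qed.

Lemma frob2Z p q a (X : 'M[R]_(p, q)) : frob2 (a *: X) = a ^+ 2 * frob2 X.
Proof.
by rewrite /frob2 [(a *: X)^T]linearZ/= -scalemxAl -scalemxAr !mxtraceZ mulrA expr2.
Qed.

(** Cauchy-Schwarz for the trace pairing: [frob2 (X + s *: Y^T)] is nonnegative for all [s], and the
    minimizing [s] is inserted. *)
Lemma mxtrace_mul_le p q (X : 'M[R]_(p, q)) (Y : 'M[R]_(q, p)) :
  (\tr (X *m Y)) ^+ 2 <= frob2 X * frob2 Y.
Proof.
have CS (s : R) : 0 <= frob2 X + 2 * s * \tr (X *m Y) + s ^+ 2 * frob2 Y.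
  have := frob2_ge0 (X + s *: Y^T); rewrite frob2D frob2Z frob2_tr -scalemxAr.
  have -> : \tr (s *: (X^T *m Y^T)) = s * \tr (X *m Y).
    by rewrite mxtraceZ -trmx_mul mxtrace_tr mxtrace_mulC.
  by rewrite mulrA.
have [Y0|Y0] := eqVneq (frob2 Y) 0.
  by rewrite (frob2_eq0 Y0) mulmx0 mxtrace0 /frob2 !(mulmx0, mxtrace0) mulr0 expr0n.
have Yp : 0 < frob2 Y by rewrite lt_def Y0 frob2_ge0.
have := CS (- (\tr (X *m Y) / frob2 Y)).
set a := \tr _; set b := frob2 Y in Yp Y0 *; set d := frob2 X => h.
have : 0 <= b * (d + 2 * - (a / b) * a + (- (a / b)) ^+ 2 * b) by rewrite mulr_ge0 ?(ltW Yp).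
have -> : b * (d + 2 * - (a / b) * a + (- (a / b)) ^+ 2 * b) = d * b - a ^+ 2 by field.
by rewrite subr_ge0.
Qed.

Section PSD.
Variables (p : nat) (A : 'M[R]_p) (t : R).
Hypotheses (psdA : psd A) (t0 : 0 < t).
Let Q := resolvent t A.

Lemma resolvent_unit : A + t%:M \in unitmx.
Proof.
rewrite unitmxE unitfE; apply/negP => /det0P[v v0 vA].
have /frob2_eq0 : frob2 (v^T) = 0.
  have := congr1 (fun M => \tr (M *m v^T)) vA.
  rewrite mul0mx mxtrace0 mulmxDr mulmxDl mxtraceD mul_mx_scalar -scalemxAl mxtraceZ.
  have := psdA.2 _ v^T; have := frob2_ge0 v^T; rewrite /frob2 trmxK => h1 h2 h3.
  apply/eqP; rewrite eq_le h1 andbT -(pmulr_rle0 _ t0); lra.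
by move=> vT0; move: v0; rewrite -[v]trmxK vT0 trmx0 eqxx.
Qed.

Lemma resolventK : (A + t%:M) *m Q = 1%:M.
Proof. exact/mulmxV/resolvent_unit. Qed.

Lemma Kresolvent : Q *m (A + t%:M) = 1%:M.
Proof. exact/mulVmx/resolvent_unit. Qed.

Lemma resolvent_sym : Q^T = Q.
Proof. by rewrite /Q /resolvent trmx_inv linearD/= tr_scalar_mx psdA.1. Qed.

(** With [Y = Q *m X] one has [X = A *m Y + t *: Y]. In the expansion of [frob2 X] the square of
    [A *m Y] and the cross term are nonnegative. The next bounds use the same substitution. *)
Lemma resolvent_frob2_le q (X : 'M[R]_(p, q)) :
  t ^+ 2 * frob2 (Q *m X) <= frob2 X.
Proof.
set Y := Q *m X.
have XE : X = A *m Y + t *: Y.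
  by rewrite -mul_scalar_mx -mulmxDl mulmxA resolventK mul1mx.
rewrite [in leRHS]XE frob2D frob2Z -scalemxAr mxtraceZ (trmx_mul A Y) psdA.1.
have h1 := psdA.2 _ Y; have h2 := frob2_ge0 (A *m Y).
by have := mulr_ge0 (ltW t0) h1; lra.
Qed.

Lemma resolvent_form_ge q (X : 'M[R]_(p, q)) :
  t * frob2 (Q *m X) <= \tr (X^T *m Q *m X).
Proof.
set Y := Q *m X.
have XE : X = A *m Y + t *: Y.
  by rewrite -mul_scalar_mx -mulmxDl mulmxA resolventK mul1mx.
rewrite -mulmxA -/Y [X in X^T]XE [(_ + _)^T]linearD/= [(_ *: _)^T]linearZ/= mulmxDl -scalemxAl.
rewrite mxtraceD mxtraceZ -/(frob2 Y) (trmx_mul A Y) psdA.1.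
by have := psdA.2 _ Y; lra.
Qed.

Lemma resolvent_form_ge0 q (X : 'M[R]_(p, q)) : 0 <= \tr (X^T *m Q *m X).
Proof.
by apply: le_trans (resolvent_form_ge X); rewrite mulr_ge0 ?frob2_ge0 ?ltW.
Qed.

Lemma resolvent_form_le q (X : 'M[R]_(p, q)) : t * \tr (X^T *m Q *m X) <= frob2 X.
Proof.
set Y := Q *m X.
have XE : X = A *m Y + t *: Y.
  by rewrite -mul_scalar_mx -mulmxDl mulmxA resolventK mul1mx.
have -> : \tr (X^T *m Q *m X) = \tr (Y^T *m A *m Y) + t * frob2 Y.
  rewrite -mulmxA -/Y [X in X^T]XE [(_ + _)^T]linearD/= [(_ *: _)^T]linearZ/= mulmxDl -scalemxAl.
  by rewrite mxtraceD mxtraceZ (trmx_mul A Y) psdA.1.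
rewrite [X in _ <= frob2 X]XE frob2D frob2Z -scalemxAr mxtraceZ (trmx_mul A Y) psdA.1.
have h1 := psdA.2 _ Y; have h2 := frob2_ge0 (A *m Y).
by have := mulr_ge0 (ltW t0) h1; lra.
Qed.

Lemma resolvent_trace_ge0 : 0 <= \tr Q.
Proof. by have := resolvent_form_ge0 1%:M; rewrite trmx1 mulmx1 mul1mx. Qed.

Lemma resolvent_trace_le : t * \tr Q <= p%:R.
Proof.
by have := resolvent_form_le 1%:M; rewrite trmx1 mulmx1 mul1mx frob21.
Qed.

Lemma resolvent_frob2 : t ^+ 2 * frob2 Q <= p%:R.
Proof. by have := resolvent_frob2_le 1%:M; rewrite mulmx1 frob21. Qed.

End PSD.

Lemma resolvent_diff p (A B : 'M[R]_p) t : psd A -> psd B -> 0 < t ->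
  resolvent t A - resolvent t B = resolvent t A *m (B - A) *m resolvent t B.
Proof.
move=> pA pB t0.
have -> : B - A = (B + t%:M) - (A + t%:M) by rewrite opprD addrACA subrr addr0.
by rewrite mulmxBr mulmxBl (Kresolvent pA)// mul1mx -mulmxA resolventK// mulmx1.
Qed.

(** Cauchy-Schwarz applied to the resolvent identity, with [frob2] of the product of the two
    resolvents at most [p / t ^ 4]. After division by [p ^ 2], any squared Frobenius distance small
    compared with [p] is negligible. *)
Lemma resolvent_trace_diff p (A B : 'M[R]_p) t : psd A -> psd B -> 0 < t ->
  t ^+ 4 * (\tr (resolvent t A) - \tr (resolvent t B)) ^+ 2 <=
  p%:R * frob2 (A - B).
Proof.
move=> pA pB t0; rewrite -linearB/= resolvent_diff// mxtrace_mulC mulmxA.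
have h := mxtrace_mul_le (resolvent t B *m resolvent t A) (B - A).
have tt : 0 <= t ^+ 2 by exact: sqr_ge0.
have h1 := resolvent_frob2_le pB t0 (resolvent t A).
have h2 := resolvent_frob2 pA t0.
have -> : frob2 (A - B) = frob2 (B - A).
  by rewrite !frob2E; apply: eq_bigr => i _; apply: eq_bigr => j _; rewrite !mxE; ring.
apply: (@le_trans _ _ (t ^+ 4 * (frob2 (resolvent t B *m resolvent t A) * frob2 (B - A)))).
  by rewrite ler_wpM2l// exprn_ge0 ?ltW.
rewrite mulrA ler_wpM2r ?frob2_ge0//; apply: le_trans h2.
have -> : t ^+ 4 = t ^+ 2 * t ^+ 2 by ring.
by rewrite -mulrA ler_wpM2l.
Qed.

Section RankOne.
Variables (p : nat) (A : 'M[R]_p) (x : 'cV[R]_p) (c t : R).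
Hypotheses (psdA : psd A) (c0 : 0 <= c) (t0 : 0 < t).
Let B : 'M[R]_p := A + c *: (x *m x^T).
Let q := c * \tr (x^T *m resolvent t A *m x).

Lemma psd_rank1 : psd B.
Proof.
split; first by rewrite linearD/= linearZ/= trmx_mul trmxK psdA.1.
move=> r X; rewrite mulmxDr mulmxDl mxtraceD addr_ge0 ?psdA.2//.
rewrite -scalemxAr -scalemxAl mxtraceZ mulr_ge0// mulmxA.
by have := frob2_ge0 (x^T *m X); rewrite /frob2 trmx_mul trmxK !mulmxA.
Qed.

Let q0 : 0 <= q.
Proof. by rewrite mulr_ge0// resolvent_form_ge0. Qed.

Let scalarE (M : 'M[R]_1) : M = (\tr M)%:M.
Proof. by rewrite [LHS]mx11_scalar /mxtrace big_ord1. Qed.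

(** Sherman-Morrison in vector form: [B + t] maps [resolvent t A *m x] to [(1 + q) *: x]. *)
Lemma resolvent_rank1_mul :
  resolvent t B *m x = (1 + q)^-1 *: (resolvent t A *m x).
Proof.
have q1 : 1 + q != 0 by rewrite gt_eqF// ltr_wpDr.
have h : (B + t%:M) *m (resolvent t A *m x) = (1 + q) *: x.
  have -> : B + t%:M = (A + t%:M) + c *: (x *m x^T) by rewrite addrAC.
  rewrite mulmxDl mulmxA resolventK// mul1mx -scalemxAl -mulmxA.
  rewrite (mulmxA x^T) [x^T *m _ *m x]scalarE mul_mx_scalar scalerA.
  by rewrite scalerDl scale1r.
have := congr1 (mulmx (resolvent t B)) h.
rewrite mulmxA (Kresolvent psd_rank1 t0) mul1mx -scalemxAr => ->.
by rewrite scalerA mulVf// scale1r.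
Qed.

Lemma resolvent_rank1_form :
  c * \tr (x^T *m resolvent t B *m x) = q / (1 + q).
Proof.
rewrite -mulmxA resolvent_rank1_mul -scalemxAr mxtraceZ mulmxA mulrCA mulrC.
by [].
Qed.

(** The difference equals [c * frob2 (resolvent t A *m x) / (1 + q)], and [t] times its numerator is
    at most [q]. The bound depends neither on the dimension nor on the size of [x], so removing one
    column does not affect a normalized trace. *)
Lemma resolvent_rank1_trace :
  0 <= \tr (resolvent t A) - \tr (resolvent t B) <= t^-1.
Proof.
have q1 : 0 < 1 + q by rewrite ltr_wpDr.
have -> : \tr (resolvent t A) - \tr (resolvent t B) =
    c * frob2 (resolvent t A *m x) / (1 + q).
  rewrite -linearB/= resolvent_diff//; last exact: psd_rank1.
  have -> : B - A = c *: (x *m x^T) by rewrite /B addrC addKr.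
  rewrite -scalemxAr -scalemxAl mxtraceZ -[RHS]mulrA; congr (_ * _).
  have xB : x^T *m resolvent t B = (resolvent t B *m x)^T.
    by rewrite trmx_mul (resolvent_sym _ psd_rank1).
  rewrite mulmxA -(mulmxA _ _ (resolvent t B)) xB resolvent_rank1_mul.
  by rewrite linearZ/= -scalemxAr mxtraceZ mxtrace_mulC mulrC.
apply/andP; split.
  by rewrite mulr_ge0 ?invr_ge0 ?(ltW q1)// mulr_ge0 ?frob2_ge0.
rewrite ler_pdivrMr// -(ler_pM2l t0) [leRHS]mulrA mulfV ?gt_eqF// mul1r.
have := ler_wpM2l c0 (resolvent_form_ge psdA t0 x); rewrite -/q.
by rewrite mulrCA => h; apply: (le_trans h); rewrite lerDr.
Qed.

End RankOne.

End Resolvent.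

(** * Eigenvalues of positive semidefinite matrices and the trace of the resolvent *)

Section Spectrum.
Variables (R : realType) (p : nat) (A : 'M[R]_p).

Lemma size_eigenvalues : A^T = A -> size (eigenvalues A) = p.
Proof.
move=> symA; have := congr1 (fun q : {poly R} => size q) (eigenvaluesP symA).
by rewrite size_char_poly size_prod_XsubC => -[].
Qed.

Lemma sum_eigenvalues : A^T = A -> \sum_(x <- eigenvalues A) x = \tr A.
Proof.
move=> symA; have [p0|p0] := posnP p.
  rewrite (size0nil (etrans (size_eigenvalues symA) p0)) big_nil.
  move: A; rewrite p0 => B; by rewrite /mxtrace big_ord0.
apply: oppr_inj; rewrite -char_poly_trace// eigenvaluesP//.
have sE := size_eigenvalues symA.
by have := @coefPn_prod_XsubC _ (eigenvalues A); rewrite sE => ->//; rewrite -lt0n.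
Qed.

Lemma eigenvalues_ge0 x : psd A -> x \in eigenvalues A -> 0 <= x.
Proof.
move=> [symA psdA] xA.
have : eigenvalue A x by rewrite eigenvalue_root_char eigenvaluesP// root_prod_XsubC.
case/eigenvalueP => v vA v0.
have := psdA _ v^T; rewrite trmxK vA -scalemxAl mxtraceZ -[v in v *m _]trmxK -/(frob2 v^T).
apply: contraLR; rewrite -!ltNge => x0; rewrite nmulr_rlt0// lt_def frob2_ge0 andbT.
by apply: contra v0 => /eqP/frob2_eq0 vT0; rewrite -[v]trmxK vT0 trmx0.
Qed.

Import complex.

(** The diagonalization takes place over the complex numbers. Unique factorization of the
    characteristic polynomial identifies its diagonal with the embedded [eigenvalues A], up to
    order, and injectivity of the embedding brings the identity back to [R]. *)
Lemma trace_resolventE t : 0 < t -> psd A ->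
  \tr (resolvent t A) = \sum_(x <- eigenvalues A) (x + t)^-1.
Proof.
move=> t0 psdA; have symA := psdA.1.
pose f : {rmorphism R -> (complex R)} := real_complex R.
pose C : 'M[complex R]_p := map_mx f A.
have fR x : f x \is Num.real by rewrite complex_real.
have Creal : C \is a mxOver Num.real by apply/mxOverP => i j; rewrite mxE.
have Csym : C \is symmetricmx.
  by apply/is_hermitianmxP; rewrite expr0 scale1r map_mx_id// map_trmx symA.
have Cherm : C \is hermsymmx by apply: realsym_hermsym.
have /hermitian_normalmx/orthomx_spectralP CE := Cherm.
set D := spectral_diag C in CE.
set Q := spectralmx C in CE.
have Qu : Q \in unitmx by exact: spectral_unit.
have charC : char_poly C = \prod_(x <- [seq D 0 i | i <- enum 'I_p]) ('X - x%:P).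
  have diagE : char_poly (diag_mx D) = \prod_(i < p) ('X - (D 0 i)%:P).
    rewrite char_poly_trig ?diag_mx_is_trig//.
    by apply: eq_bigr => i _; rewrite mxE eqxx mulr1n.
  rewrite big_map big_enum/= -diagE CE /char_poly /char_poly_mx.
  have QQ : map_mx polyC (invmx Q) *m map_mx polyC Q = 1%:M.
    by rewrite -map_mxM mulVmx// map_mx1.
  have -> : 'X%:M - map_mx polyC (invmx Q *m diag_mx D *m Q) =
      map_mx polyC (invmx Q) *m ('X%:M - map_mx polyC (diag_mx D)) *m
      map_mx polyC Q.
    rewrite !map_mxM mulmxBr mulmxBl; congr (_ - _).
    by rewrite -mulmxA -scalar_mxC mulmxA QQ mul1mx.
  by rewrite !det_mulmx mulrAC -det_mulmx QQ det1 mul1r.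
have DP : perm_eq [seq D 0 i | i <- enum 'I_p] (map f (eigenvalues A)).
  apply: prod_XsubC_eq; rewrite -charC -map_char_poly (eigenvaluesP symA).
  rewrite rmorph_prod big_map; apply: eq_bigr => i _.
  by rewrite rmorphB/= map_polyX map_polyC.
have D0 i : D 0 i + f t != 0.
  have : D 0 i \in map f (eigenvalues A).
    by rewrite -(perm_mem DP); apply/mapP; exists i; rewrite ?mem_enum.
  case/mapP => x /(eigenvalues_ge0 psdA) x0 ->.
  by rewrite -rmorphD fmorph_eq0 gt_eqF// ltr_wpDl.
have CtE : C + (f t)%:M = invmx Q *m diag_mx (\row_i (D 0 i + f t)) *m Q.
  have -> : diag_mx (\row_i (D 0 i + f t)) = diag_mx D + (f t)%:M.
    by apply/matrixP => i j; rewrite !mxE mulrnDl.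
  by rewrite mulmxDr mulmxDl -CE -mulmxA -scalar_mxC mulmxA mulVmx// mul1mx.
have mapQ : map_mx f (resolvent t A) =
    invmx Q *m diag_mx (\row_i (D 0 i + f t)^-1) *m Q.
  have h : (invmx Q *m diag_mx (\row_i (D 0 i + f t)^-1) *m Q) *m (C + (f t)%:M) = 1%:M.
    rewrite CtE !mulmxA mulmxK// -[_ *m _ *m diag_mx (\row_i (D 0 i + f t))]mulmxA.
    rewrite mulmx_diag.
    have -> : diag_mx (\row_j ((\row_i (D 0 i + f t)^-1) 0 j * (\row_i (D 0 i + f t)) 0 j)) = 1%:M.
      by apply/matrixP => i j; rewrite !mxE mulVf.
    by rewrite mulmx1 mulVmx.
  have h2 : (C + (f t)%:M) *m map_mx f (resolvent t A) = 1%:M.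
    by rewrite -map_scalar_mx -map_mxD -map_mxM resolventK// map_mx1.
  have inv_uniq (M N P : 'M[complex R]_p) : P *m M = 1%:M -> M *m N = 1%:M -> N = P.
    by move=> PM MN; rewrite -[N]mul1mx -PM -mulmxA MN mulmx1.
  exact: inv_uniq h h2.
apply: (fmorph_inj f); rewrite -[LHS]trace_map_mx mapQ.
rewrite mxtrace_mulC mulmxA mulmxV// mul1mx mxtrace_diag rmorph_sum/=.
transitivity (\sum_(x <- map f (eigenvalues A)) (x + f t)^-1).
  rewrite -(perm_big _ DP)/= big_map big_enum/=.
  by apply: eq_bigr => i _; rewrite mxE.
by rewrite big_map; apply: eq_bigr => x _; rewrite -rmorphD fmorphV.
Qed.

End Spectrum.

(** * Averages over finite product spaces *)

Section Mean.
Variables (R : realFieldType) (Om : finType).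
Hypothesis Om0 : (0 < #|Om|)%N.
Implicit Types f g : Om -> R.

Definition mean f : R := (\sum_w f w) / #|Om|%:R.

Let card_gt0 : 0 < #|Om|%:R :> R. Proof. by rewrite ltr0n. Qed.

Lemma eq_mean f g : f =1 g -> mean f = mean g.
Proof. by move=> fg; rewrite /mean (eq_bigr g). Qed.

Lemma mean_le f g : (forall w, f w <= g w) -> mean f <= mean g.
Proof.
by move=> fg; rewrite ler_wpM2r ?invr_ge0 ?(ltW card_gt0)//; apply: ler_sum.
Qed.

Lemma mean_ge0 f : (forall w, 0 <= f w) -> 0 <= mean f.
Proof. by move=> f0; rewrite divr_ge0 ?sumr_ge0. Qed.

Lemma mean_cst c : mean (fun=> c) = c.
Proof.
by rewrite /mean sumr_const -[c *+ _]mulr_natr mulfK// gt_eqF.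
Qed.

Lemma meanD f g : mean (fun w => f w + g w) = mean f + mean g.
Proof. by rewrite /mean big_split mulrDl. Qed.

Lemma meanZ c f : mean (fun w => c * f w) = c * mean f.
Proof. by rewrite /mean -mulr_sumr mulrA. Qed.

Lemma mean_sum (J : finType) (P : pred J) (F : J -> Om -> R) :
  mean (fun w => \sum_(j | P j) F j w) = \sum_(j | P j) mean (F j).
Proof. by rewrite /mean exchange_big mulr_suml. Qed.

Definition freq (P : pred Om) : R := mean (fun w => (P w)%:R).

Lemma freqE P : freq P = #|[set w | P w]%SET|%:R / #|Om|%:R.
Proof.
rewrite /freq /mean -natr_sum; congr (_%:R / _).
by rewrite -sum1_card [RHS]big_mkcond; apply: eq_bigr => w _; rewrite inE; case: (P w).
Qed.

Lemma freq_le (P Q : pred Om) : (forall w, P w -> Q w) -> freq P <= freq Q.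
Proof.
move=> PQ; apply: mean_le => w; rewrite ler_nat.
by case: (P w) (PQ w) => // ->.
Qed.

Lemma freqU (P Q : pred Om) : freq [pred w | P w || Q w] <= freq P + freq Q.
Proof.
rewrite -meanD; apply: mean_le => w /=.
by case: (P w); case: (Q w); rewrite /= ?addr0 ?add0r//; lra.
Qed.

Lemma freq_has (J : eqType) (s : seq J) (P : J -> pred Om) :
  freq [pred w | has (P^~ w) s] <= \sum_(j <- s) freq (P j).
Proof.
elim: s => [|j s IHs] /=; last first.
  by rewrite big_cons; apply: le_trans (freqU _ _) _; rewrite lerD2l.
by rewrite big_nil /freq (@eq_mean _ (fun=> 0))// mean_cst.
Qed.

Lemma markov_freq f e : 0 < e -> (forall w, 0 <= f w) ->
  freq [pred w | e <= f w] <= mean f / e.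
Proof.
move=> e0 f0; rewrite ler_pdivlMr// mulrC -meanZ; apply: mean_le => w /=.
by case: (leP e (f w)) => h; rewrite ?mulr1 ?mulr0.
Qed.

(** Each [Y x] correlates only with itself and with [Y (r x)], and such a product is at most half
    the sum of the squares; this is where the factor 2 comes from. In the applications [r] swaps the
    two indices of a pair or is the identity. *)
Lemma mean_sqr_sum_le (J : finType) (r : J -> J) (Y : J -> Om -> R) :
  involutive r ->
  (forall x y, y != x -> y != r x -> mean (fun w => Y x w * Y y w) = 0) ->
  mean (fun w => (\sum_x Y x w) ^+ 2) <= 2 * \sum_x mean (fun w => Y x w ^+ 2).
Proof.
move=> rK orth; pose m x := mean (fun w => Y x w ^+ 2).
have m0 x : 0 <= m x by apply: mean_ge0 => w; exact: sqr_ge0.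
have -> : mean (fun w => (\sum_x Y x w) ^+ 2) =
    \sum_x \sum_y mean (fun w => Y x w * Y y w).
  rewrite -[RHS](_ : mean (fun w => \sum_x \sum_y Y x w * Y y w) = _).
    by apply: eq_mean => w; rewrite expr2 mulr_suml; apply: eq_bigr => x _; rewrite mulr_sumr.
  by rewrite mean_sum; apply: eq_bigr => x _; rewrite mean_sum.
have le1 x y : mean (fun w => Y x w * Y y w) <=
    (y == x)%:R * (m x + m y) / 2 + (y == r x)%:R * (m x + m y) / 2.
  have le2 : mean (fun w => Y x w * Y y w) <= (m x + m y) / 2.
    rewrite /m -meanD mulrC -meanZ; apply: mean_le => w.
    by have := sqr_ge0 (Y x w - Y y w); nra.
  have mm : 0 <= (m x + m y) / 2 by rewrite divr_ge0// addr_ge0.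
  have [yx|yx] := eqVneq y x; have [yr|yr] := eqVneq y (r x);
    rewrite ?mul0r ?mul1r ?addr0 ?add0r//; last by rewrite orth.
  by apply: le_trans le2 _; rewrite lerDl.
apply: (@le_trans _ _ (\sum_x (m x + (m x + m (r x)) / 2))).
  apply: ler_sum => x _; apply: le_trans (ler_sum _ (fun y _ => le1 x y)) _.
  rewrite big_split/= (bigD1 x)//= big1 ?addr0; last first.
    by move=> y /negbTE ->; rewrite !mul0r.
  rewrite (bigD1 (r x))//= [X in _ + (_ + X)]big1 ?addr0; last first.
    by move=> y /negbTE ->; rewrite !mul0r.
  by rewrite !eqxx !mul1r; lra.
rewrite -[leRHS]/(2 * \sum_x m x); clearbody m.
rewrite big_split/= -mulr_suml big_split/=.
have -> : \sum_x m (r x) = \sum_x m x.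
  by rewrite [RHS](reindex_inj (can_inj rK)).
by lra.
Qed.

End Mean.

Section Resampling.
Variables (R : realFieldType) (I T : finType).
Implicit Types (w : {ffun I -> T}) (i : I) (f g : {ffun I -> T} -> R).

Definition upd w i a : {ffun I -> T} := [ffun j => if j == i then a else w j].

Lemma upd_same w i a : upd w i a i = a.
Proof. by rewrite ffunE eqxx. Qed.

Lemma upd_other w i j a : j != i -> upd w i a j = w j.
Proof. by move=> /negbTE ji; rewrite ffunE ji. Qed.

(** Exchanging the value at [i] with the fresh value [a] is an involution of the pairs [(w, a)], so
    resampling one coordinate preserves the uniform law. *)
Lemma sum_upd i f : \sum_w \sum_a f (upd w i a) = #|T|%:R * \sum_w f w.
Proof.
rewrite pair_big/=.
pose h (u : {ffun I -> T} * T) := (upd u.1 i u.2, u.1 i).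
have hK : involutive h.
  move=> [w a]; rewrite /h/= upd_same; congr (_, _).
  by apply/ffunP => j; rewrite !ffunE; case: eqVneq => // ->.
rewrite (reindex_inj (can_inj hK))/=.
transitivity (\sum_w \sum_(a : T) f w).
  rewrite pair_big/=; apply: eq_bigr => -[w a] _ /=; congr f.
  by apply/ffunP => j; rewrite !ffunE; case: eqVneq => // ->.
by rewrite mulr_sumr; apply: eq_bigr => w _; rewrite sumr_const mulr_natl.
Qed.

Hypothesis T0 : (0 < #|T|)%N.
Let T0R : #|T|%:R != 0 :> R. Proof. by rewrite pnatr_eq0 -lt0n. Qed.

Lemma card_ffun_gt0 : (0 < #|{ffun I -> T}|)%N.
Proof. by rewrite card_ffun expn_gt0 T0. Qed.

Lemma mean_upd i f :
  mean f = mean (fun w => (\sum_a f (upd w i a)) / #|T|%:R).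
Proof.
rewrite /mean; congr (_ / _); rewrite -mulr_suml sum_upd mulrC mulrA mulVf//.
by rewrite mul1r.
Qed.

Lemma mean_coord i (h : T -> R) : mean (fun w => h (w i)) = (\sum_a h a) / #|T|%:R.
Proof.
rewrite (mean_upd i) -[RHS](mean_cst card_ffun_gt0); apply: eq_mean => w.
by congr (_ / _); apply: eq_bigr => a _; rewrite upd_same.
Qed.

Lemma mean_orth1 i f g : (forall w a, g (upd w i a) = g w) ->
  (forall w, \sum_a f (upd w i a) = 0) -> mean (fun w => f w * g w) = 0.
Proof.
move=> gi fi; rewrite (mean_upd i) -[RHS](mean_cst card_ffun_gt0).
apply: eq_mean => w.
under eq_bigr do rewrite gi.
by rewrite -mulr_suml fi !mul0r.
Qed.

(** Two coordinates are resampled together because a product of signs, minus its projections, is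
    centred only after averaging over both columns. *)
Lemma mean_orth2 i j f g : (forall w a, g (upd w i a) = g w) ->
  (forall w a, g (upd w j a) = g w) ->
  (forall w, \sum_b \sum_a f (upd (upd w i b) j a) = 0) ->
  mean (fun w => f w * g w) = 0.
Proof.
move=> gi gj fij; rewrite (mean_upd j) (mean_upd i) -[RHS](mean_cst card_ffun_gt0).
apply: eq_mean => w; rewrite -mulr_suml.
under eq_bigr do under eq_bigr do rewrite gj gi.
under eq_bigr do rewrite -mulr_suml.
by rewrite -mulr_suml fij !mul0r.
Qed.

End Resampling.

Section Grid.
Variables (R : realFieldType) (L : nat).
Hypothesis L0 : (0 < L)%N.

(* Scaled so that [grid b] is the mean sign of [b - a] over uniform [a], see
   [sum_sgB]: the projection of a sign on one of its arguments is exact. *)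
Definition grid (a : 'I_L) : R := (2 * a%:R + 1 - L%:R) / L%:R.
Definition grid_var : R := (L%:R ^+ 2 - 1) / (3 * L%:R ^+ 2).

Let LR : L%:R != 0 :> R. Proof. by rewrite pnatr_eq0 -lt0n. Qed.
Let Lp : 0 < L%:R :> R. Proof. by rewrite ltr0n. Qed.

Let sumI n : 2 * \sum_(a < n) (a%:R : R) = n%:R * (n%:R - 1).
Proof.
elim: n => [|n IHn]; first by rewrite big_ord0 mulr0 mul0r.
by rewrite big_ord_recr/= mulrDr IHn -natr1; ring.
Qed.

Let sumI2 n : 6 * \sum_(a < n) (a%:R ^+ 2 : R) = n%:R * (n%:R - 1) * (2 * n%:R - 1).
Proof.
elim: n => [|n IHn]; first by rewrite big_ord0 mulr0 !mul0r.
by rewrite big_ord_recr/= mulrDr IHn -natr1; ring.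
Qed.

Lemma sum_grid : \sum_a grid a = 0.
Proof.
rewrite /grid -mulr_suml sumrB big_split/= -mulr_sumr sumI !sumr_const card_ord -mulr_natr.
by rewrite -[1 *+ L]mulr_natr; field.
Qed.

Lemma sum_grid2 : \sum_a grid a ^+ 2 = L%:R * grid_var.
Proof.
have -> : \sum_a grid a ^+ 2 =
   \sum_(a < L) (4 / L%:R ^+ 2 * a%:R ^+ 2 + (4 * (1 - L%:R) / L%:R ^+ 2 * a%:R +
     ((1 - L%:R) / L%:R) ^+ 2)).
  by apply: eq_bigr => a _; rewrite /grid; field.
rewrite !big_split/= -!mulr_sumr sumr_const card_ord -mulr_natr.
have -> : \sum_(a < L) (a%:R ^+ 2 : R) = L%:R * (L%:R - 1) * (2 * L%:R - 1) / 6.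
  by rewrite -sumI2; field.
have -> : \sum_(a < L) (a%:R : R) = L%:R * (L%:R - 1) / 2.
  by rewrite -sumI; field.
by rewrite /grid_var; field.
Qed.

Lemma grid_le1 a : -1 <= grid a <= 1.
Proof.
rewrite /grid ler_pdivlMr// ler_pdivrMr// mulN1r mul1r.
have : (a%:R : R) + 1 <= L%:R by rewrite natr1 ler_nat.
have : 0 <= (a%:R : R) by [].
by move=> h1 h2; apply/andP; split; lra.
Qed.

Lemma grid_var_ge0 : 0 <= grid_var.
Proof.
by rewrite -(pmulr_rge0 _ Lp) -sum_grid2; apply: sumr_ge0 => a _; exact: sqr_ge0.
Qed.

Lemma grid_var_le : grid_var <= 1 / 3.
Proof.
rewrite /grid_var ler_pdivrMr ?mulr_gt0 ?exprn_gt0//.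
have -> : 1 / 3 * (3 * L%:R ^+ 2) = L%:R ^+ 2 :> R by field.
by rewrite gerBl.
Qed.

Lemma grid_var_near : 1 / 3 - grid_var <= L%:R^-1.
Proof.
rewrite /grid_var.
have -> : 1 / 3 - (L%:R ^+ 2 - 1) / (3 * L%:R ^+ 2) = (3 * L%:R)^-1 * L%:R^-1 :> R by field.
rewrite ler_piMl ?invr_ge0 ?(ltW Lp)// invf_le1 ?mulr_gt0//.
have : (1 : R) <= L%:R by rewrite ler1n.
by lra.
Qed.

Lemma sum_sgB (b : 'I_L) : \sum_(a < L) Num.sg (a%:R - b%:R : R) = - L%:R * grid b.
Proof.
have -> : - L%:R * grid b = (L%:R - b%:R - 1) - b%:R by rewrite /grid; field.
have key n : (b < n)%N -> \sum_(0 <= a < n) Num.sg (a%:R - b%:R : R) = (n%:R - b%:R - 1) - b%:R.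
  move=> bn; rewrite (@big_cat_nat _ _ _ b)//= ?(ltnW bn)// [X in _ + X]big_ltn// subrr sgr0 add0r.
  have -> : \sum_(0 <= a < b) Num.sg (a%:R - b%:R : R) = \sum_(0 <= a < b) -1.
    by apply: eq_big_nat => a /andP[_ ab]; rewrite ltr0_sg// subr_lt0 ltr_nat.
  have -> : \sum_(b.+1 <= a < n) Num.sg (a%:R - b%:R : R) = \sum_(b.+1 <= a < n) 1.
    by apply: eq_big_nat => a /andP[ab _]; rewrite gtr0_sg// subr_gt0 ltr_nat.
  by rewrite !sumr_const_nat subn0 natrB// -natr1 mulNrn; ring.
by rewrite -(big_mkord xpredT (fun a => Num.sg (a%:R - b%:R : R))) key.
Qed.

End Grid.

(** * Signs and projections of a uniform grid sample *)

Lemma sum_neq_const (R : nzRingType) n (i : 'I_n) (c : R) :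
  \sum_(j | j != i) c = (n%:R - 1) * c.
Proof.
rewrite sumr_const (@eq_card _ _ (predC1 i))// cardC1 card_ord -[LHS]mulr_natl.
by rewrite -subn1 natrB// (leq_ltn_trans _ (ltn_ord i)).
Qed.

Section GridSample.
Variables (R : realFieldType) (p n L : nat).
Hypothesis L0 : (0 < L)%N.

Definition sample := {ffun 'I_p * 'I_n -> 'I_L}.
Implicit Types (w : sample) (k l : 'I_p) (i j : 'I_n).

Let v : R := grid_var R L.
Let LR : L%:R != 0 :> R. Proof. by rewrite pnatr_eq0 -lt0n. Qed.
Let Om0 : (0 < #|{: sample}|)%N.
Proof. by apply: card_ffun_gt0; rewrite card_ord. Qed.
Let cardL : (0 < #|'I_L|)%N. Proof. by rewrite card_ord. Qed.

Definition unif w k i : R := grid R (w (k, i)).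
(* Unlike [sign], antisymmetric; both agree in the absence of ties. *)
Definition sgn w k i j : R := Num.sg ((w (k, i))%:R - (w (k, j))%:R).

Definition unif_col w i : 'cV[R]_p := \col_k unif w k i.

Definition gram w : 'M[R]_p := \sum_i n%:R^-1 *: (unif_col w i *m (unif_col w i)^T).

(** The sum runs over all ordered pairs: the terms [i = j] vanish and each unordered pair counts
    twice, hence [n * (n - 1)] in place of the binomial coefficient. *)
Definition sgn_kendall w : 'M[R]_p := \matrix_(k, l)
  ((n%:R * (n%:R - 1))^-1 * \sum_i \sum_j sgn w k i j * sgn w l i j).

Lemma unif_le1 w k i : -1 <= unif w k i <= 1.
Proof. exact: grid_le1. Qed.

Lemma unif2_le1 w k i : unif w k i ^+ 2 <= 1.
Proof. by have /andP[] := unif_le1 w k i; nra. Qed.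

Lemma gramE w k l : gram w k l = n%:R^-1 * \sum_i unif w k i * unif w l i.
Proof.
rewrite /gram summxE mulr_sumr; apply: eq_bigr => i _.
by rewrite !mxE big_ord1 !mxE.
Qed.

Lemma sgnC w k i j : sgn w k j i = - sgn w k i j.
Proof. by rewrite /sgn -sgrN opprB. Qed.

Lemma sgn_le1 w k i j : -1 <= sgn w k i j <= 1.
Proof. by rewrite /sgn; case: sgrP => _; apply/andP; split; lra. Qed.

Lemma sgnn w k i : sgn w k i i = 0.
Proof. by rewrite /sgn subrr sgr0. Qed.

(* Averaging over coordinate [x.1] of both columns [k] and [l] turns the product
   of signs into [unif w k x.2 * unif w l x.2], so the kernel has mean zero given
   the other coordinates, and likewise for [x.2]. *)
Definition pair_kernel k l (x : 'I_n * 'I_n) w : R :=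
  if x.1 == x.2 then 0 else
  sgn w k x.1 x.2 * sgn w l x.1 x.2 - unif w k x.1 * unif w l x.1 - unif w k x.2 * unif w l x.2.

(** A Hoeffding decomposition. Each index [i] lies in [2 * (n - 1)] ordered pairs of distinct
    indices, so the projections add up to [2 / n] times the sum of the [unif w k i * unif w l i]. *)
Lemma sgn_kendall_gram w k l : (1 < n)%N ->
  sgn_kendall w k l - 2 * gram w k l =
  (n%:R * (n%:R - 1))^-1 * \sum_x pair_kernel k l x w.
Proof.
move=> n1.
have n0R : n%:R != 0 :> R by rewrite pnatr_eq0 -lt0n ltnW.
have n1R : n%:R - 1 != 0 :> R by rewrite subr_eq0 pnatr_eq1 gtn_eqF.
have -> : \sum_x pair_kernel k l x w = \sum_i \sum_j (sgn w k i j * sgn w l i j)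
   - 2 * (n%:R - 1) * \sum_i unif w k i * unif w l i.
  rewrite -[LHS](_ : \sum_i \sum_j pair_kernel k l (i, j) w = _); last first.
    by rewrite pair_big; apply: eq_bigr => -[i j].
  have -> : 2 * (n%:R - 1) * \sum_i unif w k i * unif w l i = \sum_i \sum_(j | j != i)
       (unif w k i * unif w l i + unif w k j * unif w l j).
    have e i := big_split +%R (index_enum 'I_n) (fun j => j != i)
      (fun=> unif w k i * unif w l i) (fun j => unif w k j * unif w l j).
    rewrite [RHS](eq_bigr _ (fun i _ => e i)) big_split/=.
    have -> : \sum_i \sum_(j | j != i) unif w k i * unif w l i =
        (n%:R - 1) * \sum_i unif w k i * unif w l i.
      rewrite mulr_sumr; apply: eq_bigr => i _.
      exact: sum_neq_const.
    have -> : \sum_i \sum_(j | j != i) unif w k j * unif w l j =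
        (n%:R - 1) * \sum_i unif w k i * unif w l i.
      rewrite (exchange_big_dep predT)//= mulr_sumr; apply: eq_bigr => i _.
      under eq_bigl do rewrite eq_sym.
      exact: sum_neq_const.
    by ring.
  rewrite -sumrB; apply: eq_bigr => i _.
  rewrite (bigD1 i)//= [in RHS](bigD1 i)//= /pair_kernel/= eqxx sgnn mul0r !add0r.
  rewrite -sumrB; apply: eq_bigr => j ji; rewrite eq_sym (negbTE ji); ring.
rewrite mxE gramE; set a := \sum_i _; set b := \sum_i _; field.
by rewrite n0R n1R.
Qed.

Lemma unif_upd w k i k' i' a :
  unif (upd w (k', i') a) k i = if (k, i) == (k', i') then grid R a else unif w k i.
Proof. by rewrite /unif ffunE; case: ifP. Qed.

Lemma pair_kernel_upd k l x w m i a : i != x.1 -> i != x.2 ->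
  pair_kernel k l x (upd w (m, i) a) = pair_kernel k l x w.
Proof.
move=> /negbTE i1 /negbTE i2; rewrite /pair_kernel /sgn !unif_upd !ffunE !xpair_eqE.
by rewrite !(eq_sym _ i) i1 i2 !andbF.
Qed.

Lemma pair_kernelC k l x w : pair_kernel k l (x.2, x.1) w = pair_kernel k l x w.
Proof.
rewrite /pair_kernel/= eq_sym; case: eqP => // _.
rewrite (sgnC _ _ x.1 x.2) (sgnC w l x.1 x.2); ring.
Qed.

Lemma sum_pair_kernel k l x w : k != l ->
  \sum_b \sum_a pair_kernel k l x (upd (upd w (k, x.1) b) (l, x.1) a) = 0.
Proof.
move=> /negbTE kl; rewrite /pair_kernel.
have lk : (l == k) = false by rewrite eq_sym.
have [x12|/negbTE x12] := eqVneq x.1 x.2.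
  by rewrite big1// => b _; rewrite big1.
have x21 : (x.2 == x.1) = false by rewrite eq_sym.
transitivity (\sum_(b < L) \sum_(a < L)
   (Num.sg (b%:R - (w (k, x.2))%:R) * Num.sg (a%:R - (w (l, x.2))%:R) -
    grid R b * grid R a - unif w k x.2 * unif w l x.2)).
  apply: eq_bigr => b _; apply: eq_bigr => a _.
  by rewrite /sgn /unif !ffunE !xpair_eqE !eqxx kl lk x21/= ?andbF/=.

under eq_bigr do rewrite 2!sumrB -2!mulr_sumr (sum_sgB R L0) (sum_grid R L0) mulr0 subr0 sumr_const card_ord -[_ *+ L]mulr_natr.
rewrite sumrB -mulr_suml (sum_sgB R L0) sumr_const card_ord -[_ *+ L]mulr_natr.
rewrite /unif; ring.
Qed.

Lemma pair_kernel_bound k l x w : pair_kernel k l x w ^+ 2 <= 9.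
Proof.
rewrite /pair_kernel; case: eqP => [_|_]; first by rewrite expr0n ler0n.
have abs2 (a b : R) : -1 <= a <= 1 -> -1 <= b <= 1 -> -1 <= a * b <= 1.
  by move=> /andP[a1 a2] /andP[b1 b2]; apply/andP; split; nra.
have /andP[h1 h2] := abs2 _ _ (sgn_le1 w k x.1 x.2) (sgn_le1 w l x.1 x.2).
have /andP[h3 h4] := abs2 _ _ (unif_le1 w k x.1) (unif_le1 w l x.1).
have /andP[h5 h6] := abs2 _ _ (unif_le1 w k x.2) (unif_le1 w l x.2).
have h7 (z : R) : -3 <= z -> z <= 3 -> z ^+ 2 <= 9 by move=> *; nra.
by apply: h7; lra.
Qed.

(** Two pairs of distinct indices that are neither equal nor swapped leave an index of [x] outside
    [y]. Resampling that index in columns [k] and [l] makes the mean vanish. *)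
Lemma pair_kernel_orth k l x y : k != l -> y != x -> y != (x.2, x.1) ->
  mean (fun w : sample => pair_kernel k l x w * pair_kernel k l y w) = 0.
Proof.
move=> kl yx yrx.
have orth x' : x'.1 != y.1 -> x'.1 != y.2 ->
    mean (fun w : sample => pair_kernel k l x' w * pair_kernel k l y w) = 0.
  move=> x1 x2; apply: (mean_orth2 cardL (i := (k, x'.1)) (j := (l, x'.1))).
  - by move=> w a; rewrite pair_kernel_upd.
  - by move=> w a; rewrite pair_kernel_upd.
  - by move=> w; exact: sum_pair_kernel.
have zero f g : f =1 (fun=> 0) -> mean (fun w : sample => f w * g w) = 0 :> R.
  by move=> f0; rewrite -[RHS](mean_cst Om0); apply: eq_mean => w; rewrite f0 mul0r.
have [x12|x12] := eqVneq x.1 x.2.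
  by apply: zero => w; rewrite /pair_kernel x12 eqxx.
have [y12|y12] := eqVneq y.1 y.2.
  rewrite (@eq_mean _ _ _ (fun w => pair_kernel k l y w * pair_kernel k l x w)).
    by apply: zero => w; rewrite /pair_kernel y12 eqxx.
  by move=> w; rewrite mulrC.
have [x1y|hx1] := boolP ((x.1 != y.1) && (x.1 != y.2)).
  by have /andP[] := x1y; exact: orth.
have [x2y|hx2] := boolP ((x.2 != y.1) && (x.2 != y.2)).
  rewrite -(@eq_mean _ _ (fun w => pair_kernel k l (x.2, x.1) w * pair_kernel k l y w)).
    by have /andP[] := x2y; exact: (orth (x.2, x.1)).
  by move=> w; rewrite pair_kernelC.
move: hx1 hx2; rewrite !negb_and !negbK.
move: x y x12 y12 yx yrx {orth zero} => [x1 x2] [y1 y2] /=; rewrite !xpair_eqE.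
move=> x12 y12 yx yrx /orP[]/eqP e2 /orP[]/eqP e1; subst; rewrite ?eqxx ?andbT// in x12 y12 yx yrx *.
Qed.

(** The constant is [18 = 2 * 9]: the factor 2 of [mean_sqr_sum_le] and the bound 9 on the square of
    a kernel made of three terms in [-1, 1], over [n * (n - 1)] pairs of distinct indices. *)
Lemma mean_sgn_kendall_gram k l : (1 < n)%N -> k != l ->
  mean (fun w => (sgn_kendall w k l - 2 * gram w k l) ^+ 2) <=
  18 / (n%:R * (n%:R - 1)) :> R.
Proof.
move=> n1 kl; set c : R := n%:R * (n%:R - 1).
have c0 : 0 < c.
  by rewrite /c mulr_gt0 ?subr_gt0 ?ltr1n// ltr0n ltnW.
rewrite (@eq_mean _ _ _ (fun w => c^-1 ^+ 2 * (\sum_x pair_kernel k l x w) ^+ 2)); last first.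
  by move=> w; rewrite sgn_kendall_gram// exprMn.
rewrite meanZ.
have rK : involutive (fun x : 'I_n * 'I_n => (x.2, x.1)) by case.
have := mean_sqr_sum_le Om0 rK (fun x y => @pair_kernel_orth k l x y kl).
have -> : (18 : R) / c = c^-1 ^+ 2 * (18 * c) by field; rewrite gt_eqF.
move=> h; rewrite ler_wpM2l ?sqr_ge0//; apply: le_trans h _.
have -> : (18 : R) * c = 2 * \sum_(x : 'I_n * 'I_n) (if x.1 == x.2 then 0 else 9).
  rewrite -[X in _ = _ * X](_ : \sum_i \sum_j (if i == j :> 'I_n then 0 else 9) = _); last by rewrite pair_big.
  have -> : \sum_i \sum_j (if i == j :> 'I_n then 0 else 9 : R) = \sum_(i < n) 9 * (n%:R - 1).
    apply: eq_bigr => i _; rewrite (bigD1 i)//= eqxx add0r.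
    rewrite (eq_bigr (fun=> 9)); last by move=> j /negbTE ji; rewrite eq_sym ji.
    by rewrite sum_neq_const mulrC.
  by rewrite sumr_const card_ord -[X in _ = _ * X]mulr_natr /c; ring.
rewrite ler_wpM2l//; apply: ler_sum => x _.
case: ifP => x12; last first.
  by rewrite -[leRHS](mean_cst Om0); apply: mean_le => // w; exact: pair_kernel_bound.
rewrite -[leRHS](mean_cst Om0); apply: mean_le => // w.
by rewrite /pair_kernel x12 expr0n.
Qed.

Lemma mean_gram_diag k : (0 < n)%N -> mean (fun w => (gram w k k - v) ^+ 2) <= 2 / n%:R.
Proof.
move=> n0; have nR : n%:R != 0 :> R by rewrite pnatr_eq0 -lt0n.
pose Y i w := unif w k i ^+ 2 - v.
have gE w : (gram w k k - v) ^+ 2 = n%:R^-1 ^+ 2 * (\sum_i Y i w) ^+ 2.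
  rewrite -exprMn sumrB sumr_const card_ord -[v *+ n]mulr_natr mulrBr gramE.
  by rewrite [n%:R^-1 * (v * _)]mulrCA mulVf// mulr1.
rewrite (eq_mean gE) meanZ.
have orth i j : j != i -> j != id i -> mean (fun w : sample => Y i w * Y j w) = 0.
  move=> ji _; apply: (mean_orth1 cardL (i := (k, i))) => w.
    by move=> a; rewrite /Y unif_upd xpair_eqE (negbTE ji) andbF.
  under eq_bigr do rewrite /Y unif_upd eqxx.
  by rewrite sumrB (sum_grid2 R L0) sumr_const card_ord -[v *+ L]mulr_natl subrr.
have idK : involutive (@id 'I_n) by [].
have h := mean_sqr_sum_le Om0 idK orth.
have -> : (2 : R) / n%:R = n%:R^-1 ^+ 2 * (2 * n%:R) by field.
rewrite ler_wpM2l ?sqr_ge0//; apply: le_trans h _; rewrite ler_wpM2l//.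
have -> : (n%:R : R) = \sum_(i < n) 1 by rewrite sumr_const card_ord.
apply: ler_sum => i _; rewrite -[leRHS](mean_cst Om0); apply: mean_le => // w.
rewrite /Y; have := unif2_le1 w k i; have := sqr_ge0 (unif w k i).
by have := grid_var_ge0 R L0; have := grid_var_le R L0; rewrite -/v; nra.
Qed.

(** The diagonal value [2 / 3] is [1 - 1 / 3], the Kendall matrix having diagonal 1 in the absence
    of ties. Inserting that value by hand gives a quantity whose mean can be bounded on the whole
    sample space, ties included. *)
Definition frob_defect w : R :=
  \sum_k \sum_l (if k == l then 2 / 3 - 2 * gram w k k
                 else sgn_kendall w k l - 2 * gram w k l) ^+ 2.

Lemma mean_frob_defect : (1 < n)%N ->
  mean frob_defect <=
  p%:R ^+ 2 * (18 / (n%:R * (n%:R - 1))) + p%:R * (8 / L%:R + 16 / n%:R).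
Proof.
move=> n1; rewrite /frob_defect mean_sum.
have c0 : 0 <= 18 / (n%:R * (n%:R - 1)) :> R.
  by rewrite divr_ge0// mulr_ge0// subr_ge0 ler1n ltnW.
have -> : p%:R ^+ 2 * (18 / (n%:R * (n%:R - 1))) + p%:R * (8 / L%:R + 16 / n%:R) =
   \sum_(k < p) (p%:R * (18 / (n%:R * (n%:R - 1))) + (8 / L%:R + 16 / n%:R)) :> R.
  by rewrite sumr_const card_ord -[RHS]mulr_natr; ring.
apply: ler_sum => k _; rewrite mean_sum (bigD1 k)//= addrC lerD//.
  apply: (@le_trans _ _ (\sum_(l | l != k) (18 / (n%:R * (n%:R - 1))))).
    apply: ler_sum => l lk; rewrite eq_sym (negbTE lk).
    by apply: mean_sgn_kendall_gram => //; rewrite eq_sym.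
  rewrite sumr_const -[leLHS]mulr_natl ler_wpM2r// ler_nat.
  by rewrite -[leqRHS]card_ord max_card.
rewrite eqxx.
have Lp : 0 < L%:R :> R by rewrite ltr0n.
(* With [g = gram w k k], write [2 / 3 - 2 g = 2 ((1 / 3 - v) + (v - g))]. Its square is at most
   [8 (1 / 3 - v)^2 + 8 (g - v)^2], and [0 <= 1 / 3 - v <= 1 / L <= 1]. *)
apply: (@le_trans _ _ (mean (fun w => 8 / L%:R + 8 * (gram w k k - v) ^+ 2))).
  apply: mean_le => // w.
  have h1 := grid_var_near R L0; have h2 := grid_var_le R L0; rewrite -/v in h1 h2.
  have h3 : L%:R^-1 <= 1 :> R by rewrite invf_le1// ler1n.
  have h4 : 0 < L%:R^-1 :> R by rewrite invr_gt0.
  have h5 : (1 / 3 - v) ^+ 2 <= L%:R^-1 by nra.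
  by have := sqr_ge0 ((1 / 3 - v) + (gram w k k - v)); nra.
rewrite meanD meanZ (mean_cst Om0) lerD2l.
by have := mean_gram_diag k (ltnW n1); rewrite -/v; lra.
Qed.

(** As [A] ignores column [i], it acts as a constant when that column is resampled. The centred
    products [xi] are bounded by 1 and orthogonal except for equal or swapped index pairs. *)
Lemma mean_quad_form i (A : sample -> 'M[R]_p) :
  (forall w k a, A (upd w (k, i) a) = A w) ->
  mean (fun w => (\tr ((unif_col w i)^T *m A w *m unif_col w i) - v * \tr (A w)) ^+ 2) <=
  2 * mean (fun w => frob2 (A w)).
Proof.
move=> Ai.
pose xi (x : 'I_p * 'I_p) w := unif w x.1 i * unif w x.2 i - (x.1 == x.2)%:R * v.
pose Y x w := xi x w * A w x.1 x.2.
have formE w : \tr ((unif_col w i)^T *m A w *m unif_col w i) - v * \tr (A w) = \sum_x Y x w.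
  rewrite -[RHS](_ : \sum_k \sum_l Y (k, l) w = _); last first.
    by rewrite pair_big; apply: eq_bigr => -[].
  rewrite /Y /xi/=.
  under [RHS]eq_bigr do under eq_bigr do rewrite mulrBl.
  under [RHS]eq_bigr do rewrite sumrB.
  rewrite sumrB; congr (_ - _).
    rewrite /mxtrace big_ord1 mxE exchange_big; apply: eq_bigr => l _.
    rewrite mxE mulr_suml; apply: eq_bigr => k _; rewrite !mxE; ring.
  rewrite /mxtrace mulr_sumr; apply: eq_bigr => k _.
  rewrite (bigD1 k)//= eqxx mul1r big1 ?addr0// => l /negbTE lk.
  by rewrite eq_sym lk !mul0r.
have xi_upd x w k a : k != x.1 -> k != x.2 -> xi x (upd w (k, i) a) = xi x w.
  by move=> /negbTE k1 /negbTE k2; rewrite /xi !unif_upd !xpair_eqE !(eq_sym _ k) k1 k2.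
have xi_sum x w : \sum_a xi x (upd w (x.1, i) a) = 0.
  rewrite /xi; under eq_bigr do rewrite !unif_upd !xpair_eqE !eqxx andbT/=.
  rewrite [x.2 == _]eq_sym; case: eqP => _.
    under eq_bigr do rewrite -expr2 mul1r.
    by rewrite sumrB (sum_grid2 R L0) sumr_const card_ord -[v *+ L]mulr_natl subrr.
  by under eq_bigr do rewrite mul0r subr0; rewrite -mulr_suml (sum_grid R L0) mul0r.
have xiC x w : xi (x.2, x.1) w = xi x w by rewrite /xi/= mulrC eq_sym.
have orth0 x y (g : sample -> R) : (forall w a, g (upd w (x.1, i) a) = g w) ->
    x.1 != y.1 -> x.1 != y.2 -> mean (fun w => xi x w * (xi y w * g w)) = 0.
  move=> gx xy1 xy2; apply: (mean_orth1 cardL (i := (x.1, i))) => w; last exact: xi_sum.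
  by move=> a; rewrite gx xi_upd.
have rK : involutive (fun x : 'I_p * 'I_p => (x.2, x.1)) by case.
have orth x y : y != x -> y != (x.2, x.1) -> mean (fun w => Y x w * Y y w) = 0.
  move=> yx yrx; pose g w := A w x.1 x.2 * A w y.1 y.2.
  have gi w k a : g (upd w (k, i) a) = g w by rewrite /g Ai.
  have YE w : Y x w * Y y w = xi x w * (xi y w * g w) by rewrite /Y /g; ring.
  have YE2 w : Y x w * Y y w = xi (x.2, x.1) w * (xi y w * g w) by rewrite YE xiC.
  have YE3 w : Y x w * Y y w = xi y w * (xi x w * g w) by rewrite YE; ring.
  have YE4 w : Y x w * Y y w = xi (y.2, y.1) w * (xi x w * g w) by rewrite YE3 xiC.
  (* Diagonal pairs now occur, so the index lying in only one of the two pairs may have to come from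
     [y]: [x = (a, a)] and [y = (a, b)] are separated by [b] alone. Hence four attempts. *)
  have [/andP[]|h0] := boolP ((x.1 != y.1) && (x.1 != y.2)).
    by rewrite (eq_mean YE); exact: orth0.
  have [/andP[]|h1] := boolP ((x.2 != y.1) && (x.2 != y.2)).
    by rewrite (eq_mean YE2); exact: (orth0 (x.2, x.1)).
  have [/andP[]|h2] := boolP ((y.1 != x.1) && (y.1 != x.2)).
    by rewrite (eq_mean YE3); exact: orth0.
  have [/andP[]|h3] := boolP ((y.2 != x.1) && (y.2 != x.2)).
    by rewrite (eq_mean YE4); exact: (orth0 (y.2, y.1)).
  move: h0 h1 h2 h3; rewrite !negb_and !negbK.
  move: x y yx yrx {g gi YE YE2 YE3 YE4} => [x1 x2] [y1 y2] /=; rewrite !xpair_eqE.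
  move=> yx yrx /orP[]/eqP e4 /orP[]/eqP e3 /orP[]/eqP e2 /orP[]/eqP e1; subst;
    rewrite ?eqxx ?andbT// in yx yrx *.
rewrite (@eq_mean _ _ _ (fun w => (\sum_x Y x w) ^+ 2)); last first.
  by move=> w; rewrite formE.
apply: le_trans (mean_sqr_sum_le Om0 rK orth) _; rewrite ler_wpM2l//.
rewrite -mean_sum; apply: mean_le => // w.
rewrite frob2E pair_big/=; apply: ler_sum => x _.
rewrite /Y exprMn ler_piMl ?sqr_ge0// /xi.
have := unif_le1 w x.1 i; have := unif_le1 w x.2 i; have := grid_var_ge0 R L0; have := grid_var_le R L0.
rewrite -/v; case: eqP => [->|_] v1 v0 /andP[a1 a2] /andP[b1 b2].
  rewrite mul1r -expr2; set z := unif w _ _ in a1 a2 *.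
  have : z ^+ 2 <= 1 by nra.
  by have := sqr_ge0 z; nra.
rewrite mul0r subr0 exprMn; have := unif2_le1 w x.1 i; have := unif2_le1 w x.2 i.
by have := sqr_ge0 (unif w x.1 i); have := sqr_ge0 (unif w x.2 i); nra.
Qed.

Lemma freq_tie k i j : i != j ->
  freq R [pred w : sample | w (k, i) == w (k, j)] = L%:R^-1.
Proof.
move=> ij; rewrite /freq (mean_upd cardL (k, i)) -[RHS](mean_cst Om0).
apply: eq_mean => w; rewrite card_ord.
under eq_bigr => a _.
  rewrite /= upd_same upd_other; first over.
  by rewrite xpair_eqE eqxx/= eq_sym.
rewrite (bigD1 (w (k, j)))//= eqxx big1 ?addr0 ?mul1r// => a /negbTE ->.
by [].
Qed.

End GridSample.

(** * The self-consistent equation *)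

Section PSDGen.
Variable R : realFieldType.

Lemma psd0 p : psd (0 : 'M[R]_p).
Proof. by split=> [|q X]; rewrite ?trmx0// mulmx0 mul0mx mxtrace0. Qed.

Lemma psdD p (A B : 'M[R]_p) : psd A -> psd B -> psd (A + B).
Proof.
move=> [sA pA] [sB pB]; split=> [|q X].
  by rewrite [(A + B)^T]linearD/= sA sB.
by rewrite mulmxDr mulmxDl mxtraceD addr_ge0.
Qed.

Lemma psd_outer p (x : 'cV[R]_p) c : 0 <= c -> psd (c *: (x *m x^T)).
Proof. by move=> c0; rewrite -[_ *: _]add0r; apply: psd_rank1 => //; exact: psd0. Qed.

Lemma psd_sum p (J : Type) (s : seq J) (P : pred J) (F : J -> 'M[R]_p) :
  (forall j, P j -> psd (F j)) -> psd (\sum_(j <- s | P j) F j).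
Proof. by move=> PF; apply: big_ind => //; [exact: psd0|exact: psdD]. Qed.

Lemma psdZ p (A : 'M[R]_p) c : 0 <= c -> psd A -> psd (c *: A).
Proof.
move=> c0 [sA pA]; split=> [|q X]; first by rewrite [(c *: A)^T]linearZ/= sA.
by rewrite -scalemxAr -scalemxAl mxtraceZ mulr_ge0.
Qed.

Lemma psd_scalar p c : 0 <= c -> psd (c%:M : 'M[R]_p).
Proof.
move=> c0; split=> [|q X]; first exact: tr_scalar_mx.
by rewrite mul_mx_scalar -scalemxAl mxtraceZ mulr_ge0// frob2_ge0.
Qed.

Lemma mean_sqr_le (Om : finType) (f : Om -> R) : (0 < #|Om|)%N ->
  mean f ^+ 2 <= mean (fun w => f w ^+ 2).
Proof.
move=> Om0; have := mean_ge0 (fun w => sqr_ge0 (f w - mean f)).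
rewrite (@eq_mean _ _ _ (fun w => f w ^+ 2 + (- 2 * mean f * f w + mean f ^+ 2))).
  by rewrite meanD meanD meanZ mean_cst// => h; nra.
by move=> w; ring.
Qed.

Lemma mean_exchange (Om Om' : finType) (f : Om -> Om' -> R) :
  mean (fun w => mean (f w)) = mean (fun w' => mean (f^~ w')).
Proof. by rewrite /mean -!mulr_suml exchange_big/= mulrAC. Qed.

Lemma frac_lip (x y : R) : 0 <= x -> 0 <= y ->
  (x / (1 + x) - y / (1 + y)) ^+ 2 <= (x - y) ^+ 2.
Proof.
move=> x0 y0.
have x1 : 0 < 1 + x by lra.
have y1 : 0 < 1 + y by lra.
have -> : x / (1 + x) - y / (1 + y) = (x - y) / ((1 + x) * (1 + y)).
  by field; rewrite !gt_eqF.
rewrite exprMn ler_piMr ?sqr_ge0//; apply: exprn_ile1.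
  by rewrite invr_ge0 mulr_ge0 ?ltW.
by rewrite invf_le1 ?mulr_gt0//; nra.
Qed.

End PSDGen.

Section SelfConsistent.
Variables (R : realFieldType) (p n L : nat) (t : R).
Hypotheses (L0 : (0 < L)%N) (n1 : (1 < n)%N) (t0 : 0 < t).

Notation sample := (sample p n L).
Implicit Types (w : sample) (i : 'I_n).
Let v : R := grid_var R L.
Let n0 : 0 < n%:R :> R. Proof. by rewrite ltr0n ltnW. Qed.
Let nV0 : 0 <= n%:R^-1 :> R. Proof. by rewrite invr_ge0 ltW. Qed.
Let Om0 : (0 < #|{: sample}|)%N.
Proof. by apply: card_ffun_gt0; rewrite card_ord. Qed.
Let v0 : 0 <= v. Proof. exact: grid_var_ge0. Qed.
Let v1 : v <= 1 / 3. Proof. exact: grid_var_le. Qed.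

Definition gram_but i w : 'M[R]_p :=
  \sum_(j | j != i) n%:R^-1 *: (unif_col R w j *m (unif_col R w j)^T).

(** Divided by [n] rather than [p], so that the leave-one-out forms concentrate around
    [v * stieltjes w] without an aspect ratio. *)
Definition stieltjes w : R := \tr (resolvent t (gram R w)) / n%:R.

Definition loo_form i w : R :=
  n%:R^-1 * \tr ((unif_col R w i)^T *m resolvent t (gram_but i w) *m unif_col R w i).

Definition sc_error w : R :=
  p%:R / n%:R - t * stieltjes w - v * stieltjes w / (1 + v * stieltjes w).

Lemma psd_gram w : psd (gram R w).
Proof. by apply: psd_sum => i _; exact: psd_outer. Qed.

Lemma psd_gram_but i w : psd (gram_but i w).
Proof. by apply: psd_sum => j _; exact: psd_outer. Qed.

Lemma gram_butE i w :
  gram R w = gram_but i w + n%:R^-1 *: (unif_col R w i *m (unif_col R w i)^T).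
Proof. by rewrite /gram (bigD1 i)//= addrC. Qed.

Lemma gram_but_upd i w k a : gram_but i (upd w (k, i) a) = gram_but i w.
Proof.
apply: eq_bigr => j ji; have -> // : unif_col R (upd w (k, i) a) j = unif_col R w j.
by apply/colP => l; rewrite !mxE unif_upd xpair_eqE (negbTE ji) andbF.
Qed.

Lemma loo_form_ge0 i w : 0 <= loo_form i w.
Proof. by rewrite mulr_ge0// resolvent_form_ge0//; exact: psd_gram_but. Qed.

Lemma stieltjes_ge0 w : 0 <= stieltjes w.
Proof. by rewrite divr_ge0 ?(ltW n0)// resolvent_trace_ge0//; exact: psd_gram. Qed.

Lemma stieltjes_le w : t * stieltjes w <= p%:R / n%:R.
Proof.
by rewrite mulrA ler_wpM2r// resolvent_trace_le//; exact: psd_gram.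
Qed.

(* The trace of [(W + t) Q = 1], where Sherman-Morrison isolates the vector
   [unif_col w i] in each rank-one term of [W]. *)
Lemma trace_identity w :
  p%:R / n%:R - t * stieltjes w = mean (fun i => loo_form i w / (1 + loo_form i w)).
Proof.
rewrite /mean card_ord.
have -> : \sum_i (loo_form i w / (1 + loo_form i w)) =
    \tr (gram R w *m resolvent t (gram R w)).
  rewrite {1}/gram mulmx_suml raddf_sum/=; apply: eq_bigr => i _.
  rewrite -resolvent_rank1_form//; last exact: psd_gram_but.
  by rewrite -gram_butE -scalemxAl mxtraceZ mxtrace_mulC mulmxA.
have := resolventK (psd_gram w) t0.
rewrite mulmxDl mul_scalar_mx => /(congr1 (@mxtrace _ _)).
rewrite mxtraceD mxtraceZ mxtrace1 => <-; rewrite /stieltjes.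
by rewrite mulrDl mulrA addrK.
Qed.

(** Two errors are separated: the fluctuation of the quadratic form around its mean given the other
    columns, and the change of trace caused by removing column [i], at most [1 / t] by the rank-one
    bound. *)
Lemma loo_form_near i w :
  (loo_form i w - v * stieltjes w) ^+ 2 <=
  2 / n%:R ^+ 2 * (\tr ((unif_col R w i)^T *m resolvent t (gram_but i w) *m unif_col R w i)
    - v * \tr (resolvent t (gram_but i w))) ^+ 2 + 2 / (n%:R ^+ 2 * t ^+ 2).
Proof.
rewrite /loo_form /stieltjes (gram_butE i).
have := resolvent_rank1_trace (unif_col R w i) (psd_gram_but i w) nV0 t0.
set a := \tr _; set b := \tr _; set c := \tr _ => /andP[h1 h2].
have -> : n%:R^-1 * c - v * (b / n%:R) = n%:R^-1 * ((c - v * a) + v * (a - b)).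
  by field; rewrite gt_eqF.
have h3 : (v * (a - b)) ^+ 2 <= t^-1 ^+ 2.
  rewrite ler_sqr ?nnegrE ?(mulr_ge0 v0 h1) ?invr_ge0 ?(ltW t0)//.
  by apply: le_trans h2; rewrite ler_piMl//; apply: le_trans v1 _; lra.
have -> : 2 / n%:R ^+ 2 * (c - v * a) ^+ 2 + 2 / (n%:R ^+ 2 * t ^+ 2) =
   n%:R^-1 ^+ 2 * (2 * (c - v * a) ^+ 2 + 2 * t^-1 ^+ 2).
  by field; rewrite !gt_eqF.
rewrite exprMn ler_wpM2l ?sqr_ge0//.
by have := sqr_ge0 ((c - v * a) - v * (a - b)); nra.
Qed.

(** By [trace_identity], [sc_error] is an average over [i] of differences of [x / (1 + x)], a
    1-Lipschitz function on the nonnegative reals. Jensen reduces its square to the fluctuation of a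
    single [loo_form], to which [mean_quad_form] applies because [gram_but i] omits column [i]. *)
Lemma mean_sc_error : mean (fun w => sc_error w ^+ 2) <=
  (4 * p%:R + 2) / (n%:R ^+ 2 * t ^+ 2).
Proof.
have card_n : (0 < #|'I_n|)%N by rewrite card_ord ltnW.
have le1 w : sc_error w ^+ 2 <= mean (fun i => (loo_form i w - v * stieltjes w) ^+ 2).
  have -> : sc_error w = mean (fun i => loo_form i w / (1 + loo_form i w) -
      v * stieltjes w / (1 + v * stieltjes w)).
    by rewrite meanD (mean_cst card_n) -trace_identity.
  apply: le_trans (mean_sqr_le _ card_n) _; apply: (mean_le card_n) => i.
  by apply: frac_lip; [exact: loo_form_ge0|rewrite mulr_ge0// stieltjes_ge0].
apply: le_trans (mean_le Om0 le1) _.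
rewrite mean_exchange -[leRHS](mean_cst card_n); apply: (mean_le card_n) => i.
apply: le_trans (mean_le Om0 (loo_form_near i)) _.
rewrite meanD meanZ (mean_cst Om0).
have h := mean_quad_form L0 (i := i) (A := fun w => resolvent t (gram_but i w)).
have {}h := h (fun w k a => congr1 _ (gram_but_upd i w k a)).
have h2 : mean (fun w => frob2 (resolvent t (gram_but i w))) <= p%:R / t ^+ 2.
  rewrite -[leRHS](mean_cst Om0); apply: mean_le => // w.
  rewrite ler_pdivlMr ?exprn_gt0// mulrC.
  by apply: resolvent_frob2 => //; exact: psd_gram_but.
have -> : (4 * p%:R + 2) / (n%:R ^+ 2 * t ^+ 2) =
   2 / n%:R ^+ 2 * (2 * (p%:R / t ^+ 2)) + 2 / (n%:R ^+ 2 * t ^+ 2).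
  by field; rewrite !gt_eqF.
rewrite lerD2r ler_wpM2l ?divr_ge0 ?exprn_ge0 ?(ltW n0)//.
by apply: le_trans h _; rewrite ler_wpM2l.
Qed.

(* The left-hand side of the limiting equation has slope at least [t] in [m]. *)
Lemma stieltjes_near w g m : 0 <= m -> t * m + m / 3 / (1 + m / 3) = g ->
  t * `|stieltjes w - m| <=
  `|sc_error w| + `|p%:R / n%:R - g| + p%:R / n%:R / t / L%:R.
Proof.
move=> m0 mE; have := stieltjes_ge0 w; have := stieltjes_le w.
rewrite /sc_error; set z := stieltjes w; set c := p%:R / n%:R => zle z0.
have h : 1 / 3 - v <= L%:R^-1 := grid_var_near R L0.
clearbody v.
have c0 : 0 <= c by rewrite divr_ge0// ltW.
set e := c - t * z - v * z / (1 + v * z).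
have vz0 : 0 <= v * z by rewrite mulr_ge0.
have z3 : 0 < 1 + z / 3 by lra.
have m3 : 0 < 1 + m / 3 by lra.
have vz1 : 0 < 1 + v * z by lra.
(* [d] is the cost of replacing the grid variance [v] by its limit [1 / 3]; it is of order
   [1 / L]. *)
pose d := z / 3 / (1 + z / 3) - v * z / (1 + v * z).
have dE : d = z * (1 / 3 - v) / ((1 + z / 3) * (1 + v * z)).
  by rewrite /d; field; rewrite !gt_eqF//; lra.
have zv0 : 0 <= z * (1 / 3 - v) by rewrite mulr_ge0// subr_ge0.
have dd0 : 0 < (1 + z / 3) * (1 + v * z) by rewrite mulr_gt0.
have d0 : 0 <= d by rewrite dE divr_ge0// ltW.
have d1 : d <= c / t / L%:R.
  apply: (@le_trans _ _ (z * (1 / 3 - v))).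
    rewrite dE ler_piMr// invf_le1//.
    by have := mulr_ge0 z0 vz0; nra.
  apply: ler_pM => //; first by rewrite subr_ge0.
  by rewrite ler_pdivlMr// mulrC.
have slope : (z - m) * (t + (3 * (1 + z / 3) * (1 + m / 3))^-1) = c - g - e + d.
  by rewrite -mE /e /d; field; rewrite !gt_eqF//; lra.
have k0 : 0 <= (3 * (1 + z / 3) * (1 + m / 3))^-1.
  by rewrite invr_ge0 !mulr_ge0// ltW.
apply: (@le_trans _ _ `|c - g - e + d|).
  rewrite -slope normrM [leRHS]mulrC ler_wpM2r//.
  by rewrite ger0_norm ?lerDl// addr_ge0// ltW.
apply: le_trans (ler_normD _ _) _; rewrite (ger0_norm d0) lerD//.
by apply: le_trans (ler_normB _ _) _; rewrite addrC.
Qed.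

End SelfConsistent.

(** * From the Gram matrix to the Kendall matrix of a grid sample *)

Section KendallResolvent.
Variables (R : realFieldType) (p n L : nat).
Hypotheses (L0 : (0 < L)%N) (n1 : (1 < n)%N) (p0 : (0 < p)%N).

Notation sample := (sample p n L).
Implicit Types (w : sample).
Let n0 : 0 < n%:R :> R. Proof. by rewrite ltr0n ltnW. Qed.
Let p0R : 0 < p%:R :> R. Proof. by rewrite ltr0n. Qed.
Let n1R : 0 < n%:R - 1 :> R. Proof. by rewrite subr_gt0 ltr1n. Qed.
Let Om0 : (0 < #|{: sample}|)%N.
Proof. by apply: card_ffun_gt0; rewrite card_ord. Qed.

Definition no_tie : pred sample := fun w =>
  [forall k, forall i, forall j, (i != j) ==> (w (k, i) != w (k, j))].

Lemma psd_sgn_kendall w : psd (sgn_kendall R w).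
Proof.
have -> : sgn_kendall R w = \sum_i \sum_j (n%:R * (n%:R - 1))^-1 *:
    ((\col_k sgn R w k i j) *m (\col_k sgn R w k i j)^T).
  apply/matrixP => k l; rewrite mxE summxE mulr_sumr; apply: eq_bigr => i _.
  rewrite summxE mulr_sumr; apply: eq_bigr => j _.
  by rewrite !mxE big_ord1 !mxE.
apply: psd_sum => i _; apply: psd_sum => j _; apply: psd_outer.
by rewrite invr_ge0 mulr_ge0 ?ltW.
Qed.

Lemma sgn_kendall_diag w k : no_tie w -> sgn_kendall R w k k = 1.
Proof.
move=> /forallP/(_ k)/forallP nt; rewrite mxE.
have -> : \sum_i \sum_j sgn R w k i j * sgn R w k i j = \sum_(i < n) (n%:R - 1).
  apply: eq_bigr => i _; rewrite (bigD1 i)//= sgnn mul0r add0r.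
  rewrite -[RHS]mulr1 -(sum_neq_const i); apply: eq_bigr => j ji.
  have /forallP/(_ j) := nt i; rewrite eq_sym ji/= => wij.
  by rewrite -expr2 /sgn sqr_sg subr_eq0 eqr_nat -val_eqE in wij *; rewrite wij.
by rewrite sumr_const card_ord -[(n%:R - 1) *+ n]mulr_natl mulVf// gt_eqF// mulr_gt0.
Qed.

Lemma frob_defectE w : no_tie w ->
  frob2 (sgn_kendall R w - (2 *: gram R w + (1 / 3)%:M)) = frob_defect R w.
Proof.
move=> nt; rewrite frob2E; apply: eq_bigr => k _; apply: eq_bigr => l _.
have entry (A B : 'M[R]_p) c :
  (A - (2 *: B + c%:M)) k l = A k l - (2 * B k l + c *+ (k == l)) by rewrite !mxE.
rewrite entry; congr (_ ^+ 2); have [<-|kl] := eqVneq k l.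
  by rewrite sgn_kendall_diag// mulr1n; field.
by rewrite mulr0n addr0.
Qed.

(** A union bound over the coordinate and the two sample indices, each tie having frequency
    [1 / L]. *)
Lemma freq_ties : freq R [pred w : sample | ~~ no_tie w] <= p%:R * n%:R ^+ 2 / L%:R.
Proof.
pose T (x : 'I_p * 'I_n * 'I_n) : pred sample :=
  fun w => (x.1.2 != x.2) && (w (x.1.1, x.1.2) == w (x.1.1, x.2)).
apply: (@le_trans _ _ (freq R [pred w | has (T^~ w) (index_enum _)])).
  apply: freq_le => // w /= /forallPn[k /forallPn[i /forallPn[j]]].
  rewrite negb_imply negbK => h; apply/hasP; exists (k, i, j) => //.
  exact: mem_index_enum.
apply: le_trans (freq_has _ Om0 _ _) _.
have -> : p%:R * n%:R ^+ 2 / L%:R = \sum_(x : 'I_p * 'I_n * 'I_n) L%:R^-1 :> R.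
  by rewrite sumr_const !card_prod !card_ord -[RHS]mulr_natl !natrM expr2 mulrA.
apply: ler_sum => -[[k i] j] _.
have [->|ij] := eqVneq i j.
  rewrite [freq _ _](_ : _ = 0) ?invr_ge0//.
  by rewrite -[RHS](mean_cst Om0); apply: eq_mean => w; rewrite /T/= eqxx.
by rewrite -(freq_tie R L0 k ij); apply: freq_le => // w /andP[].
Qed.

(** Factoring 2 out of [2 W + 1 / 3 + t] leaves [W + s] with [s = (1 / 3 + t) / 2], the argument at
    which the self-consistent equation is used from here on. *)
Lemma resolvent_affine w t : 0 < t ->
  \tr (resolvent t (2 *: gram R w + (1 / 3)%:M)) =
  n%:R / 2 * stieltjes ((1 / 3 + t) / 2) w.
Proof.
move=> t0; rewrite /stieltjes /resolvent.
have -> : 2 *: gram R w + (1 / 3)%:M + t%:M = 2 *: (gram R w + ((1 / 3 + t) / 2)%:M).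
  rewrite scalerDr scale_scalar_mx -addrA -raddfD/=; congr (_ + _%:M).
  by field.
rewrite invmxZ ?unitfE// ?mxtraceZ; last first.
  rewrite unitmxZ ?unitfE ?pnatr_eq0//.
  by apply: resolvent_unit; [exact: psd_gram|lra].
by field; rewrite gt_eqF.
Qed.

(** The deviation [3 * e] is split in three: the deterministic error is below [e], so either the
    Frobenius defect or the error in the self-consistent equation contributes at least [e]. Both
    alternatives are squared, ready for Markov's inequality. *)
Lemma kendall_resolvent_near w t g m : 0 < t -> 0 < g -> no_tie w -> 0 <= m ->
  let s := (1 / 3 + t) / 2 in let c := p%:R / n%:R in
  s * m + m / 3 / (1 + m / 3) = g ->
  forall e, 0 < e ->
  (`|c - g| + c / s / L%:R) / (2 * c * s) + m * `|1 / (2 * c) - 1 / (2 * g)| < e ->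
  3 * e <= `|\tr (resolvent t (sgn_kendall R w)) / p%:R - m / (2 * g)| ->
  (e ^+ 2 <= frob_defect R w / (p%:R * t ^+ 4)) ||
  (e ^+ 2 <= sc_error s w ^+ 2 / (2 * c * s) ^+ 2).
Proof.
move=> t0 g0 nt m0 s c mE e e0 det.
have s0 : 0 < s by rewrite /s; lra.
have c0 : 0 < c by rewrite divr_gt0.
have := stieltjes_near L0 n1 s0 w m0 mE; rewrite -/c.
set z := stieltjes s w => zm.
set r := \tr _ => far.
pose rB := z / (2 * c).
have rBE : \tr (resolvent t (2 *: gram R w + (1 / 3)%:M)) / p%:R = rB.
  rewrite resolvent_affine// -/s -/z /rB /c.
  by field; rewrite !gt_eqF.
have h1 : (r / p%:R - rB) ^+ 2 <= frob_defect R w / (p%:R * t ^+ 4).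
  rewrite -rBE -mulrBl exprMn -frob_defectE//.
  have pB : psd (2 *: gram R w + (1 / 3)%:M).
    by apply: psdD; [apply: psdZ => //; exact: psd_gram|apply: psd_scalar; lra].
  have := resolvent_trace_diff (psd_sgn_kendall w) pB t0; rewrite -/r => h.
  rewrite ler_pdivlMr ?mulr_gt0 ?exprn_gt0//.
  rewrite -(ler_pM2l p0R); apply: le_trans h; rewrite le_eqVlt; apply/orP; left; apply/eqP.
  by field; rewrite gt_eqF.
have h2 : `|rB - m / (2 * g)| <= `|sc_error s w| / (2 * c * s) +
   ((`|c - g| + c / s / L%:R) / (2 * c * s) + m * `|1 / (2 * c) - 1 / (2 * g)|).
  have -> : rB - m / (2 * g) = (z - m) / (2 * c) + m * (1 / (2 * c) - 1 / (2 * g)).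
    by rewrite /rB; field; rewrite !gt_eqF.
  apply: le_trans (ler_normD _ _) _; rewrite [`|m * _|]normrM (ger0_norm m0) addrA lerD2r.
  have c2 : 0 < 2 * c by rewrite mulr_gt0.
  rewrite normrM normfV (gtr0_norm c2) -mulrDl addrA ler_pdivrMr//.
  set X := _ + _ + _; have -> : X / (2 * c * s) * (2 * c) = X / s.
    by field; rewrite !gt_eqF.
  by rewrite ler_pdivlMr// mulrC.
have h3 : 2 * e <= `|r / p%:R - rB| + `|sc_error s w| / (2 * c * s).
  have := ler_normD (r / p%:R - rB) (rB - m / (2 * g)); rewrite addrA subrK.
  by move=> h; lra.
have cs0 : 0 < 2 * c * s by rewrite mulr_gt0// mulr_gt0.
have [h4|h4] := leP e `|r / p%:R - rB|.
  apply/orP; left; apply: le_trans h1; rewrite -[leRHS]real_normK ?num_real//.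
  by rewrite ler_sqr ?nnegrE ?(ltW e0).
apply/orP; right; rewrite -[sc_error s w ^+ 2]real_normK ?num_real// -expr_div_n.
rewrite ler_sqr ?nnegrE ?(ltW e0)//; last by rewrite divr_ge0// ltW.
by set X := _ / _ in h3 *; lra.
Qed.

Lemma freq_kendall_resolvent t g m : 0 < t -> 0 < g -> 0 <= m ->
  let s := (1 / 3 + t) / 2 in let c := p%:R / n%:R in
  s * m + m / 3 / (1 + m / 3) = g ->
  forall e, 0 < e ->
  (`|c - g| + c / s / L%:R) / (2 * c * s) + m * `|1 / (2 * c) - 1 / (2 * g)| < e ->
  freq R [pred w : sample | no_tie w &&
    (3 * e <= `|\tr (resolvent t (sgn_kendall R w)) / p%:R - m / (2 * g)|)] <=
  (c * (18 / (n%:R - 1)) + (8 / L%:R + 16 / n%:R)) / t ^+ 4 / e ^+ 2 +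
  (4 * c + 2 / n%:R) / n%:R / s ^+ 2 / (2 * c * s) ^+ 2 / e ^+ 2.
Proof.
move=> t0 g0 m0 s c mE e e0 det.
have s0 : 0 < s by rewrite /s; lra.
have c0 : 0 < c by rewrite divr_gt0.
have e20 : 0 < e ^+ 2 by rewrite exprn_gt0.
pose F1 w := (p%:R * t ^+ 4)^-1 * frob_defect R w.
pose F2 w := ((2 * c * s) ^+ 2)^-1 * sc_error s w ^+ 2.
apply: (@le_trans _ _ (freq R [pred w | (e ^+ 2 <= F1 w) || (e ^+ 2 <= F2 w)])).
  apply: freq_le => // w /= /andP[nt far]; rewrite /F1 /F2 mulrC [X in _ || (_ <= X)]mulrC.
  exact: (kendall_resolvent_near t0 g0 nt m0 mE e0 det far).
apply: le_trans (freqU _ Om0 _ _) _; apply: lerD.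
  apply: le_trans (markov_freq Om0 e20 _) _ => [w|].
    rewrite mulr_ge0 ?invr_ge0 ?mulr_ge0 ?exprn_ge0 ?(ltW t0)//.
    by apply: sumr_ge0 => k _; apply: sumr_ge0 => l _; exact: sqr_ge0.
  rewrite ler_wpM2r ?invr_ge0 ?(ltW e20)// meanZ mulrC ler_pdivrMr ?mulr_gt0 ?exprn_gt0//.
  apply: le_trans (mean_frob_defect R p L0 n1) _.
  rewrite le_eqVlt; apply/orP; left; apply/eqP; rewrite /c.
  have L0R : 0 < L%:R :> R by rewrite ltr0n.
  by field; rewrite !gt_eqF.
apply: le_trans (markov_freq Om0 e20 _) _ => [w|].
  by rewrite mulr_ge0 ?sqr_ge0// invr_ge0 sqr_ge0.
rewrite ler_wpM2r ?invr_ge0 ?(ltW e20)// meanZ mulrC ler_wpM2r ?invr_ge0 ?sqr_ge0//.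
apply: le_trans (mean_sc_error p L0 n1 s0) _.
rewrite le_eqVlt; apply/orP; left; apply/eqP; rewrite /c.
by field; rewrite !gt_eqF.
Qed.

End KendallResolvent.

(** * Passage to the limit in [n] for a fixed resolvent argument *)

Section Limit.
Variables (R : realType) (p L : nat -> nat) (gamma : R).
Hypotheses (p0 : forall n, (2 <= n)%N -> (0 < p n)%N) (nL : forall n, (n < L n)%N).
Hypotheses (g0 : 0 < gamma) (pg : (fun n => (p n)%:R / n%:R : R) @ \oo --> gamma).

Let c n : R := (p n)%:R / n%:R.

Let cvgn : (fun n => n%:R^-1 : R) @ \oo --> (0 : R).
Proof.
apply/gtr0_cvgV0; last exact: cvgr_idn.
by near=> n; rewrite ltr0n; near: n; exact: nbhs_infty_gt.
Unshelve. all: by end_near. Qed.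

Let cvgL : (fun n => (L n)%:R^-1 : R) @ \oo --> (0 : R).
Proof.
apply: (squeeze_cvgr _ (cvg_cst 0) cvgn); near=> n.
have n0 : (0 < n)%N by near: n; exact: nbhs_infty_gt.
rewrite invr_ge0 ler0n/= lef_pV2 ?posrE ?ltr0n// ?(ltn_trans n0)//.
by rewrite ler_nat ltnW.
Unshelve. all: by end_near. Qed.

Let cvgn1 : (fun n => (n%:R - 1)^-1 : R) @ \oo --> (0 : R).
Proof.
rewrite -(cvg_shiftS (fun n => (n%:R - 1)^-1 : R)).
by under eq_fun do rewrite -natr1 addrK.
Qed.

Lemma near_freq_kendall_resolvent (t m : R) : 0 < t -> 0 <= m ->
  (1 / 3 + t) / 2 * m + m / 3 / (1 + m / 3) = gamma ->
  forall e d : R, 0 < e -> 0 < d ->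
  \forall n \near \oo,
  freq R [pred w : sample (p n) n (L n) | no_tie w &&
    (e <= `|\tr (resolvent t (sgn_kendall R w)) / (p n)%:R - m / (2 * gamma)|)] <= d.
Proof.
move=> t0 m0 mE e d e0 d0; set s := (1 / 3 + t) / 2 in mE.
have s0 : 0 < s by rewrite /s; lra.
have e3 : 0 < e / 3 by rewrite divr_gt0.
have cs : (fun n => (2 * c n * s)^-1) @ \oo --> (2 * gamma * s)^-1.
  apply: cvgV; first by rewrite gt_eqF// mulr_gt0// mulr_gt0.
  by apply: cvgMr_tmp; apply: cvgMl_tmp.
have det : (fun n => (`|c n - gamma| + c n / s / (L n)%:R) / (2 * c n * s) +
    m * `|1 / (2 * c n) - 1 / (2 * gamma)|) @ \oo --> 0.
  have -> : 0 = (`|gamma - gamma| + gamma / s * 0) * (2 * gamma * s)^-1 +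
     m * `|1 * (2 * gamma)^-1 - 1 / (2 * gamma)|.
    by rewrite subrr normr0 mulr0 addr0 mul0r subrr normr0 mulr0 addr0.
  apply: cvgD.
    apply: cvgM cs; apply: cvgD.
      by apply: cvg_norm; apply: cvgB => //; exact: cvg_cst.
    by apply: cvgM cvgL; apply: cvgMr_tmp.
  apply: cvgMl_tmp; apply: cvg_norm; apply: cvgB; last exact: cvg_cst.
  apply: cvgMl_tmp; apply: cvgV; first by rewrite gt_eqF// mulr_gt0.
  exact: cvgMl_tmp.
have bnd : (fun n => (c n * (18 / (n%:R - 1)) + (8 / (L n)%:R + 16 / n%:R)) / t ^+ 4 / (e / 3) ^+ 2 +
  (4 * c n + 2 / n%:R) / n%:R / s ^+ 2 / (2 * c n * s) ^+ 2 / (e / 3) ^+ 2) @ \oo --> 0.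
  have -> : 0 = (gamma * (18 * 0) + (8 * 0 + 16 * 0)) / t ^+ 4 / (e / 3) ^+ 2 +
     (4 * gamma + 2 * 0) * 0 / s ^+ 2 * ((2 * gamma * s)^-1 ^+ 2) / (e / 3) ^+ 2.
    by rewrite !(mulr0, addr0, mul0r).
  under eq_fun do rewrite -[((2 * _ * s) ^+ 2)^-1]exprVn.
  apply: cvgD; apply: cvgMr_tmp.
    apply: cvgMr_tmp; apply: cvgD; first by apply: cvgM => //; exact: cvgMl_tmp.
    by apply: cvgD; exact: cvgMl_tmp.
  apply: cvgM; last by rewrite !expr2; apply: cvgM.
  apply: cvgMr_tmp; apply: cvgM => //; apply: cvgD; exact: cvgMl_tmp.
near=> n.
have n1 : (1 < n)%N by near: n; exact: nbhs_infty_gt.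
have L0 : (0 < L n)%N by apply: leq_ltn_trans (nL n).
apply: le_trans (_ : (c n * (18 / (n%:R - 1)) + (8 / (L n)%:R + 16 / n%:R)) / t ^+ 4 / (e / 3) ^+ 2 +
  (4 * c n + 2 / n%:R) / n%:R / s ^+ 2 / (2 * c n * s) ^+ 2 / (e / 3) ^+ 2 <= d).
  have -> : e = 3 * (e / 3) by field.
  rewrite {2 3}(_ : 3 * (e / 3) = e); last by field.
  apply: (freq_kendall_resolvent L0 n1 (p0 n1) t0 g0 m0 mE e3).
  near: n; exact: (cvgr_lt _ det).
near: n; exact: (cvgr_le _ bnd).
Unshelve. all: by end_near. Qed.

End Limit.

(** * The Stieltjes transform of the Marchenko-Pastur law *)

Section DensityIntegral.
Variables (R : realType) (gamma : R).
Local Notation lam := (@lebesgue_measure R).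
Local Notation dens := (mp_density gamma).
Import HBNNSimple.
Local Open Scope ereal_scope.

Let mdens : measurable_fun [set: R] (EFin \o dens).
Proof. by apply/measurable_EFinP; exact: measurable_mp_density. Qed.

Let integral_mp_ac_indic E : measurable E ->
  \int[mp_ac gamma]_x (\1_E x)%:E = \int[lam]_x ((\1_E x)%:E * (dens x)%:E).
Proof.
move=> mE; rewrite integral_indic//= setIT /mp_ac [LHS]integral_mkcond.
apply: eq_integral => x _; rewrite patchE indicE; case: ifPn => _.
  by rewrite mul1e.
by rewrite mul0e.
Qed.

Let integral_mp_ac_nnsfun (f : {nnsfun R >-> R}) :
  \int[mp_ac gamma]_x (f x)%:E = \int[lam]_x ((f x)%:E * (dens x)%:E).
Proof.
have mf r : measurable (f @^-1` [set r]).
  by rewrite -[X in measurable X]setTI; exact: (measurable_funP f).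
under [LHS]eq_integral do rewrite fimfunE -fsumEFin//.
rewrite [LHS]ge0_integral_fsum//; last 2 first.
  - by move=> r; exact/measurable_EFinP/measurableT_comp.
  - by move=> n x _; rewrite EFinM nnfun_muleindic_ge0.
under [RHS]eq_integral.
  move=> x xD; rewrite fimfunE -fsumEFin// muleC ge0_mule_fsumr; last first.
    by move=> r; rewrite EFinM nnfun_muleindic_ge0.
  over.
rewrite [RHS]ge0_integral_fsum//; last 2 first.
  - move=> r; apply: emeasurable_funM => //.
    apply/measurable_EFinP; apply: measurable_funM => //.
    by apply: measurable_indic; exact: mf.
  - move=> n x _; rewrite EFinM mule_ge0//; last by rewrite nnfun_muleindic_ge0.
    by rewrite lee_fin mp_density_ge0.
apply: eq_fsbigr => r _.
rewrite integralZl_indic_nnsfun//= integral_mp_ac_indic//.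
have [r0|r0] := leP 0%R r.
  rewrite -ge0_integralZl//.
  - by apply: eq_integral => x _; rewrite EFinM muleA muleC.
  - by apply: emeasurable_funM => //; apply/measurable_EFinP; apply: measurable_indic; exact: mf.
  - by move=> x _; rewrite mule_ge0// lee_fin mp_density_ge0.
have f0 x : (\1_(f @^-1` [set r]) x : R) = 0%R.
  rewrite indicE memNset//= => fx; have : (0 <= f x)%R by [].
  by rewrite fx leNgt r0.
under eq_integral do rewrite f0 mul0e.
rewrite integral0 mule0; apply/esym; rewrite (eq_integral (cst 0)) ?integral0//.
by move=> x _; rewrite f0 mulr0 mule0.
Qed.

(** [mp_ac] is given by its values on sets, so the density formula is built up from indicators and
    simple functions by monotone convergence. *)
Lemma integral_mp_ac (f : R -> \bar R) :
  measurable_fun [set: R] f -> (forall x, 0 <= f x) ->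
  \int[mp_ac gamma]_x f x = \int[lam]_x (f x * (dens x)%:E).
Proof.
move=> mf f0.
pose f_ := nnsfun_approx measurableT mf.
have fE x : f x = lim ((f_ n x)%:E @[n --> \oo]).
  by apply/esym/cvg_lim => //; exact: cvg_nnsfun_approx.
transitivity (limn (fun n => \int[mp_ac gamma]_x (f_ n x)%:E)).
  rewrite -monotone_convergence//=.
  - by apply: eq_integral => x _; exact: fE.
  - by move=> n; exact/measurable_EFinP/measurable_funTS.
  - by move=> n ? _; rewrite lee_fin.
  - by move=> ? _ ? ? mn; rewrite lee_fin; exact/lefP/nd_nnsfun_approx.
transitivity (limn (fun n => \int[lam]_x ((f_ n x)%:E * (dens x)%:E))); last first.
  rewrite -monotone_convergence//=.
  - apply: eq_integral => x _; rewrite fE; apply/esym.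
    rewrite muleC -limeMl//; first by congr (lim _); under eq_fun do rewrite muleC.
    by apply/cvg_ex; exists (f x); exact: cvg_nnsfun_approx.
  - move=> n; apply: emeasurable_funM => //.
    by apply/measurable_EFinP; exact: (measurable_funP (f_ n)).
  - by move=> n x _; rewrite mule_ge0 ?lee_fin// mp_density_ge0.
  - move=> x _ m n mn; rewrite lee_pmul ?lee_fin ?mp_density_ge0//.
    by have /lefP/(_ x) := nd_nnsfun_approx measurableT mf mn.
by apply: congr_lim; apply/funext => n; exact: integral_mp_ac_nnsfun.
Qed.

Lemma integral_marchenko_pastur (f : R -> \bar R) :
  measurable_fun [set: R] f -> (forall x, 0 <= f x) ->
  \int[marchenko_pastur gamma]_x f x =
  \int[lam]_x (f x * (dens x)%:E) + (mp_atom gamma)%:E * f 0%R.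
Proof.
move=> mf f0; rewrite /marchenko_pastur ge0_integral_measure_add//.
rewrite [X in X + _](integral_mp_ac mf f0); congr (_ + _).
by rewrite ge0_integral_mscale// integral_dirac// diracT mul1e.
Qed.

End DensityIntegral.

Section OpenFTC.
Variable R : realType.
Local Notation lam := (@lebesgue_measure R).

(** Only one-sided limits are assumed at the ends, since the primitive used below has an infinite
    half angle at [b], and for [gamma = 1] the density is unbounded near [a = 0]. The open interval
    is exhausted by segments, on which the usual theorem holds. *)
Lemma ge0_FTC2_oo (f F : R -> R) (a b la lb : R) : a < b ->
  (forall x, a < x < b -> 0 <= f x) ->
  (forall x, a < x < b -> {for x, continuous f}) ->
  (forall x, a < x < b -> is_derive x 1 F (f x)) ->
  F x @[x --> a^'+] --> la -> F x @[x --> b^'-] --> lb ->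
  (\int[lam]_(x in `]a, b[) (f x)%:E = (lb - la)%:E)%E.
Proof.
move=> ab f0 fc dF Fa Fb.
pose e n : R := (b - a) / 3 * n.+1%:R^-1.
have e0 n : 0 < e n by rewrite mulr_gt0// divr_gt0// subr_gt0.
have e1 n : e n <= (b - a) / 3.
  by rewrite ler_piMr ?divr_ge0 ?subr_ge0 ?(ltW ab)// invf_le1// ler1n.
have ecvg : e n @[n --> \oo] --> (0 : R).
  by rewrite -(mulr0 ((b - a) / 3)); apply: cvgMl_tmp; exact: cvg_harmonic.
have emono m n : (m <= n)%N -> e n <= e m.
  move=> mn; rewrite ler_wpM2l ?divr_ge0 ?subr_ge0 ?(ltW ab)//.
  by rewrite lef_pV2 ?posrE ?ltr0n// ler_nat ltnS.
pose I n := `[a + e n, b - e n]%classic.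
have Iab n x : I n x -> a < x < b.
  rewrite /I/= in_itv/= => /andP[h1 h2]; have := e0 n => h.
  by apply/andP; split; lra.
have IE n : (\int[lam]_(x in I n) (f x)%:E = (F (b - e n) - F (a + e n))%:E)%E.
  have lt : a + e n < b - e n by have := e0 n; have := e1 n; lra.
  have sub x : a + e n <= x <= b - e n -> a < x < b.
    by move=> h; apply: (Iab n); rewrite /I/= in_itv.
  have Fcont x : a < x < b -> {for x, continuous F}.
    by move=> /dF [dx _]; apply/differentiable_continuous/derivable1_diffP.
  rewrite (continuous_FTC2 (F := F) lt).
  - by rewrite EFinB.
  - apply: continuous_in_subspaceT => x; rewrite inE/= in_itv/= => h.
    by apply: fc; exact: sub.
  - split.
    + by move=> x; rewrite in_itv/= => /andP[h1 h2]; apply: (@ex_derive _ _ _ _ _ _ _ (dF _ (sub _ _))); rewrite !ltW.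
    + by apply: cvg_at_right_filter; apply: Fcont; apply: sub; rewrite lexx ltW.
    + by apply: cvg_at_left_filter; apply: Fcont; apply: sub; rewrite lexx ltW.
  - move=> x; rewrite in_itv/= => /andP[h1 h2]; rewrite derive1E.
    by apply: derive_val; apply: dF; apply: sub; rewrite !ltW.
have UI : \bigcup_n I n = `]a, b[%classic.
  apply/seteqP; split => x /=.
    by move=> [n _ /Iab]; rewrite in_itv.
  rewrite in_itv/= => /andP[ax xb].
  have : \forall n \near \oo, e n < Num.min (x - a) (b - x).
    by apply: (cvgr_lt _ ecvg); rewrite lt_min !subr_gt0 ax xb.
  move=> [N _ /(_ N (leqnn N))]; rewrite lt_min => /andP[h1 h2].
  by exists N => //; rewrite /I/= in_itv/=; apply/andP; split; lra.
have := @ge0_nondecreasing_set_cvg_integral _ (measurableTypeR R) R I (EFin \o f) lam.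
have -> : (fun i => (\int[lam]_(x in I i) (EFin \o f) x)%E) = (fun n => (F (b - e n) - F (a + e n))%:E).
  by apply/funext => n; rewrite -IE.
rewrite UI => h.
have h1 : ((F (b - e n) - F (a + e n))%:E @[n --> \oo] --> (lb - la)%:E)%E.
  apply: cvg_EFin; first by near=> n.
  apply: cvgB.
    move/cvg_at_leftP : Fb; apply; split => [n|]; first by have := e0 n; lra.
    by rewrite -[X in _ --> X]subr0; apply: cvgB => //; exact: cvg_cst.
  move/cvg_at_rightP : Fa; apply; split => [n|]; first by have := e0 n; lra.
  by rewrite -[X in _ --> X]addr0; apply: cvgD => //; exact: cvg_cst.
apply: (cvg_unique _ _ h1) => //; apply: h.
- move=> m n mn; apply/subsetPset => x; rewrite /I/= !in_itv/= => /andP[h2 h3].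
  by have := emono _ _ mn; move=> ?; apply/andP; split; lra.
- by move=> n; exact: measurable_itv.
- move=> n; apply/measurable_EFinP; apply: subspace_continuous_measurable_fun.
    exact: measurable_itv.
  apply: continuous_in_subspaceT => x; rewrite inE => /Iab; exact: fc.
- by move=> n x /Iab h2; rewrite lee_fin f0.
Unshelve. all: by end_near. Qed.

End OpenFTC.

Lemma cvg_sqrt (R : realType) (T : Type) (F : set_system T) (FF : Filter F)
  (f : T -> R) l : f @ F --> l -> Num.sqrt (f x) @[x --> F] --> Num.sqrt l.
Proof. by move=> fl; apply: (continuous_cvg _ _ fl); exact: sqrt_continuous. Qed.

Lemma cvg_atan (R : realType) (T : Type) (F : set_system T) (FF : Filter F)
  (f : T -> R) l : f @ F --> l -> atan (f x) @[x --> F] --> atan l.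
Proof. by move=> fl; apply: (continuous_cvg _ _ fl); exact: continuous_atan. Qed.

Section Primitive.
Variables (R : realType) (a b s : R).
Hypotheses (a0 : 0 <= a) (ab : a < b) (s0 : 0 < s).

Let A := a + s.
Let B := b + s.
Let A0 : 0 < A. Proof. by rewrite /A ltr_wpDl. Qed.
Let B0 : 0 < B. Proof. by rewrite /B; have := a0; have := ab; have := s0; lra. Qed.
Let b0 : 0 < b. Proof. exact: le_lt_trans ab. Qed.

(* [y = (a + b * w ^+ 2) / (1 + w ^+ 2)] for [w = half_angle y], which makes the
   Marchenko-Pastur integrand rational in [w]. *)
Definition half_angle (y : R) := Num.sqrt ((y - a) / (b - y)).

(** Partial fractions in [w]: the integrand becomes a constant times [w^2] over
    [(1 + w^2) (a + b w^2) (A + B w^2)]. The three arctangents belong to these factors, that is to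
    [y] infinite, [y = 0] and [y = - s]. *)
Definition mp_primitive (y : R) : R :=
  - atan (half_angle y)
  - Num.sqrt (a * b) / s * atan (Num.sqrt (b / a) * half_angle y)
  + Num.sqrt (A * B) / s * atan (Num.sqrt (B / A) * half_angle y).

Let ratio_derive y : a < y < b ->
  is_derive y 1 (fun y => (y - a) / (b - y)) ((b - a) / (b - y) ^+ 2).
Proof.
move=> /andP[ay yb]; have by0 : b - y != 0 by rewrite subr_eq0 gt_eqF.
have d1 : is_derive y 1 (fun y => b - y) (- 1).
  exact: (is_derive_eq (is_deriveB (is_derive_cst b y 1) (is_derive_id y 1)) (sub0r 1)).
have d2 : is_derive y 1 (fun y => (b - y)^-1) (- (b - y) ^- 2 * (- 1)).
  exact: (@is_deriveV R (fun y => b - y) y (- 1) 1 by0 d1).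
have d3 : is_derive y 1 (fun y => y - a) 1.
  exact: (is_derive_eq (is_deriveB (is_derive_id y 1) (is_derive_cst a y 1)) (subr0 1)).
apply: (is_derive_eq (is_deriveM d3 d2)).
by rewrite /GRing.scale/=; field.
Qed.

Let half_angle_gt0 y : a < y < b -> 0 < half_angle y.
Proof. by move=> /andP[ay yb]; rewrite sqrtr_gt0 divr_gt0// subr_gt0. Qed.

Let half_angle_derive y : a < y < b ->
  is_derive y 1 half_angle ((2 * half_angle y)^-1 * ((b - a) / (b - y) ^+ 2)).
Proof.
move=> yab; have /andP[ay yb] := yab.
apply: (@is_derive1_comp _ Num.sqrt (fun y => (y - a) / (b - y))); last exact: ratio_derive.
by apply: is_derive1_sqrt; rewrite divr_gt0// subr_gt0.
Qed.

Let atan_derive k y : a < y < b ->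
  is_derive y 1 (fun y => atan (k * half_angle y))
   ((1 + (k * half_angle y) ^+ 2)^-1 * (k * ((2 * half_angle y)^-1 * ((b - a) / (b - y) ^+ 2)))).
Proof.
move=> yab; apply: (@is_derive1_comp _ atan (fun y => k * half_angle y)).
exact: (is_deriveZ k (half_angle_derive yab)).
Qed.

Lemma mp_primitive_derive y : a < y < b ->
  is_derive y 1 mp_primitive (Num.sqrt ((b - y) * (y - a)) / (2 * y * (y + s))).
Proof.
move=> yab; have /andP[ay yb] := yab.
have by0 : 0 < b - y by rewrite subr_gt0.
have ya0 : 0 < y - a by rewrite subr_gt0.
have y0 : 0 < y by apply: le_lt_trans ay.
have ba0 : 0 < b - a by rewrite subr_gt0.
have d1 := atan_derive 1 yab.
have d2 := atan_derive (Num.sqrt (b / a)) yab.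
have d3 := atan_derive (Num.sqrt (B / A)) yab.
have d := is_deriveD (is_deriveB (is_deriveN d1) (is_deriveZ (Num.sqrt (a * b) / s) d2))
   (is_deriveZ (Num.sqrt (A * B) / s) d3).
have -> : mp_primitive = (- (fun y => atan (1 * half_angle y)) -
   (Num.sqrt (a * b) / s) *: (fun y => atan (Num.sqrt (b / a) * half_angle y)) +
   (Num.sqrt (A * B) / s) *: (fun y => atan (Num.sqrt (B / A) * half_angle y))).
  by apply/funext => z; rewrite /mp_primitive !fctE mul1r.
apply: (is_derive_eq d); rewrite /GRing.scale/= {d d1 d2 d3}.
rewrite mul1r !exprMn.
set w := half_angle y; have w0 : 0 < w by exact: half_angle_gt0.
have w2 : w ^+ 2 = (y - a) / (b - y) by rewrite sqr_sqrtr// divr_ge0 ?ltW.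
have qE : Num.sqrt ((b - y) * (y - a)) = w * (b - y).
  rewrite -[b - y in RHS](ger0_norm (ltW by0)) -sqrtr_sqr -sqrtrM; last first.
    by rewrite divr_ge0 ?ltW.
  by congr Num.sqrt; field; rewrite gt_eqF.
pose w' := (2 * w)^-1 * ((b - a) / (b - y) ^+ 2).
have t2 : Num.sqrt (a * b) / s * ((1 + Num.sqrt (b / a) ^+ 2 * w ^+ 2)^-1 * (Num.sqrt (b / a) * w')) =
    a * b / (s * y) * ((b - y) / (b - a)) * w'.
  (* For [a = 0], where [b / a] is a conventional value, the coefficient of this arctangent vanishes
     as well. *)
  have [->|an0] := eqVneq a 0; first by rewrite !mul0r sqrtr0 !mul0r.
  have ap : 0 < a by rewrite lt_def an0.
  rewrite sqr_sqrtr ?divr_ge0 ?(ltW b0)// w2.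
  have e1 : Num.sqrt (a * b) * Num.sqrt (b / a) = b.
    rewrite -sqrtrM ?mulr_ge0 ?(ltW b0)//.
    have -> : a * b * (b / a) = b ^+ 2 by field.
    by rewrite sqrtr_sqr ger0_norm ?(ltW b0).
  have e2 : 1 + b / a * ((y - a) / (b - y)) = y * (b - a) / (a * (b - y)).
    by field; rewrite !gt_eqF.
  rewrite e2.
  have -> : a * b / (s * y) * ((b - y) / (b - a)) * w' =
     (Num.sqrt (a * b) * Num.sqrt (b / a)) * (a / (s * y) * ((b - y) / (b - a)) * w').
    by rewrite e1; field; rewrite !gt_eqF.
  by field; rewrite !gt_eqF.
have t3 : Num.sqrt (A * B) / s * ((1 + Num.sqrt (B / A) ^+ 2 * w ^+ 2)^-1 * (Num.sqrt (B / A) * w')) =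
    A * B / (s * (y + s)) * ((b - y) / (b - a)) * w'.
  have ys0 : 0 < y + s by rewrite addr_gt0.
  rewrite sqr_sqrtr ?divr_ge0 ?(ltW B0) ?(ltW A0)// w2.
  have e1 : Num.sqrt (A * B) * Num.sqrt (B / A) = B.
    rewrite -sqrtrM ?mulr_ge0 ?(ltW B0) ?(ltW A0)//.
    have -> : A * B * (B / A) = B ^+ 2 by field; rewrite gt_eqF.
    by rewrite sqrtr_sqr ger0_norm ?(ltW B0).
  have e2 : 1 + B / A * ((y - a) / (b - y)) = (y + s) * (b - a) / (A * (b - y)).
    by rewrite /B; have := A0; rewrite /A => A0'; field; rewrite !gt_eqF.
  rewrite e2.
  have -> : A * B / (s * (y + s)) * ((b - y) / (b - a)) * w' =
     (Num.sqrt (A * B) * Num.sqrt (B / A)) * (A / (s * (y + s)) * ((b - y) / (b - a)) * w').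
    by rewrite e1; field; rewrite !gt_eqF.
  by field; rewrite !gt_eqF.
rewrite -/w' t2 t3 qE.
have -> : (1 + w ^+ 2)^-1 = (b - y) / (b - a).
  by rewrite w2; field; rewrite !gt_eqF//; lra.
have -> : w' = (2 * w ^+ 2)^-1 * ((b - a) / (b - y) ^+ 2) * w.
  by rewrite /w'; field; rewrite !gt_eqF.
have ys0 : 0 < y + s by rewrite addr_gt0.
rewrite w2 /A /B; field; rewrite !gt_eqF//.
Qed.

Lemma mp_primitive_left : mp_primitive y @[y --> a^'+] --> 0.
Proof.
have ha : half_angle y @[y --> a^'+] --> 0.
  apply: cvg_at_right_filter.
  rewrite -[X in _ --> X](_ : Num.sqrt ((a - a) / (b - a)) = 0); last first.
    by rewrite subrr mul0r sqrtr0.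
  apply: cvg_sqrt.
  apply: cvgM; first by apply: cvgB; [exact: cvg_id|exact: cvg_cst].
  apply: cvgV; first by rewrite subr_eq0 gt_eqF.
  by apply: cvgB; [exact: cvg_cst|exact: cvg_id].
have at0 k : atan (k * half_angle y) @[y --> a^'+] --> 0.
  rewrite -[X in _ --> X]atan0 -(mulr0 k).
  apply: cvg_atan.
  exact: cvgMl_tmp.
have -> : 0 = - 0 - Num.sqrt (a * b) / s * 0 + Num.sqrt (A * B) / s * 0 :> R.
  by rewrite !mulr0 subr0 oppr0 addr0.
apply: cvgD; last by apply: cvgMl_tmp.
apply: cvgB; last by apply: cvgMl_tmp.
apply: cvgN; have := at0 1; by under eq_fun do rewrite mul1r.
Qed.

Lemma mp_primitive_right :
  mp_primitive y @[y --> b^'-] -->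
  pi / 2 * ((Num.sqrt (A * B) - Num.sqrt (a * b)) / s - 1).
Proof.
have at1 k : 0 < k -> atan (k * half_angle y) @[y --> b^'-] --> pi / 2.
  move=> k0; apply: (cvg_comp _ _ _ (@cvgy_atan R)).
  have pos : \forall y \near b^'-, 0 < k * half_angle y.
    near=> y; rewrite mulr_gt0// half_angle_gt0//; apply/andP; split; near: y.
      exact: nbhs_left_gt.
    exact: nbhs_left_lt.
  apply/(gtr0_cvgV0 pos); apply: cvg_at_left_filter.
  (* The reciprocal is a function that tends to 0 at [b]. Outside []a, b[] both sides are 0, by the
     conventions for square roots and inverses, so the equality holds for all [y]. *)
  have -> : (fun y => (k * half_angle y)^-1) = (fun y => k^-1 * Num.sqrt ((b - y) / (y - a))).
    apply/funext => y; rewrite invfM /half_angle; congr (_ * _).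
    have [h|h] := leP 0 ((y - a) / (b - y)).
      by rewrite -sqrtrV// invf_div.
    rewrite ler0_sqrtr ?ltW// invr0 ler0_sqrtr// -invf_div invr_le0; exact: ltW.
  rewrite -(mulr0 k^-1); apply: cvgMl_tmp.
  rewrite -[X in _ --> X](_ : Num.sqrt ((b - b) / (b - a)) = 0); last first.
    by rewrite subrr mul0r sqrtr0.
  apply: cvg_sqrt.
  apply: cvgM; first by apply: cvgB; [exact: cvg_cst|exact: cvg_id].
  apply: cvgV; first by rewrite subr_eq0 gt_eqF.
  by apply: cvgB; [exact: cvg_id|exact: cvg_cst].
have -> : pi / 2 * ((Num.sqrt (A * B) - Num.sqrt (a * b)) / s - 1) =
  - (pi / 2) - Num.sqrt (a * b) / s * (pi / 2) + Num.sqrt (A * B) / s * (pi / 2).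
  by field; rewrite gt_eqF.
apply: cvgD; last by apply: cvgMl_tmp; apply: at1; rewrite sqrtr_gt0 divr_gt0.
apply: cvgB.
  by apply: cvgN; have := at1 1 ltr01; under eq_fun do rewrite mul1r.
have [az|an0] := eqVneq a 0.
  have -> : Num.sqrt (a * b) / s = 0 by rewrite az mul0r sqrtr0 mul0r.
  by under eq_fun do rewrite mul0r; rewrite mul0r; exact: cvg_cst.
apply: cvgMl_tmp; apply: at1; rewrite sqrtr_gt0 divr_gt0//.
by rewrite lt_def an0.
Unshelve. all: by end_near. Qed.

End Primitive.

Section MPTransform.
Variables (R : realType) (gamma : R).
Hypothesis g0 : 0 < gamma.
Local Notation lam := (@lebesgue_measure R).
Local Notation dens := (mp_density gamma).
Local Notation a := (mp_a gamma).
Local Notation b := (mp_b gamma).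

(** The Stieltjes transform at [- s], namely the positive root [G] of
    [gamma s G^2 + (s + 1 - gamma) G = 1]. *)
Definition mp_stieltjes (s : R) : R :=
  (Num.sqrt ((1 - gamma) ^+ 2 + 2 * (1 + gamma) * s + s ^+ 2) - (1 - gamma) - s)
  / (2 * gamma * s).

Lemma mp_a_ge0 : 0 <= a. Proof. exact: sqr_ge0. Qed.

Lemma mp_a_lt_b : a < b.
Proof.
have sg0 : 0 < Num.sqrt gamma by rewrite sqrtr_gt0.
by rewrite /mp_a /mp_b; nra.
Qed.

Lemma mp_abD : a + b = 2 * (1 + gamma).
Proof.
rewrite /mp_a /mp_b -{3}(sqr_sqrtr (ltW g0)); ring.
Qed.

Lemma mp_abM : a * b = (1 - gamma) ^+ 2.
Proof.
by rewrite /mp_a /mp_b -exprMn -{3}(sqr_sqrtr (ltW g0)); congr (_ ^+ 2); ring.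
Qed.

Lemma integral_mp_density_supp (f : R -> \bar R) :
  measurable_fun [set: R] f ->
  (\int[lam]_x (f x * (dens x)%:E) = \int[lam]_(x in `]a, b[) (f x * (dens x)%:E))%E.
Proof.
move=> mf; transitivity (\int[lam]_(x in `[a, b]) (f x * (dens x)%:E))%E; last first.
  apply: integral_itv_bndoo.
  apply: measurable_funTS; apply: emeasurable_funM => //.
  by apply/measurable_EFinP; exact: measurable_mp_density.
rewrite [RHS]integral_mkcond; apply: eq_integral => x _; rewrite patchE.
case: ifPn => //; rewrite notin_setE/= in_itv/= => /negP/negbTE h.
by rewrite /mp_density h mule0.
Qed.

Lemma integral_mp_density_stieltjes s : 0 < s ->
  (\int[lam]_x (((`|x| + s)^-1)%:E * (dens x)%:E) =
   (((Num.sqrt ((a + s) * (b + s)) - Num.sqrt (a * b)) / s - 1) / (2 * gamma))%:E)%E.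
Proof.
move=> s0; have a0 := mp_a_ge0; have ab := mp_a_lt_b.
have xs0 (x : R) : `|x| + s != 0 by rewrite gt_eqF// ltr_wpDl.
rewrite integral_mp_density_supp; last first.
  apply/measurable_EFinP; apply: continuous_measurable_fun => x.
  by apply: cvgV => //; apply: cvgD; [apply: cvg_norm; exact: cvg_id|exact: cvg_cst].
pose f y : R := (pi * gamma)^-1 * (Num.sqrt ((b - y) * (y - a)) / (2 * y * (y + s))).
have pi0 : 0 < pi :> R := pi_gt0 R.
transitivity (\int[lam]_(y in `]a, b[) (f y)%:E)%E.
  apply: eq_integral => y; rewrite inE/= in_itv/= => /andP[ay yb]; rewrite -EFinM; congr EFin.
  have y0 : 0 < y by apply: le_lt_trans ay.
  have ys0 : 0 < y + s by rewrite addr_gt0.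
  rewrite /mp_density !ltW//= /f ger0_norm ?ltW//.
  by move: pi pi0 => P P0; field; rewrite !gt_eqF.
pose F y : R := (pi * gamma)^-1 * mp_primitive a b s y.
have f_ge0 y : a < y < b -> 0 <= f y.
  move=> /andP[ay yb]; have y0 : 0 < y by apply: le_lt_trans ay.
  apply: mulr_ge0; first by rewrite invr_ge0; apply: mulr_ge0; exact: ltW.
  apply: divr_ge0; first exact: sqrtr_ge0.
  by apply: mulr_ge0; [apply: mulr_ge0 => //|apply: addr_ge0]; exact: ltW.
have fc y : a < y < b -> {for y, continuous f}.
  move=> /andP[ay yb]; have y0 : 0 < y by apply: le_lt_trans ay.
  apply: cvgMl_tmp; apply: cvgM.
    by apply: cvg_sqrt; apply: cvgM; apply: cvgB; (exact: cvg_cst || exact: cvg_id).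
  apply: cvgV; first by rewrite gt_eqF// mulr_gt0 ?addr_gt0// mulr_gt0.
  apply: cvgM; first by apply: cvgMl_tmp; exact: cvg_id.
  by apply: cvgD; [exact: cvg_id|exact: cvg_cst].
have Fd y : a < y < b -> is_derive y 1 F (f y).
  by move=> yab; exact: (is_deriveZ (pi * gamma)^-1 (mp_primitive_derive a0 ab s0 yab)).
have Fl : F y @[y --> a^'+] --> (pi * gamma)^-1 * 0.
  by apply: cvgMl_tmp; exact: mp_primitive_left.
have Fr : F y @[y --> b^'-] --> (pi * gamma)^-1 *
    (pi / 2 * ((Num.sqrt ((a + s) * (b + s)) - Num.sqrt (a * b)) / s - 1)).
  by apply: cvgMl_tmp; exact: mp_primitive_right.
rewrite (ge0_FTC2_oo ab f_ge0 fc Fd Fl Fr); congr EFin.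
by move: pi pi0 => P P0; field; rewrite !gt_eqF.
Qed.

(** [Num.sqrt (a * b)] is the absolute value of [1 - gamma]. For [gamma > 1] the atom at the origin
    contributes exactly what turns it into [1 - gamma], so that one formula covers both regimes. *)
Lemma integral_mp_stieltjes s : 0 < s ->
  (\int[marchenko_pastur gamma]_x ((`|x| + s)^-1)%:E = (mp_stieltjes s)%:E)%E.
Proof.
move=> s0; have xs0 (x : R) : 0 < `|x| + s by rewrite ltr_wpDl.
rewrite integral_marchenko_pastur; last 2 first.
- apply/measurable_EFinP; apply: continuous_measurable_fun => x.
  apply: cvgV; first by rewrite gt_eqF.
  by apply: cvgD; [apply: cvg_norm; exact: cvg_id|exact: cvg_cst].
- by move=> x; rewrite lee_fin invr_ge0 ltW.
rewrite integral_mp_density_stieltjes// normr0 add0r -EFinM -EFinD; congr EFin.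
rewrite mp_abM sqrtr_sqr /mp_stieltjes.
have -> : (a + s) * (b + s) = (1 - gamma) ^+ 2 + 2 * (1 + gamma) * s + s ^+ 2.
  by rewrite -mp_abM -mp_abD; ring.
set q := Num.sqrt _; rewrite /mp_atom.
case: ltP => g1.
  by rewrite ltr0_norm ?subr_lt0//; field; rewrite !gt_eqF.
by rewrite ger0_norm ?subr_ge0//; field; rewrite !gt_eqF.
Qed.

Lemma mp_stieltjes_ge0 s : 0 < s -> 0 <= mp_stieltjes s.
Proof.
move=> s0; rewrite -lee_fin -integral_mp_stieltjes//; apply: integral_ge0 => x _.
by rewrite lee_fin invr_ge0 addr_ge0// ltW.
Qed.

Lemma mp_stieltjes_quad s : 0 < s ->
  gamma * s * mp_stieltjes s ^+ 2 + (s + 1 - gamma) * mp_stieltjes s = 1.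
Proof.
move=> s0; rewrite /mp_stieltjes.
have : Num.sqrt ((1 - gamma) ^+ 2 + 2 * (1 + gamma) * s + s ^+ 2) ^+ 2 =
    (1 - gamma) ^+ 2 + 2 * (1 + gamma) * s + s ^+ 2.
  rewrite sqr_sqrtr// !addr_ge0 ?sqr_ge0// !mulr_ge0 ?(ltW s0)// addr_ge0// ltW//.
set q := Num.sqrt _ => q2.
have -> : gamma * s * ((q - (1 - gamma) - s) / (2 * gamma * s)) ^+ 2 +
  (s + 1 - gamma) * ((q - (1 - gamma) - s) / (2 * gamma * s)) =
  (q ^+ 2 - (s + 1 - gamma) ^+ 2) / (4 * gamma * s).
  by field; rewrite !gt_eqF.
by rewrite q2; field; rewrite !gt_eqF.
Qed.

(** The mass is read off the transform for large [s], from [s / (x + s) <= 1 <= (s + b) / (x + s)]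
    on the support, instead of from a second explicit primitive. *)
Lemma mp_mass : (marchenko_pastur gamma [set: R] = 1)%E.
Proof.
have b0 : 0 < b by apply: le_lt_trans mp_a_lt_b; exact: mp_a_ge0.
have mf (s : R) : 0 < s -> measurable_fun [set: R] (fun x : R => ((`|x| + s)^-1)%:E).
  move=> s0; apply/measurable_EFinP; apply: continuous_measurable_fun => x.
  apply: cvgV; first by rewrite gt_eqF// ltr_wpDl.
  by apply: cvgD; [apply: cvg_norm; exact: cvg_id|exact: cvg_cst].
have mdens : measurable_fun [set: R] (EFin \o dens).
  by apply/measurable_EFinP; exact: measurable_mp_density.
set M := marchenko_pastur gamma [set: R].
have ME : M = (\int[marchenko_pastur gamma]_x 1)%E by rewrite integral_cst// mul1e.
have lo s : 0 < s -> ((s * mp_stieltjes s)%:E <= M)%E.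
  move=> s0; rewrite EFinM -integral_mp_stieltjes// -ge0_integralZl//; last 3 first.
  - exact: mf.
  - by move=> x _; rewrite lee_fin invr_ge0 addr_ge0// ltW.
  - by rewrite lee_fin ltW.
  rewrite ME; apply: ge0_le_integral => //.
  - by move=> x _; rewrite -EFinM lee_fin mulr_ge0 ?(ltW s0)// invr_ge0 addr_ge0// ltW.
  - by apply: emeasurable_funM => //; exact: mf.
  - move=> x _; rewrite -EFinM lee_fin ler_pdivrMr ?mul1r ?lerDr//.
    by rewrite ltr_wpDl.
have hi s : 0 < s -> (M <= ((s + b) * mp_stieltjes s)%:E)%E.
  move=> s0; rewrite EFinM -integral_mp_stieltjes// -ge0_integralZl//; last 3 first.
  - exact: mf.
  - by move=> x _; rewrite lee_fin invr_ge0 addr_ge0// ltW.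
  - by rewrite lee_fin addr_ge0// ltW.
  rewrite ME !integral_marchenko_pastur//; last 2 first.
  - by apply: emeasurable_funM => //; exact: mf.
  - by move=> x; rewrite -EFinM lee_fin mulr_ge0 ?invr_ge0 ?addr_ge0 ?(ltW s0) ?(ltW b0).
  apply: leeD.
    apply: ge0_le_integral => //.
    - by move=> x _; rewrite mul1e lee_fin mp_density_ge0.
    - by apply: emeasurable_funM => //.
    - by apply: emeasurable_funM => //; apply: emeasurable_funM => //; exact: mf.
    move=> x _; rewrite -!EFinM lee_fin mul1r.
    have [h|h] := boolP ((a <= x) && (x <= b)); last first.
      by rewrite /mp_density (negbTE h) mulr0.
    rewrite ler_peMl ?mp_density_ge0//.
    have /andP[ax xb] := h; have x0 : 0 <= x by apply: le_trans ax; exact: mp_a_ge0.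
    rewrite ler_pdivlMr ?ltr_wpDl// mul1r ger0_norm//; lra.
  rewrite -!EFinM lee_fin ler_wpM2l ?mp_atom_ge0// normr0 add0r.
  by rewrite ler_pdivlMr// mul1r; lra.
have Mfin : M \is a fin_num.
  rewrite ge0_fin_numE; last by rewrite (le_trans _ (lo 1 ltr01))// lee_fin mul1r mp_stieltjes_ge0.
  by rewrite (le_lt_trans (hi 1 ltr01))// ltry.
rewrite -(fineK Mfin); congr EFin; set m := fine M.
have {}lo s : 0 < s -> s * mp_stieltjes s <= m by move=> /lo; rewrite -(fineK Mfin) lee_fin.
have {}hi s : 0 < s -> m <= (s + b) * mp_stieltjes s by move=> /hi; rewrite -(fineK Mfin) lee_fin.
have m0 : 0 <= m by apply: le_trans (lo 1 ltr01); rewrite mul1r mp_stieltjes_ge0.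
(* the quadratic equation gives [1 - s G = G (1 - gamma + gamma s G)], and [G <= m / s] *)
pose C := m * (1 + gamma + gamma * m + b).
have C0 : 0 <= C by rewrite mulr_ge0// !addr_ge0 ?mulr_ge0 ?(ltW g0) ?(ltW b0).
have key s : 0 < s -> s * `|m - 1| <= C.
  move=> s0; have := lo _ s0; have := hi _ s0; have := mp_stieltjes_quad s0.
  have := mp_stieltjes_ge0 s0; set G := mp_stieltjes s => G0 quad h1 h2.
  have e1 : s * (1 - s * G) = (s * G) * (1 - gamma + gamma * (s * G)).
    by rewrite -[X in X - _]quad; ring.
  have sG0 : 0 <= s * G by rewrite mulr_ge0 ?(ltW s0).
  have h3 : s * (m - s * G) <= m * b.
    have : m - s * G <= b * G by lra.
    move=> h4; apply: (@le_trans _ _ (s * (b * G))); first by rewrite ler_wpM2l// ltW.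
    by rewrite mulrCA mulrC ler_wpM2r// ltW.
  have e2 : s * (m - 1) = s * (m - s * G) - (s * G) * (1 - gamma + gamma * (s * G)) by rewrite -e1; ring.
  have h5 : 0 <= s * (m - s * G) by rewrite mulr_ge0 ?(ltW s0)// subr_ge0.
  have h6 : `|(s * G) * (1 - gamma + gamma * (s * G))| <= m * (1 + gamma + gamma * m).
    rewrite normrM ger0_norm//; apply: ler_pM => //.
    have h7 : gamma * (s * G) <= gamma * m by rewrite ler_wpM2l// ltW.
    have h8 : 0 <= gamma * (s * G) by rewrite mulr_ge0// ltW.
    have g00 := g0.
    move: h7 h8; move: (gamma * (s * G)) (gamma * m) => x y h7 h8.
    by rewrite ler_norml; apply/andP; split; lra.
  rewrite -[X in X * _](ger0_norm (ltW s0)) -normrM e2.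
  apply: le_trans (ler_normB _ _) _; rewrite (ger0_norm h5) /C.
  have -> : m * (1 + gamma + gamma * m + b) = m * b + m * (1 + gamma + gamma * m) by ring.
  exact: lerD.
apply/eqP; rewrite -subr_eq0 -normr_le0 leNgt; apply/negP => d0.
have := key ((C + 1) / `|m - 1|).
rewrite divr_gt0 ?ltr_wpDl// => /(_ isT).
by rewrite divfK ?gt_eqF//; lra.
Qed.

End MPTransform.

(** * Weak convergence from Stieltjes transforms *)

Section Bernstein.
Variable R : realType.
Implicit Types (phi psi : nat -> R) (x : R).

(* Bernstein polynomials: the value at [x] is the mean of [phi] under the binomial
   law of parameters [n] and [x], computed by conditioning on the first trial. *)
Fixpoint bern (n : nat) phi : {poly R} :=
  if n is m.+1 then (1 - 'X) * bern m phi + 'X * bern m (phi \o succn)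
  else (phi 0%N)%:P.

Lemma bernS n phi x : (bern n.+1 phi).[x] =
  (1 - x) * (bern n phi).[x] + x * (bern n (phi \o succn)).[x].
Proof. by rewrite /= !hornerE. Qed.

Lemma bern_le n phi psi x : 0 <= x <= 1 -> (forall k, (k <= n)%N -> phi k <= psi k) ->
  (bern n phi).[x] <= (bern n psi).[x].
Proof.
move=> /andP[x0 x1]; elim: n phi psi => [|n IHn] phi psi le.
  by rewrite !hornerC le.
rewrite !bernS lerD// ler_wpM2l ?subr_ge0//; apply: IHn => k kn.
  by rewrite le// leqW.
by rewrite /= le.
Qed.

Lemma bernB n phi psi x :
  (bern n (fun k => phi k - psi k)).[x] = (bern n phi).[x] - (bern n psi).[x].
Proof.
elim: n phi psi => [|n IHn] phi psi; first by rewrite !hornerC.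
rewrite !bernS IHn (IHn (phi \o succn) (psi \o succn)); ring.
Qed.

Lemma bern_affine n c d phi x :
  (bern n (fun k => c + d * phi k)).[x] = c + d * (bern n phi).[x].
Proof.
elim: n phi => [|n IHn] phi; first by rewrite !hornerC.
rewrite !bernS IHn (IHn (phi \o succn)); ring.
Qed.

Lemma bern_cst n c x : (bern n (fun=> c)).[x] = c.
Proof. by elim: n => [|n IHn]; rewrite ?hornerC// bernS IHn; ring. Qed.

Lemma bern_sqr n c x :
  (bern n (fun k => (k%:R - c) ^+ 2)).[x] = (n%:R * x - c) ^+ 2 + n%:R * x * (1 - x).
Proof.
elim: n c => [|n IHn] c; first by rewrite hornerC; ring.
rewrite bernS IHn.
have -> : (fun k => (k%:R - c) ^+ 2) \o succn = (fun k : nat => (k%:R - (c - 1)) ^+ 2) :> (nat -> R).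
  by apply/funext => k /=; rewrite -natr1; congr (_ ^+ 2); ring.
by rewrite IHn -natr1; ring.
Qed.

Lemma unif_continuous01 (F : R -> R) (e : R) : continuous F -> 0 < e ->
  exists2 d, 0 < d & forall x y, 0 <= x <= 1 -> 0 <= y <= 1 ->
    `|x - y| < d -> `|F x - F y| < e.
Proof.
move=> cF e0.
have cpt : compact `[0 : R, 1] by exact: segment_compact.
have cover := (compact_near_coveringP `[0 : R, 1]).1 cpt R (0^'+)
  (fun d x => forall y, `|x - y| < d -> `|F x - F y| < e).
have H x : `[0 : R, 1]%classic x -> \forall x' \near x & d \near 0^'+,
    forall y, `|x' - y| < d -> `|F x' - F y| < e.
  move=> _; have e2 : 0 < e / 2 by rewrite divr_gt0.
  have /cvgrPdist_lt /(_ _ e2) := cF x.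
  move=> /nbhs_ballP[r /= r0 Hr].
  have r2 : 0 < r / 2 by rewrite divr_gt0.
  exists (ball x (r / 2), [set d | d <= r / 2]).
    split => /=; first exact: nbhsx_ballx.
    exact: nbhs_right_le.
  move=> [x' d] [/= xx' dr] y x'y.
  have h1 : ball x r x'.
    by rewrite /ball/= in xx' *; apply: lt_le_trans xx' _; lra.
  have h2 : ball x r y.
    rewrite /ball/= in xx' *; have := ler_normD (x - x') (x' - y); rewrite addrA subrK.
    by move=> h; apply: le_lt_trans h _; lra.
  have := ler_normD (F x' - F x) (F x - F y); rewrite addrA subrK.
  move=> h; apply: le_lt_trans h _; rewrite [`|F x' - _|]distrC.
  by have := Hr _ h1; have := Hr _ h2; rewrite /=; lra.
have [d /= d0 Hd] := cover _ H.
exists (d / 2); first by rewrite divr_gt0.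
move=> x y x01 _ xy.
have d2 : 0 < d / 2 by rewrite divr_gt0.
have xI : `[0 : R, 1]%classic x by rewrite /= in_itv.
apply: (Hd (d / 2) _ d2 x xI y xy).
by rewrite /ball_/= sub0r normrN gtr0_norm//; lra.
Qed.

(** Uniform continuity handles points closer than [d]; beyond that, [C * (y - x) ^ 2] with
    [C = 2 * K / d ^ 2] exceeds the oscillation [2 * K]. The Bernstein mean of this quadratic term
    is the binomial variance, [C * x * (1 - x) / n]. *)
Lemma weierstrass01 (F : R -> R) (e : R) : continuous F -> 0 < e ->
  exists q : {poly R}, forall x, 0 <= x <= 1 -> `|F x - q.[x]| <= e.
Proof.
move=> cF e0; have e2 : 0 < e / 2 by rewrite divr_gt0.
have [K K0 FK] : exists2 K, 0 <= K & forall x, 0 <= x <= 1 -> `|F x| <= K.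
  have [d d0 Hd] := unif_continuous01 cF ltr01.
  have bnd : bounded_set (F @` `[0 : R, 1]).
    apply: compact_bounded; apply: continuous_compact; last exact: segment_compact.
    exact: continuous_subspaceT.
  have [M [_ HM]] := bnd; exists (`|M| + 1); first by rewrite addr_ge0.
  move=> x x01; apply: (HM (`|M| + 1)); last by exists x => //=; rewrite in_itv.
  by rewrite ltr_pwDr// ler_norm.
have [d d0 Hd] := unif_continuous01 cF e2.
pose C := 2 * K / d ^+ 2.
have C0 : 0 <= C by rewrite divr_ge0 ?sqr_ge0// mulr_ge0.
have Fxy x y : 0 <= x <= 1 -> 0 <= y <= 1 -> `|F x - F y| <= e / 2 + C * (y - x) ^+ 2.
  move=> x01 y01; have [xy|xy] := ltP `|x - y| d.
    apply: (le_trans (ltW (Hd _ _ x01 y01 xy))).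
    by rewrite lerDl mulr_ge0// sqr_ge0.
  apply: (@le_trans _ _ (2 * K)).
    by have := ler_normB (F x) (F y); have := FK _ x01; have := FK _ y01; lra.
  have h : d ^+ 2 <= (y - x) ^+ 2.
    by rewrite -[leRHS]real_normK ?num_real// distrC ler_sqr ?nnegrE ?(ltW d0).
  have h2 : 2 * K <= C * (y - x) ^+ 2.
    rewrite /C mulrAC ler_pdivlMr ?exprn_gt0// ler_wpM2l// mulr_ge0//.
  by apply: le_trans h2 _; rewrite lerDr ltW.
have [N NC] : exists N : nat, C / N.+1%:R <= e / 2.
  have : (fun n : nat => C * n.+1%:R^-1) @ \oo --> C * 0.
    by apply: cvgMl_tmp; exact: cvg_harmonic.
  rewrite mulr0 => /cvgr_le /(_ _ e2)[N _ HN].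
  by exists N; exact: (HN N (leqnn N)).
pose n := N.+1; have n0 : 0 < n%:R :> R by rewrite ltr0n.
exists (bern n (fun k => F (k%:R / n%:R))) => x x01.
have x0 : 0 <= x by case/andP: x01.
have x1 : x <= 1 by case/andP: x01.
have rhs : (bern n (fun k => e / 2 + C / n%:R ^+ 2 * (k%:R - n%:R * x) ^+ 2)).[x] <= e.
  rewrite bern_affine bern_sqr subrr expr0n/= add0r.
  have -> : C / n%:R ^+ 2 * (n%:R * x * (1 - x)) = C / n%:R * (x * (1 - x)).
    by field; rewrite gt_eqF.
  have h : C / n%:R * (x * (1 - x)) <= C / n%:R.
    by rewrite ler_piMr ?divr_ge0 ?(ltW n0)//; nra.
  have NC' : C / n%:R <= e / 2 by exact: NC.
  apply: (@le_trans _ _ (e / 2 + e / 2)); last by lra.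
  by rewrite lerD2l; apply: le_trans h NC'.
have kn01 k : (k <= n)%N -> 0 <= (k%:R / n%:R : R) <= 1.
  by move=> kn; rewrite divr_ge0//= ler_pdivrMr// mul1r ler_nat.
have pt k : (k <= n)%N -> `|F x - F (k%:R / n%:R)| <=
    e / 2 + C / n%:R ^+ 2 * (k%:R - n%:R * x) ^+ 2.
  move=> kn; apply: le_trans (Fxy _ _ x01 (kn01 k kn)) _.
  rewrite lerD2l le_eqVlt; apply/orP; left; apply/eqP.
  by field; rewrite gt_eqF.
have -> : F x - (bern n (fun k => F (k%:R / n%:R))).[x] =
    (bern n (fun k => F x - F (k%:R / n%:R))).[x] by rewrite bernB bern_cst.
apply: le_trans rhs; rewrite ler_norml; apply/andP; split; last first.
  by apply: bern_le => // k kn; apply: le_trans (pt k kn); exact: ler_norm.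
rewrite lerNl.
have -> : - ((bern n (fun k => F x - F (k%:R / n%:R))).[x]) =
    (bern n (fun k => 0 + -1 * (F x - F (k%:R / n%:R)))).[x].
  by rewrite bern_affine add0r mulN1r.
apply: bern_le => // k kn; rewrite add0r mulN1r; apply: le_trans (pt k kn).
by rewrite -normrN ler_norm.
Qed.

End Bernstein.

(** * Determination of a mean by finitely many values of the transform *)

Section Functionals.
Variable R : realType.
Implicit Types (f g : R -> R) (I J : (R -> R) -> R) (c e s t x : R).

Definition bounded_measurable f : Prop :=
  measurable_fun [set: R] f /\ exists K, forall x, `|f x| <= K.

(* Integration against a probability measure on the nonnegative reals of mean at
   most [K - 1]. *)
Record expectation_like (K : R) I : Prop := {
  exp_lin : forall c f g, bounded_measurable f -> bounded_measurable g ->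
    I (fun x => f x + c * g x) = I f + c * I g;
  exp_cst : forall c, I (fun=> c) = c;
  exp_near : forall c f g, 0 <= c -> bounded_measurable f -> bounded_measurable g ->
    (forall x, 0 <= x -> `|f x - g x| <= c * (1 + x)) -> `|I f - I g| <= c * K }.

(* The absolute value makes the function bounded on [R]. *)
Definition recip t (x : R) : R := (`|x| + t)^-1.

Lemma bm_cst c : bounded_measurable (fun=> c).
Proof. by split; [exact: measurable_cst|exists `|c|]. Qed.

Lemma bm_lin c f g : bounded_measurable f -> bounded_measurable g ->
  bounded_measurable (fun x => f x + c * g x).
Proof.
move=> [mf [K fK]] [mg [K' gK]]; split.
  by apply: measurable_funD => //; exact: measurable_funM.
exists (K + `|c| * K') => x; apply: le_trans (ler_normD _ _) _.
by rewrite lerD// normrM ler_wpM2l.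
Qed.

Lemma bm_mul f g : bounded_measurable f -> bounded_measurable g ->
  bounded_measurable (fun x => f x * g x).
Proof.
move=> [mf [K fK]] [mg [K' gK]]; split; first exact: measurable_funM.
exists (K * K') => x; rewrite normrM; apply: ler_pM => //.
Qed.

Lemma recip_ge0 t x : 0 < t -> 0 <= recip t x.
Proof. by move=> t0; rewrite invr_ge0 addr_ge0// ltW. Qed.

Lemma recip_le t x : 0 < t -> recip t x <= t^-1.
Proof.
by move=> t0; rewrite lef_pV2 ?posrE// ?ltr_wpDl// lerDr.
Qed.

Lemma continuous_recip t : 0 < t -> continuous (recip t).
Proof.
move=> t0 x; apply: cvgV; first by rewrite gt_eqF// ltr_wpDl.
by apply: cvgD; [apply: cvg_norm; exact: cvg_id|exact: cvg_cst].
Qed.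

Lemma bm_recip t : 0 < t -> bounded_measurable (recip t).
Proof.
move=> t0; split; first by apply: continuous_measurable_fun; exact: continuous_recip.
by exists t^-1 => x; rewrite ger0_norm ?recip_ge0// recip_le.
Qed.

Lemma recip_diff s t x : 0 < s -> 0 < t ->
  recip s x - recip t x = (t - s) * (recip s x * recip t x).
Proof.
move=> s0 t0; rewrite /recip; have xs : 0 < `|x| + s by rewrite ltr_wpDl.
have xt : 0 < `|x| + t by rewrite ltr_wpDl.
by field; rewrite !gt_eqF.
Qed.

Section Controlled.
Variables (K : R) (I : (R -> R) -> R).
Hypothesis EI : expectation_like K I.
Hypothesis K0 : 0 <= K.

(* The mean of [f] is determined, up to any error and uniformly over [J], by finitely
   many values of the Stieltjes transform. *)
Definition controlled f : Prop := forall e, 0 < e ->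
  exists2 d, 0 < d & exists2 ts : seq R, all (fun t => 0 < t) ts &
    forall J, expectation_like 2 J ->
      (forall t, t \in ts -> `|J (recip t) - I (recip t)| < d) ->
      `|J f - I f| < e.

Lemma controlled_recip t : 0 < t -> controlled (recip t).
Proof.
move=> t0 e e0; exists e => //; exists [:: t]; first by rewrite /= t0.
by move=> J _ /(_ t); apply; rewrite inE.
Qed.

Lemma controlled_cst c : controlled (fun=> c).
Proof.
move=> e e0; exists 1 => //; exists [::] => // J EJ _.
by rewrite (exp_cst EJ) (exp_cst EI) subrr normr0.
Qed.

Lemma controlled_lin c f g : bounded_measurable f -> bounded_measurable g ->
  controlled f -> controlled g -> controlled (fun x => f x + c * g x).
Proof.
move=> bf bg cf cg e e0.
have e2 : 0 < e / 2 by rewrite divr_gt0.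
have e3 : 0 < e / 2 / (`|c| + 1) by rewrite divr_gt0// ltr_wpDl.
have [d d0 [ts ts0 Hf]] := cf _ e2.
have [d' d'0 [ts' ts'0 Hg]] := cg _ e3.
exists (Num.min d d'); first by rewrite lt_min d0.
exists (ts ++ ts'); first by rewrite all_cat ts0.
move=> J EJ H; rewrite (exp_lin EJ)// (exp_lin EI)//.
have h1 : `|J f - I f| < e / 2.
  apply: Hf => // t tts; have := H t; rewrite mem_cat tts => /(_ isT).
  by rewrite lt_min => /andP[].
have h2 : `|J g - I g| < e / 2 / (`|c| + 1).
  apply: Hg => // t tts; have := H t; rewrite mem_cat tts orbT => /(_ isT).
  by rewrite lt_min => /andP[].
have -> : J f + c * J g - (I f + c * I g) = (J f - I f) + c * (J g - I g) by ring.
apply: le_lt_trans (ler_normD _ _) _; rewrite normrM.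
have h3 : `|c| * `|J g - I g| <= e / 2.
  move: h2; rewrite ltr_pdivlMr ?ltr_wpDl// => h2.
  by have := normr_ge0 (J g - I g); lra.
by lra.
Qed.

Lemma controlled_near f : bounded_measurable f ->
  (forall c, 0 < c -> exists g, [/\ bounded_measurable g, controlled g &
    forall x, 0 <= x -> `|f x - g x| <= c * (1 + x)]) -> controlled f.
Proof.
move=> bf H e e0.
(* An error [c * (1 + x)] costs [c * 2] under [J] and [c * K] under [I]; the total stays below
   [e / 2]. *)
pose c := e / 2 / (K + 3).
have c0 : 0 < c by rewrite !divr_gt0// ltr_wpDl.
have [g [bg cg fg]] := H _ c0.
have e2 : 0 < e / 2 by rewrite divr_gt0.
have [d d0 [ts ts0 Hg]] := cg _ e2.
exists d => //; exists ts => // J EJ HJ.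
have h1 := Hg J EJ HJ.
have h2 := exp_near EJ (ltW c0) bf bg fg.
have h3 := exp_near EI (ltW c0) bf bg fg.
have h4 : c * (K + 3) = e / 2 by rewrite /c divfK// gt_eqF// ltr_wpDl.
have h5 : `|J f - I f| <= `|J f - J g| + `|J g - I g| + `|I f - I g|.
  have -> : J f - I f = (J f - J g) + (J g - I g) + (I g - I f) by ring.
  apply: le_trans (ler_normD _ _) _; rewrite [`|I f - _|]distrC lerD2r.
  exact: ler_normD.
by apply: le_lt_trans h5 _; lra.
Qed.

Lemma controlled_ext f g : (forall x, f x = g x) -> controlled f -> controlled g.
Proof. by move=> fg; have -> : g = f by apply/funext. Qed.

Definition recips (ts : seq R) x : R := \prod_(t <- ts) recip t x.

Lemma recips_cons t ts x : recips (t :: ts) x = recip t x * recips ts x.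
Proof. exact: big_cons. Qed.

Lemma bm_recips ts : all (fun t => 0 < t) ts -> bounded_measurable (recips ts).
Proof.
elim: ts => [_|t ts IHts /andP[t0 ts0]].
  have -> : recips [::] = fun=> 1 by apply/funext => x; rewrite /recips big_nil.
  exact: bm_cst.
have -> : recips (t :: ts) = fun x => recip t x * recips ts x.
  by apply/funext => x; rewrite recips_cons.
by apply: bm_mul; [exact: bm_recip|exact: IHts].
Qed.

(* Partial fractions separate distinct poles; a double pole is first perturbed. *)
Lemma controlled_recips ts : all (fun t => 0 < t) ts -> controlled (recips ts).
Proof.
have [n] := ubnP (size ts); elim: n ts => [//|n IHn] [_ _|t [_ /= /andP[t0 _]|s ts]].
- by apply: (controlled_ext _ (controlled_cst 1)) => x; rewrite /recips big_nil.
- apply: (controlled_ext _ (controlled_recip t0)) => x.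
  by rewrite /recips big_cons big_nil mulr1.
rewrite ltnS /= => sz /and3P[t0 s0 ts0].
have neq a b : 0 < a -> 0 < b -> a != b -> controlled (recips [:: a, b & ts]).
  move=> a0 b0 ab.
  have cA : controlled (recips (a :: ts)) by apply: IHn => //=; rewrite a0.
  have cB : controlled (recips (b :: ts)) by apply: IHn => //=; rewrite b0.
  have bA : bounded_measurable (recips (a :: ts)) by apply: bm_recips; rewrite /= a0.
  have bB : bounded_measurable (recips (b :: ts)) by apply: bm_recips; rewrite /= b0.
  have ba : b - a != 0 by rewrite subr_eq0 eq_sym.
  have c1 := controlled_lin (- 1) bA bB cA cB.
  have b1 := bm_lin (- 1) bA bB.
  apply: (controlled_ext _ (controlled_lin (b - a)^-1 (bm_cst 0) b1 (controlled_cst 0) c1)) => x.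
  rewrite !recips_cons add0r mulN1r -mulrBl recip_diff//.
  by rewrite !mulrA mulVf// mul1r.
have [<-|] := eqVneq t s; last exact: neq.
have tts0 : all (fun t => 0 < t) [:: t, t & ts] by rewrite /= t0.
apply: controlled_near; first exact: bm_recips.
move=> c c0.
have bT : bounded_measurable (recips (t :: ts)) by apply: bm_recips; rewrite /= t0.
have [_ [M HM]] := bT.
have M0 : 0 <= M by apply: le_trans (HM 0).
(* Moving one pole by [h] changes the product by at most [h * M / t ^ 2], which is
   [c * (M / (M + 1))]. *)
pose h := c * t ^+ 2 / (M + 1).
have h0 : 0 < h by rewrite divr_gt0 ?mulr_gt0 ?exprn_gt0// ltr_wpDl.
have th0 : 0 < t + h by rewrite addr_gt0.
exists (recips [:: t + h, t & ts]); split.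
- by apply: bm_recips; rewrite /= th0 t0.
- by apply: neq => //; rewrite -subr_eq0 addrC addKr gt_eqF.
move=> x x0; rewrite ![recips [:: _, t & ts] x]recips_cons -mulrBl normrM recip_diff//.
rewrite [t + h]addrC addrK normrM (gtr0_norm h0) -mulrA.
have r1 : 0 <= recip t x * recip (h + t) x <= (t ^+ 2)^-1.
  rewrite mulr_ge0 ?recip_ge0//=; last by rewrite addrC.
  rewrite expr2 invfM ler_pM ?recip_ge0 ?recip_le//; first by rewrite addrC.
  apply: le_trans (recip_le _ _) _; first by rewrite addrC.
  by rewrite lef_pV2 ?posrE// ?lerDr ?ltW// addrC.
have /andP[r2 r3] := r1; rewrite (ger0_norm r2).
apply: (@le_trans _ _ (h * ((t ^+ 2)^-1 * M))).
  by rewrite ler_wpM2l ?(ltW h0)//; apply: ler_pM.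
have -> : h * ((t ^+ 2)^-1 * M) = c * (M / (M + 1)).
  by rewrite /h; field; rewrite !gt_eqF//; lra.
rewrite ler_wpM2l ?(ltW c0)//; apply: (@le_trans _ _ 1); last by lra.
by rewrite ler_pdivrMr ?ltr_wpDl//; lra.
Qed.

Lemma bm_horner_recip (q : {poly R}) : bounded_measurable (fun x => q.[recip 1 x]).
Proof.
elim/poly_ind: q => [|q c IHq].
  by under eq_fun do rewrite horner0; exact: bm_cst.
have -> : (fun x => (q * 'X + c%:P).[recip 1 x]) = fun x => c + 1 * (q.[recip 1 x] * recip 1 x).
  by apply/funext => x; rewrite hornerMXaddC mul1r addrC.
by apply: bm_lin; [exact: bm_cst|apply: bm_mul => //; exact: bm_recip].
Qed.

Lemma controlled_horner_recip (q : {poly R}) : controlled (fun x => q.[recip 1 x]).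
Proof.
(* The extra power makes the induction on [q] go through: each factor ['X] is absorbed into the
   exponent. *)
have H n : bounded_measurable (fun x => q.[recip 1 x] * recip 1 x ^+ n) /\
    controlled (fun x => q.[recip 1 x] * recip 1 x ^+ n); last first.
  by apply: (controlled_ext _ (H 0%N).2) => x; rewrite expr0 mulr1.
have pow k : bounded_measurable (fun x => recip 1 x ^+ k) /\ controlled (fun x => recip 1 x ^+ k).
  have E : recips (nseq k 1) = fun x => recip 1 x ^+ k.
    by apply/funext => x; rewrite /recips big_nseq -Monoid.iteropE.
  have k0 : all (fun t => 0 < t) (nseq k (1 : R)) by rewrite all_nseq ltr01 orbT.
  by rewrite -E; split; [exact: bm_recips|exact: controlled_recips].
elim/poly_ind: q n => [|q c IHq] n.
  have -> : (fun x => (0 : {poly R}).[recip 1 x] * recip 1 x ^+ n) = fun=> 0.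
    by apply/funext => x; rewrite horner0 mul0r.
  by split; [exact: bm_cst|exact: controlled_cst].
have -> : (fun x => (q * 'X + c%:P).[recip 1 x] * recip 1 x ^+ n) =
    fun x => q.[recip 1 x] * recip 1 x ^+ n.+1 + c * recip 1 x ^+ n.
  by apply/funext => x; rewrite hornerMXaddC exprS; ring.
have [b1 c1] := IHq n.+1; have [b2 c2] := pow n.
by split; [exact: bm_lin|exact: controlled_lin].
Qed.

(* With [v = 1 / (1 + x)], approximate [v * f x] by a polynomial in [v] vanishing at
   [0] and divide by [v]: the error [c * (1 + x)] is absorbed by the bounded mean. *)
Lemma controlled_continuous f K' : continuous f -> (forall x, `|f x| <= K') -> controlled f.
Proof.
move=> cf fK.
have bf : bounded_measurable f by split; [exact: continuous_measurable_fun|exists K'].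
have K'0 : 0 <= K' by apply: le_trans (fK 0).
pose F v := v * f (v^-1 - 1).
have cF : continuous F.
  (* At [v = 0] the inverse is a conventional value, but the factor [v] and the bound on [f] force
     [F] to tend to 0. *)
  move=> v; have [->|v0] := eqVneq v 0; last first.
    apply: cvgM; first exact: cvg_id.
    apply: (continuous_cvg _ (cf _)); apply: cvgB; last exact: cvg_cst.
    by apply: cvgV => //; exact: cvg_id.
  apply/cvgrPdist_lt => e e0; rewrite /F mul0r.
  have d0 : 0 < e / (K' + 1) by rewrite divr_gt0// ltr_wpDl.
  exists (e / (K' + 1)) => //= y; rewrite /= !sub0r !normrN => yd.
  rewrite normrM; apply: (@le_lt_trans _ _ (`|y| * K')); first by rewrite ler_wpM2l.
  move: yd; rewrite ltr_pdivlMr ?ltr_wpDl// => yd.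
  by apply: le_lt_trans yd; rewrite ler_wpM2l// lerDl.
apply: controlled_near => // c c0.
have c2 : 0 < c / 2 by rewrite divr_gt0.
have [q Hq] := weierstrass01 cF c2.
(* As [F 0 = 0], the constant term of [q] is at most [c / 2]. Dropping it doubles the error and
   leaves a multiple of ['X]. *)
have [r rE] : exists r : {poly R}, q = r * 'X + q.[0]%:P.
  have /factor_theorem[r] : root (q - q.[0]%:P) 0 by rewrite /root !hornerE subrr.
  rewrite subr0 => h; by exists r; rewrite -h subrK.
exists (fun x => r.[recip 1 x]); split.
- exact: bm_horner_recip.
- exact: controlled_horner_recip.
move=> x x0; pose v := recip 1 x.
have x1 : 0 < x + 1 by rewrite ltr_wpDl.
have vE : v = (x + 1)^-1 by rewrite /v /recip ger0_norm.
have v0 : 0 < v by rewrite vE invr_gt0.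
have v1 : 0 <= v <= 1 by rewrite (ltW v0) vE invf_le1//; lra.
have FE : F v = v * f x by rewrite /F vE invrK addrK.
have q0 : `|q.[0]| <= c / 2.
  by have := Hq 0; rewrite lexx ler01 /F mul0r sub0r normrN => /(_ isT).
have qE : q.[v] = r.[v] * v + q.[0] by rewrite {1}rE hornerMXaddC.
have h : v * `|f x - r.[v]| <= c.
  rewrite -[X in X * _](gtr0_norm v0) -normrM.
  have -> : v * (f x - r.[v]) = (F v - q.[v]) + q.[0] by rewrite FE qE; ring.
  by apply: le_trans (ler_normD _ _) _; have := Hq v v1; lra.
rewrite -(ler_pM2l v0); apply: le_trans h _.
by rewrite vE mulrCA [1 + x]addrC mulVf ?mulr1// gt_eqF.
Qed.

End Controlled.
End Functionals.

(** * The empirical and limiting measures as expectations *)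

Section MeasureExpectation.
Variables (R : realType) (nu : {measure set R -> \bar R}) (k : R).
Hypotheses (nuT : nu [set: R] = 1%E) (nuneg : nu `]-oo, 0[%classic = 0%E).
Hypothesis nuk : (\int[nu]_x (`|x|%:E) <= k%:E)%E.

Let bm_integrable f : bounded_measurable f -> nu.-integrable [set: R] (EFin \o f).
Proof.
move=> [mf [K fK]]; apply: measurable_bounded_integrable => //.
  by rewrite nuT ltry.
exists K; split; first exact: num_real.
by move=> M KM x _; apply: le_trans (fK x) (ltW KM).
Qed.

Lemma expectation_like_Rintegral :
  expectation_like (1 + k) (fun f => \int[nu]_x f x).
Proof.
split.
- move=> c f g bf bg; rewrite RintegralD//; last 2 first.
  + exact: bm_integrable.
  + have -> : (fun x => c * g x) = fun x => 0 + c * g x by apply/funext => x; rewrite add0r.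
    by apply: bm_integrable; apply: bm_lin => //; exact: bm_cst.
  by rewrite RintegralZl//; exact: bm_integrable.
- by move=> c; rewrite Rintegral_cst// nuT mulr1.
move=> c f g c0 bf bg fg.
have bfg : bounded_measurable (fun x => f x - g x).
  have -> : (fun x => f x - g x) = fun x => f x + (-1) * g x.
    by apply/funext => x; rewrite mulN1r.
  exact: bm_lin.
rewrite -RintegralB//; [|exact: bm_integrable..].
apply: le_trans (le_normr_Rintegral _ _) _ => //; first exact: bm_integrable.
have mfg : measurable_fun [set: R] (fun x => `|f x - g x|%:E).
  apply/measurable_EFinP; apply: measurableT_comp => //; exact: bfg.1.
have mabs : measurable_fun [set: R] (fun x : R => (`|x|)%:E).
  by apply/measurable_EFinP; exact: normr_measurable.
have le : (\int[nu]_x (`|f x - g x|%:E) <= (c * (1 + k))%:E)%E.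
  apply: (@le_trans _ _ (\int[nu]_x (c%:E * (1 + `|x|%:E)))%E).
    apply: ae_ge0_le_integral => //.
    - by move=> x _; rewrite mule_ge0// ?lee_fin// -EFinD lee_fin addr_ge0.
    - by apply: emeasurable_funM => //; apply: emeasurable_funD.
    (* The bound is known for nonnegative [x] only; the negative half line is a null set. *)
    exists (`]-oo, 0[)%classic; split => // x /= /not_implyP[_ H]; rewrite in_itv/= ltNge.
    apply/negP => x0; apply: H; rewrite -EFinD -EFinM lee_fin.
    by rewrite (ger0_norm x0) fg.
  rewrite ge0_integralZl//; last 2 first.
    - by apply: emeasurable_funD.
    - by move=> x _; rewrite -EFinD lee_fin addr_ge0.
  rewrite ge0_integralD//.
  by rewrite integral_cst// nuT mule1 EFinM EFinD lee_wpmul2l// leeD2l.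
have ge0 : (0 <= \int[nu]_x (`|f x - g x|%:E))%E by apply: integral_ge0.
rewrite -lee_fin /Rintegral fineK// ge0_fin_numE//.
by apply: le_lt_trans le _; rewrite ltry.
Qed.

End MeasureExpectation.

Section ESD.
Variables (R : realType) (p : nat) (A : 'M[R]_p).
Hypotheses (p0 : (0 < p)%N) (psdA : psd A).

Lemma integral_esd (f : R -> R) : measurable_fun [set: R] f -> (forall x, 0 <= f x) ->
  (\int[esd A]_x (f x)%:E = ((\sum_(x <- eigenvalues A) f x) / p%:R)%:E)%E.
Proof.
move=> mf f0; have mf' : measurable_fun [set: R] (EFin \o f) by apply/measurable_EFinP.
rewrite /esd ge0_integral_mscale//; last by move=> x _; rewrite lee_fin.
rewrite ge0_integral_measure_sum//; last by move=> x _; rewrite lee_fin.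
rewrite (eq_bigr (fun i : 'I__ => (f (eigenvalues A)`_i)%:E)); last first.
  by move=> i _; rewrite integral_dirac// diracT mul1e.
rewrite sumEFin -EFinM mulrC; congr (_ / _)%:E.
by rewrite [RHS](big_nth 0) big_mkord.
Qed.

(** The constant is one plus the mean of the eigenvalues, which are nonnegative and add up to the
    trace [p]. This uniform first moment replaces tightness. *)
Lemma expectation_like_esd : \tr A = p%:R ->
  expectation_like 2 (fun f => \int[esd A]_x f x).
Proof.
move=> trA; have -> : 2 = 1 + 1 :> R by [].
have p0R : p%:R != 0 :> R by rewrite pnatr_eq0 -lt0n.
apply: expectation_like_Rintegral.
- by apply: esdT => //; exact: psdA.1.
- rewrite /esd /= /mscale /= /msum big1 ?mule0// => i _.
  rewrite /= /dirac indicE memNset//= in_itv/= => xneg.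
  have : 0 <= (eigenvalues A)`_i by apply: (eigenvalues_ge0 psdA); exact: mem_nth.
  by rewrite leNgt xneg.
rewrite integral_esd//.
rewrite (eq_big_seq id); last by move=> x /(eigenvalues_ge0 psdA) x0; rewrite ger0_norm.
by rewrite sum_eigenvalues ?psdA.1// trA mulfV.
Qed.

Lemma Rintegral_esd_recip t : 0 < t ->
  \int[esd A]_x recip t x = \tr (resolvent t A) / p%:R.
Proof.
move=> t0; rewrite /Rintegral integral_esd//; last 2 first.
- exact: (bm_recip t0).1.
- by move=> x; exact: recip_ge0.
rewrite /= trace_resolventE//; congr (_ / _); apply: eq_big_seq => x.
by move=> /(eigenvalues_ge0 psdA) x0; rewrite /recip ger0_norm.
Qed.

End ESD.

Section AffineMP.
Variables (R : realType) (gamma : R).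
Hypothesis g0 : 0 < gamma.
Local Notation lam := (@lebesgue_measure R).
Local Notation dens := (mp_density gamma).
Local Notation a := (mp_a gamma).
Local Notation b := (mp_b gamma).
Local Notation mu := (affine_law (marchenko_pastur gamma) (2 / 3) (1 / 3)).

Let maff : measurable_fun [set: R] (fun y : R => 2 / 3 * y + 1 / 3).
Proof. by apply: measurable_funD => //; exact: measurable_funM. Qed.

Let mdens : measurable_fun [set: R] (EFin \o dens).
Proof. by apply/measurable_EFinP; exact: measurable_mp_density. Qed.

Lemma integral_affine_mp (f : R -> \bar R) :
  measurable_fun [set: R] f -> (forall x, 0 <= f x)%E ->
  (\int[mu]_x f x = \int[marchenko_pastur gamma]_x f (2 / 3 * x + 1 / 3)%R)%E.
Proof.
move=> mf f0; rewrite [LHS](ge0_integral_pushforward maff)//.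
Qed.

Lemma eq_integral_mp (f g : R -> \bar R) :
  measurable_fun [set: R] f -> (forall x, 0 <= f x)%E ->
  measurable_fun [set: R] g -> (forall x, 0 <= g x)%E ->
  (forall x, 0 <= x -> f x = g x) ->
  (\int[marchenko_pastur gamma]_x f x = \int[marchenko_pastur gamma]_x g x)%E.
Proof.
move=> mf f0 mg g0' fg; rewrite !integral_marchenko_pastur// fg//; congr (_ + _)%E.
apply: eq_integral => x _; rewrite /mp_density; case: ifPn => [/andP[ax _]|_].
  by rewrite fg//; apply: le_trans ax; exact: mp_a_ge0.
by rewrite !mule0.
Qed.

Lemma expectation_like_affine_mp :
  exists2 K, 0 <= K & expectation_like K (fun f => \int[mu]_x f x).
Proof.
have b0 : 0 < b by apply: le_lt_trans (mp_a_lt_b g0); exact: mp_a_ge0.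
(* The image of the right end of the support, a crude bound on the mean. *)
pose k := 2 / 3 * b + 1 / 3.
have k0 : 0 <= k by rewrite /k; lra.
exists (1 + k); first by rewrite addr_ge0.
apply: expectation_like_Rintegral.
- exact: (mp_mass g0).
- rewrite -[LHS]/(marchenko_pastur gamma ((fun y => 2 / 3 * y + 1 / 3) @^-1` `]-oo, 0[)).
  apply/eqP; rewrite eq_le measure_ge0 andbT.
  have -> : (0 = \int[marchenko_pastur gamma]_x (\1_(`]-oo, 0[%classic : set R) x)%:E)%E.
    rewrite (@eq_integral_mp _ (fun=> 0%E))//.
    - by rewrite integral0.
    - by apply/measurable_EFinP; exact: measurable_indic.
    by move=> x x0; rewrite indicE memNset//= in_itv/= ltNge x0.
  rewrite integral_indic// setIT; apply: le_measure; rewrite ?inE.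
  - by rewrite -[X in measurable X]setTI; exact: maff.
  - by [].
  - by move=> x /=; rewrite !in_itv/= => h; lra.
rewrite integral_affine_mp//; last by apply/measurable_EFinP; exact: normr_measurable.
have mn : measurable_fun [set: R] (fun x => (`|2 / 3 * x + 1 / 3|)%:E).
  by apply/measurable_EFinP; apply: measurableT_comp => //; exact: normr_measurable.
apply: (@le_trans _ _ (\int[marchenko_pastur gamma]_x k%:E)%E); last first.
  by rewrite integral_cst// mp_mass// mule1.
rewrite !integral_marchenko_pastur//; [|by move=> x; rewrite lee_fin..].
apply: leeD.
  apply: ge0_le_integral => //.
  - by move=> x _; rewrite mule_ge0// lee_fin// mp_density_ge0.
  - exact: emeasurable_funM.
  - exact: emeasurable_funM.
  move=> x _; rewrite -!EFinM lee_fin /mp_density.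
  case: ifPn => [h|_]; last by rewrite !mulr0.
  have d0 : 0 <= dens x by exact: mp_density_ge0.
  rewrite /mp_density h in d0; apply: ler_wpM2r => //.
  have /andP[ax xb] := h; have x0 : 0 <= x by apply: le_trans ax; exact: mp_a_ge0.
  by rewrite ger0_norm /k; lra.
rewrite -!EFinM lee_fin ler_wpM2l ?mp_atom_ge0// mulr0 add0r ger0_norm//.
by rewrite /k; lra.
Qed.

(** [2 / 3 * x + 1 / 3 + t] is [2 / 3] times [x + (1 + 3 * t) / 2]. *)
Lemma Rintegral_affine_mp_recip t : 0 < t ->
  \int[mu]_x recip t x = 3 / 2 * mp_stieltjes gamma ((1 + 3 * t) / 2).
Proof.
move=> t0; have s0 : 0 < (1 + 3 * t) / 2 by lra.
rewrite /Rintegral integral_affine_mp//; last 2 first.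
- by apply/measurable_EFinP; exact: (bm_recip t0).1.
- by move=> x; rewrite lee_fin recip_ge0.
have mr : measurable_fun [set: R] (fun x => ((`|x| + (1 + 3 * t) / 2)^-1)%:E).
  by apply/measurable_EFinP; exact: (bm_recip s0).1.
rewrite (@eq_integral_mp _ (fun x => (3 / 2)%:E * ((`|x| + (1 + 3 * t) / 2)^-1)%:E)%E)//.
- rewrite ge0_integralZl//; last by move=> x _; rewrite lee_fin; exact: recip_ge0.
  by rewrite integral_mp_stieltjes.
- apply/measurable_EFinP; apply: measurableT_comp maff; exact: (bm_recip t0).1.
- by move=> x; rewrite lee_fin recip_ge0.
- exact: emeasurable_funM.
- by move=> x; rewrite -EFinM lee_fin mulr_ge0//; exact: recip_ge0.
move=> x x0; rewrite -EFinM; congr EFin; rewrite /recip !ger0_norm//; last by lra.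
by field; rewrite !gt_eqF//; lra.
Qed.

End AffineMP.

(** * Coupling with a uniform grid sample *)

Lemma sum_ltn_ord (a L : nat) : (a <= L)%N -> (\sum_(b < L) (b < a)%N)%N = a.
Proof.
move=> aL; rewrite -(big_mkord xpredT (fun b => nat_of_bool (b < a)%N)).
rewrite (@big_cat_nat _ _ _ a)//= [X in (_ + X)%N]big_nat_cond [X in (_ + X)%N]big1 ?addn0.
  rewrite big_nat_cond (eq_bigr (fun=> 1%N)); last by move=> b /andP[/andP[_ ->]].
  by rewrite -big_nat_cond sum_nat_const_nat subn0 muln1.
by move=> b /andP[/andP[ab _] _]; rewrite ltnNge ab.
Qed.

Section Quantile.
Context d (T : measurableType d) (R : realType) (P : probability T R).
Variable Y : {RV P >-> R}.
Hypothesis Y0 : forall q, P (Y @^-1` [set q]) = 0%E.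

Let F x : R := fine (cdf Y x).

Let cdfE x : cdf Y x = (F x)%:E.
Proof. by rewrite /F fineK// fin_num_measure. Qed.

Let F_le x y : x <= y -> F x <= F y.
Proof. by move=> xy; rewrite -lee_fin -!cdfE; exact: cdf_nondecreasing. Qed.

Let measurable_preimage B : measurable B -> measurable (Y @^-1` B).
Proof. by move=> mB; rewrite -[X in measurable X]setTI; exact: (measurable_funP Y). Qed.

(** The quantile is the supremum of the points where the distribution function is below [c].
    Continuity from below, together with the absence of atoms, gives a value at most [c] there;
    right continuity gives at least [c]. *)
Lemma exists_quantile (c : R) : 0 < c < 1 ->
  exists q, P (Y @^-1` `]-oo, q]) = c%:E.
Proof.
move=> /andP[c0 c1].
have [x0 Fx0] : exists x, F x < c.
  have /fine_cvgP[_ /cvgr_lt /(_ _ c0)] := cvg_cdfNy0 Y.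
  by move=> [M [_ HM]]; exists (M - 1); apply: HM; rewrite ltrBlDr ltrDl.
have [x1 Fx1] : exists x, c < F x.
  have /fine_cvgP[_ /cvgr_gt /(_ _ c1)] := cvg_cdfy1 Y.
  by move=> [M [_ HM]]; exists (M + 1); apply: HM; rewrite ltrDl.
pose S := [set x | F x < c].
have supS : has_sup S.
  split; first by exists x0.
  exists x1 => x /= Fx; rewrite leNgt; apply/negP => /ltW/F_le.
  by rewrite leNgt (lt_trans Fx Fx1).
have below x : x < sup S -> F x <= c.
  rewrite -subr_gt0 => xS; have [y Fy xy] := sup_adherent xS supS.
  apply: (@le_trans _ _ (F y)); last exact: ltW.
  apply: F_le.
  by apply: ltW; apply: le_lt_trans xy; rewrite opprB subrKC.
exists (sup S); set q := sup S in below *.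
rewrite -[LHS]/(cdf Y q) cdfE; congr EFin; apply/eqP; rewrite eq_le; apply/andP; split.
  rewrite -lee_fin -cdfE /cdf.
  have -> : distribution P Y `]-oo, q] = P (Y @^-1` `]-oo, q[).
    rewrite -[LHS]/(P (Y @^-1` `]-oo, q])).
    have -> : Y @^-1` `]-oo, q] = Y @^-1` `]-oo, q[ `|` Y @^-1` [set q].
      apply/seteqP; split=> w /=; rewrite !in_itv/=.
        by rewrite le_eqVlt => /orP[/eqP|]; [right|left].
      by move=> [/ltW//|->].
    rewrite measureU//.
    + by rewrite [X in (_ + X)%E](_ : _ = 0%E) ?adde0//; exact: Y0.
    + exact: measurable_preimage.
    + by apply/seteqP; split=> // w /= []; rewrite in_itv/= => /[swap] ->; rewrite ltxx.
  pose G (n : nat) := Y @^-1` `]-oo, q - n.+1%:R^-1].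
  have UG : \bigcup_n G n = Y @^-1` `]-oo, q[.
    apply/seteqP; split=> w /=.
      move=> [n _]; rewrite /G/= !in_itv/= => h; apply: le_lt_trans h _.
      by rewrite ltrBlDr ltrDl invr_gt0.
    rewrite in_itv/= => Yq.
    have : \forall n \near \oo, (n.+1%:R^-1 : R) < q - Y w.
      by apply: (cvgr_lt _ (@cvg_harmonic R)); rewrite subr_gt0.
    move=> [n _ /(_ n (leqnn n))] h; exists n => //.
    by rewrite /G/= in_itv/= lerBrDr addrC -lerBrDr ltW.
  have mG i : measurable (G i) by exact: measurable_preimage.
  have ndG : nondecreasing_seq G.
    move=> m n mn; apply/subsetPset => w; rewrite /G/= !in_itv/= => h.
    apply: le_trans h _; rewrite lerB// lef_pV2 ?posrE// ler_nat//.
  have mUG : measurable (\bigcup_n G n) by exact: bigcup_measurable.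
  have cG := nondecreasing_cvg_mu (mu := P) mG mUG ndG.
  rewrite -UG -(cvg_lim _ cG)//; apply: lime_le; first by apply/cvg_ex; eexists; exact: cG.
  apply: nearW => n /=; rewrite -[P (G n)]/(cdf Y _) cdfE lee_fin below//.
  by rewrite ltrBlDr ltrDl invr_gt0.
rewrite leNgt; apply/negP => Fq.
have : cdf Y x @[x --> q^'+] --> cdf Y q by exact: cdf_right_continuous.
rewrite cdfE => /fine_cvgP[_ /cvgr_lt /(_ _ Fq)].
move=> [e /= e0 He].
have : F (q + e / 2) < c.
  apply: He => /=; last by rewrite ltrDl divr_gt0.
  by rewrite opprD addrA subrr sub0r normrN gtr0_norm ?divr_gt0//; lra.
move=> /(ub_le_sup supS.2); rewrite -/q leNgt ltrDl divr_gt0//.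
Qed.

Lemma exists_uniform_binning (L : nat) : (0 < L)%N ->
  exists h : R -> 'I_L, [/\ forall x y, x <= y -> (h x <= h y)%N,
    forall a, measurable (h @^-1` [set a])
    & forall a, P (Y @^-1` (h @^-1` [set a])) = (L%:R^-1)%:E].
Proof.
case: L => // L _.
have L0 : 0 < L.+1%:R :> R by rewrite ltr0n.
(* Only interior levels are requested: the distribution function may never take the values 0 and
   1. *)
have /choice[q Hq] : forall a : nat, exists q : R, (0 < a < L.+1)%N ->
    P (Y @^-1` `]-oo, q]) = (a%:R / L.+1%:R)%:E.
  move=> a.
  have [aL|aL] := boolP (0 < a < L.+1)%N; last by exists 0.
  have /andP[a0 a1] := aL.
  have aL1 : 0 < (a%:R / L.+1%:R : R) < 1.
    by rewrite divr_gt0 ?ltr0n//= ltr_pdivrMr// mul1r ltr_nat.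
  by have [q qE] := exists_quantile aL1; exists q.
have qlt a b : (0 < a)%N -> (a < b)%N -> (b < L.+1)%N -> q a < q b.
  move=> a0 ab bL; rewrite ltNge; apply/negP => qba.
  have : (P (Y @^-1` `]-oo, q b]) <= P (Y @^-1` `]-oo, q a]))%E.
    apply: le_measure; rewrite ?inE; [exact: measurable_preimage..|].
    by move=> w /=; rewrite !in_itv/= => /le_trans; apply.
  rewrite !Hq ?a0 ?(ltn_trans ab) ?bL ?(ltn_trans a0)//.
  by rewrite lee_fin ler_pM2r ?invr_gt0// ler_nat leqNgt ab.
(* Counting the quantiles strictly below [x] makes the binning visibly monotone, and its upper level
   sets are half lines, [set0] or [setT]. *)
pose cnt x := (\sum_(b < L) (q b.+1 < x)%R)%N.
have cntL x : (cnt x <= L)%N.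
  apply: (@leq_trans (\sum_(b < L) 1)%N); last by rewrite sum1_card card_ord.
  by apply: leq_sum => b _; exact: leq_b1.
have cntE a x : (a < L)%N -> (a < cnt x)%N = (q a.+1 < x).
  move=> aL; apply/idP/idP.
    apply: contraTT; rewrite -!leqNgt -leNgt => xq.
    apply: (@leq_trans (\sum_(b < L) (b < a)%N)).
      apply: leq_sum => b _; have [ba|ab] := ltnP b a; first exact: leq_b1.
      rewrite leqn0 eqb0 -leNgt; apply: le_trans xq _.
      move: ab; rewrite leq_eqVlt => /orP[/eqP ->//|ab]; apply: ltW.
      by apply: qlt => //; rewrite ltnS.
    by rewrite sum_ltn_ord// ltnW.
  move=> qx; rewrite -[X in (X <= _)%N](@sum_ltn_ord a.+1 L)//.
  apply: leq_sum => b _; have [ba|//] := ltnP b a.+1.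
  have -> // : q b.+1 < x; apply: le_lt_trans qx.
  move: ba; rewrite ltnS leq_eqVlt => /orP[/eqP ->//|ab]; apply: ltW.
  by apply: qlt => //; rewrite ltnS.
have tail a : (a <= L.+1)%N -> P (Y @^-1` [set x | (a <= cnt x)%N]) = (1 - a%:R / L.+1%:R)%:E.
  case: a => [_|a].
    by rewrite mul0r subr0 -(probability_setT P); congr (P _); apply/seteqP; split.
  rewrite ltnS leq_eqVlt => /orP[/eqP ->|aL].
    rewrite divff ?gt_eqF// subrr.
    have -> : Y @^-1` [set x | (L < cnt x)%N] = set0; last exact: measure0.
    by apply/seteqP; split => // w /=; rewrite ltnNge cntL.
  have -> : Y @^-1` [set x | (a < cnt x)%N] = ~` (Y @^-1` `]-oo, q a.+1]).
    apply/seteqP; split => w /=; rewrite cntE// in_itv/= ltNge.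
      by move/negP.
    by move=> h; apply/negP.
  rewrite probability_setC; last exact: measurable_preimage.
  by rewrite [X in (_ - X)%E](Hq a.+1).
pose h x : 'I_L.+1 := inord (cnt x).
have hE x : h x = cnt x :> nat by rewrite inordK// ltnS.
have preim a : h @^-1` [set a] = [set x | (a <= cnt x)%N] `\` [set x | (a < cnt x)%N].
  apply/seteqP; split => x /=.
    by move=> <-; rewrite hE leqnn ltnn.
  by move=> [h1 h2]; apply/val_inj/eqP; rewrite /= hE eqn_leq h1 andbT leqNgt; apply/negP.
have mtail a : (a <= L.+1)%N -> measurable [set x | (a <= cnt x)%N].
  case: a => [_|a].
    by rewrite [X in measurable X](_ : _ = setT)//; apply/seteqP; split.
  rewrite ltnS leq_eqVlt => /orP[/eqP ->|aL].
    rewrite [X in measurable X](_ : _ = set0)//; apply/seteqP; split => // w /=.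
    by rewrite ltnNge cntL.
  rewrite [X in measurable X](_ : _ = `]q a.+1, +oo[%classic)//.
  by apply/seteqP; split => w /=; rewrite cntE// in_itv/= andbT.
exists h; split.
- move=> x y xy; rewrite !hE; apply: leq_sum => b _.
  by have [bx|//] := ltP (q b.+1) x; rewrite (lt_le_trans bx xy).
- move=> a; rewrite preim; apply: measurableD; apply: mtail => //.
  by rewrite ltnW.
move=> a; rewrite preim -[Y @^-1` _]/(Y @^-1` [set x | (a <= cnt x)%N] `\` Y @^-1` [set x | (a < cnt x)%N]).
rewrite measureD; first last.
- by rewrite -ge0_fin_numE// fin_num_measure//; apply: measurable_preimage; apply: mtail; rewrite ltnW.
- by apply: measurable_preimage; apply: mtail.
- by apply: measurable_preimage; apply: mtail; rewrite ltnW.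
rewrite setIidr; last by move=> w /= /ltnW.
have aL : (a <= L.+1)%N by rewrite ltnW.
rewrite [X in (X - _)%E](tail a aL) [X in (_ - X)%E](tail a.+1 (ltn_ord a)) -EFinB; congr EFin.
by rewrite -[a.+1%:R]natr1; field; rewrite gt_eqF.
Qed.

End Quantile.

Lemma prod_EFin (R : realType) (I : Type) (s : seq I) (Q : pred I) (f : I -> R) :
  (\prod_(i <- s | Q i) (f i)%:E = (\prod_(i <- s | Q i) f i)%:E)%E.
Proof. by rewrite (big_morph EFin (id1 := 1%E) (op1 := *%E))// => x y; rewrite EFinM. Qed.

(** A strict order between bins forces the same strict order between values; when no two bins
    coincide, all signs are determined by the bins. *)
Lemma kendall_no_tie (R : realType) (p n L : nat) (x : 'I_n -> p.-tuple R)
    (s : sample p n L) : (1 < n)%N -> no_tie s ->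
  (forall k i j, (s (k, i) < s (k, j))%N -> tnth (x i) k < tnth (x j) k) ->
  kendall x = sgn_kendall R s.
Proof.
move=> n1 nt mono.
have signE k i j : i != j -> sign (tnth (x i) k - tnth (x j) k) = sgn R s k i j.
  move=> ij; rewrite /sign /sgn subr_ge0.
  have /forallP/(_ k)/forallP/(_ i)/forallP/(_ j) := nt; rewrite ij/= => sij.
  have [lt|lt|/val_inj eq] := ltngtP (s (k, i)) (s (k, j)).
  - by rewrite leNgt mono//= ltr0_sg// subr_lt0 ltr_nat.
  - by rewrite ltW ?mono//= gtr0_sg// subr_gt0 ltr_nat.
  - by rewrite eq eqxx in sij.
have n0R : n%:R != 0 :> R by rewrite pnatr_eq0 -lt0n ltnW.
have n1R : n%:R - 1 != 0 :> R by rewrite subr_eq0 pnatr_eq1 gtn_eqF.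
have binE : 'C(n, 2)%:R = n%:R * (n%:R - 1) / 2 :> R.
  have e : ('C(n, 2) * 2 = n * n.-1)%N.
    by rewrite -[2%N in LHS]/(2`!)%N bin_ffact ffactnS ffactn1.
  have : 'C(n, 2)%:R * 2 = n%:R * n.-1%:R :> R by rewrite -natrM e natrM.
  rewrite -[n.-1]subn1 (natrB _ (ltnW n1)) => <-.
  by rewrite mulfK// pnatr_eq0.
apply/matrixP => k l; rewrite !mxE binE.
pose h i j := sgn R s k i j * sgn R s l i j.
have hC i j : h j i = h i j by rewrite /h (sgnC R s k i j) (sgnC R s l i j) mulrNN.
have -> : \sum_(i < n) \sum_(j < n | (i < j)%N)
    sign (tnth (x i) k - tnth (x j) k) * sign (tnth (x i) l - tnth (x j) l) =
    \sum_(i < n) \sum_(j < n | (i < j)%N) h i j.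
  apply: eq_bigr => i _; apply: eq_bigr => j ij.
  by rewrite !signE// neq_ltn ij.
have -> : \sum_i \sum_j sgn R s k i j * sgn R s l i j =
   \sum_(i < n) \sum_(j < n | (i < j)%N) h i j + \sum_(i < n) \sum_(j < n | (j < i)%N) h i j.
  rewrite -big_split; apply: eq_bigr => i _ /=.
  rewrite (bigD1 i)//= sgnn mul0r add0r (bigID (fun j : 'I_n => (i < j)%N))/=.
  congr (_ + _); apply: eq_bigl => j; rewrite -val_eqE/=; by case: ltngtP.
have -> : \sum_(i < n) \sum_(j < n | (j < i)%N) h i j = \sum_(i < n) \sum_(j < n | (i < j)%N) h i j.
  rewrite (exchange_big_dep xpredT)//=; apply: eq_bigr => i _; apply: eq_bigr => j _.
  exact: hC.
by set S := \sum_(i < n) _; field; rewrite n0R n1R.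
Qed.

(** * From the random vectors to the uniform grid *)

Section Bridge.
Context d (T : measurableType d) (R : realType) (P : probability T R).
Variables (p n : nat) (X : 'I_n -> {RV P >-> p.-tuple R}).

Let measurable_coord i k : measurable_fun [set: T] (fun w => tnth (X i w) k).
Proof. exact: (measurableT_comp (measurable_tnth k) (measurable_funP (X i))). Qed.

(** The Kendall matrix is a function of finitely many comparisons, so any property of it is a finite
    union of measurable comparison patterns. Events about its spectrum are thus measurable without a
    study of eigenvalues as functions of the matrix. *)
Lemma measurable_kendall_event (Q : 'M[R]_p -> Prop) :
  measurable [set w | Q (kendall (fun i => X i w))].
Proof.
pose pat w := [ffun x : 'I_p * 'I_n * 'I_n =>
  0 <= tnth (X x.1.2 w) x.1.1 - tnth (X x.2 w) x.1.1].
pose sg (b : bool) : R := if b then 1 else -1.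
pose K (s : {ffun 'I_p * 'I_n * 'I_n -> bool}) : 'M[R]_p :=
  \matrix_(k, l) (('C(n, 2))%:R^-1 * \sum_(i < n) \sum_(j < n | (i < j)%N)
    sg (s (k, i, j)) * sg (s (l, i, j))).
have KE w : kendall (fun i => X i w) = K (pat w).
  apply/matrixP => k l; rewrite !mxE; congr (_ * _).
  by apply: eq_bigr => i _; apply: eq_bigr => j _; rewrite !ffunE.
have -> : [set w | Q (kendall (fun i => X i w))] =
    \bigcup_(s in [set s | Q (K s)]) (pat @^-1` [set s]).
  apply/seteqP; split=> w /=; rewrite KE.
    by move=> Qw; exists (pat w).
  by move=> [s /= Qs ->].
apply: fin_bigcup_measurable; first exact: finite_finset.
move=> s _.
have -> : pat @^-1` [set s] = \bigcap_(x in [set: 'I_p * 'I_n * 'I_n])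
    ((fun w => 0 <= tnth (X x.1.2 w) x.1.1 - tnth (X x.2 w) x.1.1) @^-1` [set s x]).
  apply/seteqP; split=> w /=.
    by move=> <- x _ /=; rewrite ffunE.
  by move=> H; apply/ffunP => x; rewrite ffunE; exact: H.
apply: fin_bigcap_measurable; first exact: finite_finset.
move=> x _; rewrite -[X in measurable X]setTI.
have mb : measurable_fun [set: T]
    (fun w => 0 <= tnth (X x.1.2 w) x.1.1 - tnth (X x.2 w) x.1.1).
  by apply: measurable_fun_ler => //; apply: measurable_funB.
exact: mb.
Qed.

Section Coupling.
Variable L : nat.
Hypotheses (n0 : (0 < n)%N) (L0 : (0 < L)%N).
Hypothesis indep : mutually_independent P (fun i w => X i w).
Hypothesis idist : identically_distributed P (fun i w => X i w).
Hypothesis cindep : forall i : 'I_n,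
  mutually_independent P (fun (k : 'I_p) w => tnth (X i w) k).
Hypothesis dens : forall (i : 'I_n) (k : 'I_p),
  has_density P (fun w => tnth (X i w) k).

(** One binning per coordinate, built from the first vector, serves all vectors by identical
    distribution, which keeps bins comparable between vectors. Independence of the vectors, then of
    their components, multiplies [p * n] probabilities [1 / L]. *)
Lemma exists_grid_coupling : exists D : T -> sample p n L,
  [/\ forall s, measurable (D @^-1` [set s]),
      forall s, P (D @^-1` [set s]) = ((#|{: sample p n L}|%:R)^-1)%:E
    & forall w k i j, (D w (k, i) < D w (k, j))%N ->
        tnth (X i w) k < tnth (X j w) k].
Proof.
pose i0 := Ordinal n0.
have /choice[h Hh] : forall k : 'I_p, exists h : R -> 'I_L,
    [/\ forall x y, x <= y -> (h x <= h y)%N,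
    forall a, measurable (h @^-1` [set a])
    & forall a, P ((fun w => tnth (X i0 w) k) @^-1` (h @^-1` [set a])) = (L%:R^-1)%:E].
  move=> k.
  pose mixY := isMeasurableFun.Build _ _ _ _ _ (measurable_coord i0 k).
  pose Y : {RV P >-> R} := HB.pack (fun w => tnth (X i0 w) k) mixY.
  apply: (exists_uniform_binning (Y := Y)) => // q.
  have [f [_ _ Hf]] := dens i0 k.
  by rewrite Hf ?integral_set1.
pose D w : sample p n L := [ffun x => h x.1 (tnth (X x.2 w) x.1)].
pose C (s : sample p n L) k i : set R := h k @^-1` [set s (k, i)].
pose B (s : sample p n L) i : set (p.-tuple R) :=
  \bigcap_(k in [set` [set: 'I_p]%SET]) ((fun v : p.-tuple R => tnth v k) @^-1` C s k i).
have mC s k i : measurable (C s k i) by have [_ mh _] := Hh k; exact: mh.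
have mcoordC s k i : measurable ((fun v : p.-tuple R => tnth v k) @^-1` C s k i).
  by rewrite -[X in measurable X]setTI; apply: measurable_tnth.
have mB s i : measurable (B s i).
  by apply: fin_bigcap_measurable; [exact: finite_finset|move=> k _].
have DE s : D @^-1` [set s] = \bigcap_(i in [set` [set: 'I_n]%SET]) (X i @^-1` B s i).
  apply/seteqP; split=> w /=.
    by move=> <- i _ k _; rewrite /C/= ffunE.
  move=> H; apply/ffunP => -[k i]; rewrite ffunE/=.
  by apply: (H i _ k); rewrite /= inE.
exists D; split.
- move=> s; rewrite DE; apply: fin_bigcap_measurable; first exact: finite_finset.
  by move=> i _; rewrite -[X in measurable X]setTI; exact: (measurable_funP (X i)).
- move=> s; rewrite DE (indep [set: 'I_n]%SET (mB s)).
  rewrite (eq_bigr (fun=> (L%:R^-1 ^+ p)%:E)); last first.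
    move=> i _.
    have -> : X i @^-1` B s i = \bigcap_(k in [set` [set: 'I_p]%SET])
        ((fun w => tnth (X i w) k) @^-1` C s k i) by [].
    rewrite (cindep i [set: 'I_p]%SET (mC s ^~ i)).
    rewrite (eq_bigr (fun=> (L%:R^-1)%:E)); last first.
      move=> k _; have [_ _ /(_ (s (k, i))) <-] := Hh k.
      exact: (idist i i0 (mcoordC s k i)).
    rewrite prod_EFin; congr EFin; rewrite prodr_const; congr (_ ^+ _).
    by rewrite cardsT card_ord.
  rewrite prod_EFin; congr EFin; rewrite prodr_const cardsT card_ord.
  by rewrite card_ffun card_prod !card_ord natrX -exprM exprVn.
- move=> w k i j; rewrite !ffunE/= ltNge; apply: contraL => /=.
  by have [mono _ _] := Hh k => /mono; rewrite -leqNgt.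
Qed.

Lemma prob_le_freq (D : T -> sample p n L) (E : set T) (B : pred (sample p n L)) :
  (forall s, measurable (D @^-1` [set s])) ->
  (forall s, P (D @^-1` [set s]) = ((#|{: sample p n L}|%:R)^-1)%:E) ->
  measurable E -> (forall w, E w -> B (D w)) ->
  (P E <= (freq R B)%:E)%E.
Proof.
move=> mD PD mE EB.
have sub : E `<=` \bigcup_(s in [set` enum B]) (D @^-1` [set s]).
  by move=> w Ew; exists (D w) => //=; rewrite mem_enum; exact: EB.
apply: le_trans (content_sub_fsum P (finite_seq _) (fun s _ => mD s) mE sub) _.
rewrite -fsbig_seq ?enum_uniq// (eq_bigr _ (fun s _ => PD s)) sumEFin lee_fin.
rewrite big_enum/= sumr_const -[leLHS]mulr_natl freqE ler_wpM2r ?invr_ge0//.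
by rewrite ler_nat cardsE.
Qed.
End Coupling.

End Bridge.

(** * Identification of the limit and conclusion *)

Section MPLimit.
Variables (R : realType) (p L : nat -> nat) (gamma : R).
Hypotheses (p0 : forall n, (2 <= n)%N -> (0 < p n)%N) (nL : forall n, (n < L n)%N).
Hypotheses (g0 : 0 < gamma) (pg : (fun n => (p n)%:R / n%:R : R) @ \oo --> gamma).

Lemma near_freq_kendall_mp (t e d : R) : 0 < t -> 0 < e -> 0 < d ->
  \forall n \near \oo,
  freq R [pred w : sample (p n) n (L n) | no_tie w &&
    (e <= `|\tr (resolvent t (sgn_kendall R w)) / (p n)%:R -
            3 / 2 * mp_stieltjes gamma ((1 + 3 * t) / 2)|)] <= d.
Proof.
move=> t0 e0 d0; set s := (1 + 3 * t) / 2; set G := mp_stieltjes gamma s.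
have s0 : 0 < s by rewrite /s; lra.
have G0 : 0 <= G by exact: mp_stieltjes_ge0.
(* The root of the limiting equation is [m = 3 * gamma * G]: a third of a Marchenko-Pastur variable
   has transform [3 * G] after rescaling, and [gamma] converts the normalization by [p] into the one
   by [n]. The equation for [m] then reduces to [gamma] times the quadratic equation of [G]. *)
have -> : 3 / 2 * G = 3 * gamma * G / (2 * gamma) by field; rewrite gt_eqF.
apply: (near_freq_kendall_resolvent p0 nL g0 pg t0 _ _ e0 d0).
  by rewrite mulr_ge0// mulr_ge0// ltW.
have quad : gamma * s * G ^+ 2 + (s + 1 - gamma) * G = 1 by exact: mp_stieltjes_quad.
have gG : 0 < 1 + gamma * G by rewrite ltr_pwDl// mulr_ge0// ltW.
have -> : 3 * gamma * G / 3 = gamma * G by field.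
have -> : (1 / 3 + t) / 2 * (3 * gamma * G) = s * gamma * G by rewrite /s; field.
apply: (mulIf (lt0r_neq0 gG)); rewrite mulrDl divfK ?gt_eqF//.
have : gamma * (gamma * s * G ^+ 2 + (s + 1 - gamma) * G) = gamma * 1 by rewrite quad.
by move=> h; lra.
Qed.

Lemma near_sum_freq_kendall_mp (ts : seq R) (e d : R) : all (fun t => 0 < t) ts ->
  0 < e -> 0 < d ->
  \forall n \near \oo,
  \sum_(t <- ts) freq R [pred w : sample (p n) n (L n) | no_tie w &&
    (e <= `|\tr (resolvent t (sgn_kendall R w)) / (p n)%:R -
            3 / 2 * mp_stieltjes gamma ((1 + 3 * t) / 2)|)] <= d.
Proof.
move=> + e0; elim: ts d => [|t ts IHts] d /=.
  by move=> _ d0; apply: nearW => n; rewrite big_nil ltW.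
move=> /andP[t0 ts0] d0; have d2 : 0 < d / 2 by rewrite divr_gt0.
have h1 := near_freq_kendall_mp t0 e0 d2.
have h2 := IHts _ ts0 d2.
near=> n; rewrite big_cons [leRHS]splitr; apply: lerD; near: n.
  exact: h1.
exact: h2.
Unshelve. all: by end_near. Qed.

End MPLimit.

Theorem theorem1 (R : realType) (gamma : R) (p : nat -> nat)
    (d : nat -> measure_display) (Omega : forall n, measurableType (d n))
    (P : forall n, probability (Omega n) R)
    (X : forall n, 'I_n -> {RV (P n) >-> (p n).-tuple R}) :
  (forall n, (2 <= n)%N -> (1 <= p n)%N) ->
  (forall n, (2 <= n)%N ->
     mutually_independent (P n) (fun i w => X n i w)) ->
  (forall n, (2 <= n)%N ->
     identically_distributed (P n) (fun i w => X n i w)) ->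
  (forall n, (2 <= n)%N -> forall i : 'I_n,
     mutually_independent (P n)
       (fun (k : 'I_(p n)) w => tnth (X n i w) k)) ->
  (forall n, (2 <= n)%N -> forall (i : 'I_n) (k : 'I_(p n)),
     has_density (P n) (fun w => tnth (X n i w) k)) ->
  0 < gamma ->
  (fun n => (p n)%:R / n%:R : R) @ \oo --> gamma ->
  weakly_cvg_in_probability P
    (fun n w => esd (kendall (fun i => X n i w)))
    (affine_law (marchenko_pastur gamma) (2 / 3) (1 / 3)).
Proof.
move=> p0 indep idist cindep dens g0 pg f cf bf eps eps0.
have [K' fK'] : exists K', forall x, `|f x| <= K'.
  have [M [_ HM]] := bf; exists (M + 1) => x; apply: HM => //; by rewrite ltrDl.
have [K K0 EI] := expectation_like_affine_mp g0.
have [e e0 [ts ts0 Hts]] := controlled_continuous EI K0 cf fK' eps0.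
(* The first summand brings the frequency of ties, at most [p * n ^ 2 / L], below [1 / n]; the
   second keeps [L] above [n] for every [n]. *)
pose L n := (p n * n ^ 3 + n.+1)%N.
have nL n : (n < L n)%N by rewrite /L addnS ltnS leq_addl.
pose mu := affine_law (marchenko_pastur gamma) (2 / 3) (1 / 3).
pose E n := [set w | eps <=
  `| \int[esd (kendall (fun i => X n i w))]_x f x - \int[mu]_x f x |].
have small (eta : R) : 0 < eta -> \forall n \near \oo, (P n (E n) <= eta%:E)%E.
  move=> eta0; have eta2 : 0 < eta / 2 by rewrite divr_gt0.
  have h1 := near_sum_freq_kendall_mp p0 nL g0 pg ts0 e0 eta2.
  have h2 : \forall n \near \oo, (n.+1%:R^-1 : R) <= eta / 4.
    by apply: (cvgr_le _ (@cvg_harmonic R)); rewrite divr_gt0.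
  near=> n.
  have n1 : (1 < n)%N by near: n; exact: nbhs_infty_gt.
  have n0 : (0 < n)%N by exact: ltnW.
  have L0 : (0 < L n)%N by apply: leq_ltn_trans (nL n).
  have [D [mD PD monoD]] := exists_grid_coupling n0 L0 (indep n n1) (idist n n1)
    (cindep n n1) (dens n n1).
  have mE : measurable (E n).
    exact: (measurable_kendall_event (X n)
      (fun A => eps <= `| \int[esd A]_x f x - \int[mu]_x f x |)).
  pose bad t : pred (sample (p n) n (L n)) := [pred w | no_tie w &&
    (e <= `|\tr (resolvent t (sgn_kendall R w)) / (p n)%:R -
            3 / 2 * mp_stieltjes gamma ((1 + 3 * t) / 2)|)].
  (* Outside the bad samples, the finitely many transform values that control [f] are all within [e]
     of their limits, which excludes the event [E n]. *)
  have EB w : E n w -> [pred s | (~~ no_tie s) || has (bad^~ s) ts] (D w).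
    rewrite /E/= => Ew; have [nt|//] := boolP (no_tie (D w)).
    apply/negPn/negP => nbad; move: Ew; apply/negP; rewrite -ltNge.
    rewrite (kendall_no_tie n1 nt (monoD w)).
    have psdK := psd_sgn_kendall R n1 (D w).
    apply: (Hts (fun f => \int[esd (sgn_kendall R (D w))]_x f x)).
      apply: expectation_like_esd => //; first exact: p0.
      rewrite /mxtrace (eq_bigr (fun=> 1)); last by move=> k _; exact: sgn_kendall_diag.
      by rewrite sumr_const card_ord.
    move=> t tts; have t0 : 0 < t by have /allP := ts0; apply.
    rewrite Rintegral_esd_recip ?p0// Rintegral_affine_mp_recip// ltNge.
    apply/negP => far; move/negP: nbad; apply; apply/hasP; exists t => //.
    by rewrite /bad/= nt.
  apply: le_trans (prob_le_freq mD PD mE EB) _; rewrite lee_fin.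
  have Om0 : (0 < #|{: sample (p n) n (L n)}|)%N by apply: card_ffun_gt0; rewrite card_ord.
  apply: le_trans (freqU R Om0 [pred s | ~~ no_tie s] [pred s | has (bad^~ s) ts]) _.
  rewrite [leRHS]splitr; apply: lerD.
    apply: le_trans (freq_ties R (p n) n L0) _.
    have nR : 0 < n%:R :> R by rewrite ltr0n.
    have LR : (p n)%:R * n%:R ^+ 3 <= (L n)%:R :> R.
      by rewrite -natrX -natrM ler_nat leq_addr.
    have pR : 0 < (p n)%:R :> R by rewrite ltr0n p0.
    apply: (@le_trans _ _ n%:R^-1).
      rewrite ler_pdivrMr ?ltr0n// [leRHS]mulrC ler_pdivlMr//.
      by apply: le_trans LR; rewrite le_eqVlt; apply/orP; left; apply/eqP; ring.
    have h3 : n.+1%:R^-1 <= eta / 4 by near: n; exact: h2.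
    (* [1 / n <= 2 / (n + 1)] reduces the bound to the harmonic sequence. *)
    apply: (@le_trans _ _ (2 * n.+1%:R^-1)); last first.
      by apply: (@le_trans _ _ (2 * (eta / 4))); [rewrite ler_wpM2l|lra].
    rewrite -[2]invrK -invfM lef_pV2 ?posrE ?mulr_gt0 ?invr_gt0//.
    by rewrite mulrC ler_pdivrMr// -natrM ler_nat muln2 -addnn -addn1 leq_add2l.
  apply: le_trans (freq_has R Om0 ts bad) _.
  exact: (near h1 n).
have Pfin n : P n (E n) \is a fin_num.
  by rewrite fin_num_measure//; exact: (measurable_kendall_event (X n)
      (fun A => eps <= `| \int[esd A]_x f x - \int[mu]_x f x |)).
apply/fine_cvgP; split; first by apply: nearW => n; exact: Pfin.
apply/cvgrPdist_le => eta eta0; near=> n.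
rewrite sub0r normrN ger0_norm ?fine_ge0//.
rewrite -lee_fin fineK; last exact: Pfin.
by near: n; exact: small.
Unshelve. all: by end_near. Qed.
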